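(* Let $S(n)$ be the best constant in the Strichartz inequality for the homogeneous Schr\''odinger equation on $\mathbb{R}^n$, $$S(n)=\sup_{f\in L^2(\mathbb{R}^n),\, f\neq 0}\frac{\|e^{-it\Delta}f\|_{L^{p(n)}(\mathbb{R}^{1+n})}}{\|f\|_{L^2(\mathbb{R}^n)}},\qquad p(n)=2+\frac4n .$$ In the case $n=1$, $p=p(1)=6$, we have $S(1)=12^{-1/12}$; in the case $n=2$, $p=p(2)=4$, we have $S(2)=2^{-1/2}$. In both cases, the Gaussian function $f_*(x)=\exp(-|x|^2)$ is a maximizer, that is, $$\|e^{-it\Delta}f_*\|_{L^{p}(\mathbb{R}\times\mathbb{R}^n)}=S(n)\,\|f_*\|_{L^2(\mathbb{R}^n)} .$$
   Context: All functions are complex valued. For $f\in L^2(\mathbb{R}^n)$, $u(t,x)=e^{-it\Delta}f(x)$ denotes the solution of $i\,\partial_t u=\Delta u$ with $u(0,x)=f(x)$, where $\Delta$ is the Laplacian in $x\in\mathbb{R}^n$; equivalently, the spatial Fourier transform of $u(t,\cdot)$ is $e^{it|\xi|^2}\widehat f(\xi)$, where $\widehat f(\xi)=\int_{\mathbb{R}^n}f(x)e^{-ix\cdot\xi}\,dx$. $L^p$ spaces are with respect to Lebesgue measure, $\|f\|_{L^p}=(\int|f|^p)^{1/p}$. *)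

(* Defs.v *)
From HB Require Import structures.
From mathcomp Require Import all_boot all_order all_algebra.
From mathcomp Require Import complex.
From mathcomp Require Import all_classical all_reals all_analysis.

Set Implicit Arguments.
Unset Strict Implicit.
Unset Printing Implicit Defensive.

Import Order.TTheory GRing.Theory Num.Theory.
Import numFieldNormedType.Exports.

Local Open Scope classical_set_scope.
Local Open Scope ring_scope.
Local Open Scope complex_scope.

(* R^n, with the sigma-algebra generated by the coordinates, that is, the
   Borel sets *)
Notation Rn R n := (n.-tuple (measurableTypeR R)).

Section lebesgue_cons.
Context (R : realType) (n : nat).
Variable mu : {sigma_finite_measure set (Rn R n) -> \bar R}.

Definition cons_Rn (x : measurableTypeR R * Rn R n) : Rn R n.+1 :=
  [tuple of x.1 :: x.2].

Lemma measurable_cons_Rn : measurable_fun [set: _] cons_Rn.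
Proof. exact: measurable_cons measurable_fst measurable_snd. Qed.

HB.instance Definition _ :=
  isMeasurableFun.Build _ _ _ _ cons_Rn measurable_cons_Rn.

(* the product measure dx_0 * mu, transported from R * R^n to R^(n+1) *)
Definition lebesgue_cons : set (Rn R n.+1) -> \bar R :=
  pushforward (lebesgue_measure \x mu)%E cons_Rn.

Let lebesgue_cons0 : lebesgue_cons set0 = 0%E.
Proof. exact: measure0. Qed.

Let lebesgue_cons_ge0 A : (0 <= lebesgue_cons A)%E.
Proof. exact: measure_ge0. Qed.

Let lebesgue_cons_sigma_additive : semi_sigma_additive lebesgue_cons.
Proof. exact: measure_semi_sigma_additive. Qed.

HB.instance Definition _ := isMeasure.Build _ _ _ lebesgue_cons
  lebesgue_cons0 lebesgue_cons_ge0 lebesgue_cons_sigma_additive.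

Let sigma_finite_lebesgue_cons : sigma_finite setT lebesgue_cons.
Proof.
have /sigma_finiteP[F [TF ndF Foo]] := sigma_finiteT (@lebesgue_measure R).
have /sigma_finiteP[G [TG ndG Goo]] := sigma_finiteT mu.
pose split_Rn (x : Rn R n.+1) : measurableTypeR R * Rn R n :=
  (thead x, [tuple of behead x]).
have msplit : measurable_fun [set: Rn R n.+1] split_Rn.
  apply/measurable_fun_pairP; split; first exact: measurable_tnth.
  exact: measurable_behead.
have split_consK : split_Rn \o cons_Rn = idfun.
  apply/funext => -[a x]; rewrite /split_Rn /= theadE; congr pair.
  exact/val_inj.
have UFG : \bigcup_k (F k `*` G k) = setT.
  rewrite -subTset => -[a x] _.
  have [i _ Fia] : (\bigcup_k F k) a by rewrite -TF.
  have [j _ Gjx] : (\bigcup_k G k) x by rewrite -TG.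
  exists (maxn i j) => //; split => /=.
    by move: a Fia; exact/subsetPset/ndF/leq_maxl.
  by move: x Gjx; exact/subsetPset/ndG/leq_maxr.
exists (fun k => split_Rn @^-1` (F k `*` G k)).
  by rewrite -preimage_bigcup UFG preimage_setT.
move=> k; have [mF Fy] := Foo k; have [mG Gy] := Goo k; split.
  by rewrite -[X in measurable X]setTI; apply: msplit => //; exact: measurableX.
rewrite /lebesgue_cons /pushforward -comp_preimage split_consK preimage_id.
by rewrite product_measure1E// lte_mul_pinfty// ge0_fin_numE.
Qed.

HB.instance Definition _ :=
  Measure_isSigmaFinite.Build _ _ _ lebesgue_cons sigma_finite_lebesgue_cons.

End lebesgue_cons.

Fixpoint lebesgue_Rn (R : realType) (n : nat) :
    {sigma_finite_measure set (Rn R n) -> \bar R} :=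
  match n with
  | 0 => (\d_ ([tuple] : Rn R 0) : {sigma_finite_measure set _ -> \bar R})
  | n'.+1 =>
    (lebesgue_cons (lebesgue_Rn R n') : {sigma_finite_measure set _ -> \bar R})
  end.

Section complex_functions.
Context d (T : measurableType d) (R : realType).
Variable mu : {measure set T -> \bar R}.
Implicit Types f : T -> R[i].

Definition cmeasurable f :=
  measurable_fun [set: T] (fun x => complex.Re (f x)) /\
  measurable_fun [set: T] (fun x => complex.Im (f x)).

Definition cintegral f : R[i] :=
  (\int[mu]_x complex.Re (f x)) +i* (\int[mu]_x complex.Im (f x)).

Definition cLnorm (p : R) f : \bar R :=
  Lnorm mu p%:E (fun x => (ComplexField.Normc.normc (f x))%:E).

Definition cLp (p : R) : set (T -> R[i]) :=
  [set f | cmeasurable f /\ (cLnorm p f < +oo)%E].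

End complex_functions.

Section schrodinger.
Context (R : realType) (n : nat).
Local Notation mu := (lebesgue_Rn R n).
Implicit Types (f g : Rn R n -> R[i]) (x xi : Rn R n).

Definition expi (t : R) : R[i] := cos t +i* sin t.

Definition dot x y : R := \sum_(i < n) tnth x i * tnth y i.

Definition fourier_integral f xi : R[i] :=
  cintegral mu (fun x => f x * expi (- dot x xi)).

(* g is the Fourier transform of f in the sense of L^2: the graph of the
   Fourier transform on L^2 is the closure in L^2 x L^2 of the graph of the
   Fourier integral on the intersection of L^1 and L^2. *)
Definition is_fourier f g :=
  [/\ cLp mu 2 f, cLp mu 2 g &
    exists f_ : nat -> Rn R n -> R[i],
      [/\ forall k, cLp mu 1 (f_ k) /\ cLp mu 2 (f_ k),
          cLnorm mu 2 (fun x => f_ k x - f x) @[k --> \oo] --> 0%E &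
          cLnorm mu 2 (fun xi => fourier_integral (f_ k) xi - g xi)
            @[k --> \oo] --> 0%E]].

(* u represents the solution with data f when, for every t, the Fourier
   transform of u(t, .) is exp(it|xi|^2) times that of f. This determines
   u(t, .) almost everywhere for every t. *)
Definition is_schrodinger f (u : measurableTypeR R * Rn R n -> R[i]) :=
  cmeasurable u /\
  exists2 fh, is_fourier f fh &
    forall t : R, is_fourier (fun x => u (t, x))
                             (fun xi => expi (t * dot xi xi) * fh xi).

(* exp(-it Delta) f as a function of (t, x). It exists for every f in L^2;
   the default value 0 is only reached when f is not in L^2. *)
Definition schrodinger f : measurableTypeR R * Rn R n -> R[i] :=
  xget (fun=> 0) [set u | is_schrodinger f u].

Definition strichartz_exponent : R := 2 + 4 / n%:R.

Definition strichartz_norm f : \bar R :=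
  cLnorm (lebesgue_measure \x mu)%E strichartz_exponent (schrodinger f).

Definition L2_nonzero : set (Rn R n -> R[i]) :=
  [set f | cLp mu 2 f /\ ~ (f = cst 0 %[ae mu])].

Definition strichartz_constant : \bar R :=
  ereal_sup [set (strichartz_norm f / cLnorm mu 2 f)%E | f in L2_nonzero].

Definition strichartz_maximizer f :=
  L2_nonzero f /\
  strichartz_norm f = (strichartz_constant * cLnorm mu 2 f)%E.

Definition gaussian : Rn R n -> R[i] := fun x => (expR (- dot x x))%:C.

End schrodinger.

Arguments strichartz_exponent : clear implicits.
Arguments strichartz_constant : clear implicits.
Arguments gaussian : clear implicits.

(* Main.v *)
(* Let k = 3 if n = 1 and k = 2 if n = 2, so that p(n) = 2k. If u has frequency
   density g, then u^k is a Fourier integral over (R^n)^k with density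
   g (x) ... (x) g, phase [t * sum |xi_j|^2 + x . sum xi_j], and
   |u|_(2k)^(2k) is the squared L^2 norm of u^k. Schur's test bounds this norm:
   the kernel obtained by integrating a Gaussian weight in (t, x) is an
   approximate Dirac mass at [sum |xi_j|^2 = T], [sum xi_j = X], and its integral
   is a k-fold convolution of the measure on the paraboloid, which for these two
   pairs (n, k) is at most a constant, pi / sqrt 3 or pi / 2 up to powers of 2 pi.
   Plancherel's theorem and Fatou's lemma extend the bound from integrable g to
   all data in L^2. The evolution of the Gaussian is explicit and attains the
   bound. *)

From HB Require Import structures.
From mathcomp Require Import all_boot all_order all_algebra.
From mathcomp Require Import complex ring lra.
From mathcomp Require Import all_classical all_reals all_analysis.
From mathcomp Require Import measurable_realfun gauss_integral.
Require Import Defs.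

Set Implicit Arguments.
Unset Strict Implicit.
Unset Printing Implicit Defensive.

Import Order.TTheory GRing.Theory Num.Theory.
Import numFieldNormedType.Exports.

Local Open Scope classical_set_scope.
Local Open Scope ring_scope.
Local Open Scope complex_scope.

Local Notation normc := ComplexField.Normc.normc.
Local Notation plane R := (measurableTypeR R * measurableTypeR R)%type.
Local Notation spacetime R n := (measurableTypeR R * Rn R n)%type.

(** * Complex-valued integrals *)

Lemma le_of_eq d (T : porderType d) (x y : T) : x = y -> (x <= y)%O.
Proof. by move=> ->. Qed.

Section squared_modulus.
Context {R : realType}.
Implicit Types z w : R[i].

Definition nsq z : R := complex.Re z ^+ 2 + complex.Im z ^+ 2.

Lemma nsq_ge0 z : 0 <= nsq z. Proof. by rewrite addr_ge0 ?sqr_ge0. Qed.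

Lemma normcE z : normc z = Num.sqrt (nsq z).
Proof. by case: z. Qed.

Lemma normc_ge0 z : 0 <= normc z.
Proof. by rewrite normcE sqrtr_ge0. Qed.

Lemma normc_sqr z : normc z ^+ 2 = nsq z.
Proof. by rewrite normcE sqr_sqrtr ?nsq_ge0. Qed.

Lemma nsqM z w : nsq (z * w) = nsq z * nsq w.
Proof. by case: z w => a b [c d]; rewrite /nsq /=; ring. Qed.

Lemma nsqN z : nsq (- z) = nsq z.
Proof. by case: z => a b; rewrite /nsq /=; ring. Qed.

Lemma nsq_conj z : nsq (conjc z) = nsq z.
Proof. by case: z => a b; rewrite /nsq /=; ring. Qed.

Lemma nsqD_parallelogram z w : nsq (z + w) + nsq (z - w) = 2 * nsq z + 2 * nsq w.
Proof. by case: z w => a b [c d]; rewrite /nsq /=; ring. Qed.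

Lemma nsqB z w :
  nsq (z - w) = nsq z + nsq w - 2 * complex.Re (z * conjc w).
Proof. by case: z w => a b [c d]; rewrite /nsq /=; ring. Qed.

Lemma nsq_expi t : nsq (expi t : R[i]) = 1.
Proof. by rewrite /nsq /= cos2Dsin2. Qed.

Lemma expiD s t : expi (s + t) = expi s * expi t :> R[i].
Proof.
by apply/eqP; rewrite /expi eq_complex /= cosD sinD; apply/andP; split; apply/eqP; ring.
Qed.

Lemma expiN t : expi (- t) = conjc (expi t) :> R[i].
Proof. by rewrite /expi /= cosN sinN. Qed.

Lemma expi0 : expi 0 = 1 :> R[i].
Proof. by rewrite /expi cos0 sin0. Qed.

Lemma nsq_real (a : R) : nsq (a%:C) = a ^+ 2.
Proof. by rewrite /nsq /= expr0n addr0. Qed.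

Lemma mul_conjc z : z * conjc z = (nsq z)%:C.
Proof. by case: z => a b; apply/eqP; rewrite eq_complex /= /nsq /=; apply/andP; split; apply/eqP; ring. Qed.

Lemma conjcM z w : conjc (z * w) = conjc z * conjc w.
Proof. by case: z w => a b [c d]; apply/eqP; rewrite eq_complex /=; apply/andP; split; apply/eqP; ring. Qed.

Lemma Re_norm z : `|complex.Re z| <= normc z.
Proof.
by rewrite normcE -sqrtr_sqr ler_wsqrtr // lerDl sqr_ge0.
Qed.

Lemma Im_norm z : `|complex.Im z| <= normc z.
Proof. by rewrite normcE -sqrtr_sqr ler_wsqrtr // lerDr sqr_ge0. Qed.

Lemma normc_le z :
  normc z <= `|complex.Re z| + `|complex.Im z|.
Proof.
rewrite normcE -[leRHS]ger0_norm ?addr_ge0// -sqrtr_sqr ler_wsqrtr //.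
rewrite /nsq -(real_normK (num_real (complex.Re z))).
rewrite -(real_normK (num_real (complex.Im z))).
have := normr_ge0 (complex.Re z); have := normr_ge0 (complex.Im z); nra.
Qed.

Lemma normcM z w : normc (z * w) =
  normc z * normc w.
Proof. by rewrite !normcE nsqM sqrtrM // nsq_ge0. Qed.

Lemma normcD z w : normc (z + w) <=
  normc z + normc w.
Proof.
rewrite !normcE -[leRHS]ger0_norm ?addr_ge0 ?sqrtr_ge0// -sqrtr_sqr ler_wsqrtr //.
rewrite sqrrD !sqr_sqrtr ?nsq_ge0// -sqrtrM ?nsq_ge0// -nsqM.
have -> : nsq (z + w) = nsq z + nsq w + 2 * complex.Re (z * conjc w).
  by case: z w => a b [c d]; rewrite /nsq /=; ring.
rewrite [leRHS]addrAC lerD2l -(mulr_natl (Num.sqrt _)) ler_pM2l//.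
rewrite (le_trans (ler_norm _))// (le_trans (Re_norm _))//.
by rewrite normcE !nsqM nsq_conj.
Qed.

End squared_modulus.

Section cmeasurable.
Context d (T : measurableType d) (R : realType).
Implicit Types f g : T -> R[i].

Lemma cmeasurableM f g :
  cmeasurable f -> cmeasurable g -> cmeasurable (fun x => f x * g x).
Proof.
move=> [mf1 mf2] [mg1 mg2]; split.
  rewrite (_ : (fun x => _) = fun x => complex.Re (f x) * complex.Re (g x) - complex.Im (f x) * complex.Im (g x)).
    by apply: measurable_funB; exact: measurable_funM.
  by apply/funext => x; case: (f x) => a b; case: (g x).
rewrite (_ : (fun x => _) = fun x => complex.Re (f x) * complex.Im (g x) + complex.Im (f x) * complex.Re (g x)).
  by apply: measurable_funD; exact: measurable_funM.
by apply/funext => x; case: (f x) => a b; case: (g x).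
Qed.

Lemma cmeasurableD f g :
  cmeasurable f -> cmeasurable g -> cmeasurable (fun x => f x + g x).
Proof.
move=> [mf1 mf2] [mg1 mg2]; split.
  rewrite (_ : (fun x => _) = fun x => complex.Re (f x) + complex.Re (g x)).
    exact: measurable_funD.
  by apply/funext => x; case: (f x) => a b; case: (g x).
rewrite (_ : (fun x => _) = fun x => complex.Im (f x) + complex.Im (g x)).
  exact: measurable_funD.
by apply/funext => x; case: (f x) => a b; case: (g x).
Qed.

Lemma cmeasurable_cst (c : R[i]) : cmeasurable (fun _ : T => c).
Proof. by split; exact: measurable_cst. Qed.

Lemma cmeasurable_conj f : cmeasurable f -> cmeasurable (fun x => conjc (f x)).
Proof.
move=> [mf1 mf2]; split.
  by rewrite (_ : (fun x => _) = fun x => complex.Re (f x))//; apply/funext => x; case: (f x).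
rewrite (_ : (fun x => _) = fun x => - complex.Im (f x)); first exact: measurableT_comp.
by apply/funext => x; case: (f x).
Qed.

Lemma cmeasurableN f : cmeasurable f -> cmeasurable (fun x => - f x).
Proof.
move=> [mf1 mf2]; split.
  rewrite (_ : (fun x => _) = fun x => - complex.Re (f x)); first exact: measurableT_comp.
  by apply/funext => x; case: (f x).
rewrite (_ : (fun x => _) = fun x => - complex.Im (f x)); first exact: measurableT_comp.
by apply/funext => x; case: (f x).
Qed.

Lemma cmeasurableB f g :
  cmeasurable f -> cmeasurable g -> cmeasurable (fun x => f x - g x).
Proof. by move=> mf mg; apply: cmeasurableD => //; exact: cmeasurableN. Qed.

Lemma cmeasurable_real (r : T -> R) : measurable_fun setT r ->
  cmeasurable (fun x => (r x)%:C).
Proof. by move=> mr; split => //=; exact: measurable_cst. Qed.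

Lemma cmeasurable_expi (r : T -> R) : measurable_fun setT r ->
  cmeasurable (fun x => expi (r x)).
Proof.
move=> mr; split => /=; (apply: measurableT_comp => //;
  apply: continuous_measurable_fun) => x; [exact: continuous_cos|exact: continuous_sin].
Qed.

Lemma measurable_nsq f : cmeasurable f -> measurable_fun setT (fun x => nsq (f x)).
Proof. by move=> [mf1 mf2]; apply: measurable_funD; exact: measurable_funX. Qed.

Lemma emeasurable_nsq f : cmeasurable f ->
  measurable_fun setT (fun x => (nsq (f x))%:E).
Proof. by move=> mf; apply/measurable_EFinP; exact: measurable_nsq. Qed.

Lemma measurable_normc f : cmeasurable f -> measurable_fun setT (fun x => normc (f x)).
Proof.
move=> mf; under eq_fun do rewrite normcE.
apply: (measurableT_comp (continuous_measurable_fun (@sqrt_continuous R))).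
exact: measurable_nsq.
Qed.

End cmeasurable.

Lemma cmeasurable_comp d1 d2 (T1 : measurableType d1) (T2 : measurableType d2)
  (R : realType) (f : T2 -> R[i]) (h : T1 -> T2) :
  measurable_fun setT h -> cmeasurable f -> cmeasurable (fun x => f (h x)).
Proof.
by move=> mh [mf1 mf2]; split; [exact: (measurableT_comp mf1)|exact: (measurableT_comp mf2)].
Qed.

Lemma integrable_scale d (T : measurableType d) (R : realType)
  (mu : {measure set T -> \bar R}) (a : R) (f : T -> R) :
  mu.-integrable setT (fun x => (f x)%:E) ->
  mu.-integrable setT (fun x => (a * f x)%:E).
Proof.
by move=> intf; under eq_fun do rewrite EFinM; exact: integrableZl.
Qed.

Section cintegrable.
Context d (T : measurableType d) (R : realType) (mu : {measure set T -> \bar R}).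
Implicit Types f g : T -> R[i].

Definition cintegrable f :=
  mu.-integrable setT (fun x => (complex.Re (f x))%:E) /\
  mu.-integrable setT (fun x => (complex.Im (f x))%:E).

Lemma cintegrable_cmeasurable f : cintegrable f -> cmeasurable f.
Proof.
by move=> [/integrableP[/measurable_EFinP mf1 _] /integrableP[/measurable_EFinP mf2 _]]; split.
Qed.

Lemma cintegrableP f :
  cintegrable f <-> cmeasurable f /\ mu.-integrable setT (fun x => (normc (f x))%:E).
Proof.
split=> [intf|[mf intf]].
  have mf := cintegrable_cmeasurable intf; split=> //.
  have [i1 i2] := intf.
  apply: (le_integrable measurableT _ _ (integrableD measurableT (integrable_abse i1) (integrable_abse i2))).
    exact/measurable_EFinP/measurable_normc.
  move=> x _ /=; rewrite lee_fin (ger0_norm (normc_ge0 _)) (ger0_norm (addr_ge0 _ _))//.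
  exact: normc_le.
case: mf => mf1 mf2; split; apply: (le_integrable measurableT _ _ intf).
- exact/measurable_EFinP.
- by move=> x _ /=; rewrite lee_fin (ger0_norm (normc_ge0 _)) Re_norm.
- exact/measurable_EFinP.
- by move=> x _ /=; rewrite lee_fin (ger0_norm (normc_ge0 _)) Im_norm.
Qed.

Lemma cintegrable_le f g : cmeasurable g -> cintegrable f ->
  (forall x, normc (g x) <= normc (f x)) -> cintegrable g.
Proof.
move=> mg /cintegrableP[mf intf] gf; apply/cintegrableP; split=> //.
apply: (le_integrable measurableT _ _ intf); first exact/measurable_EFinP/measurable_normc.
by move=> x _; rewrite /= !ger0_norm ?normc_ge0// lee_fin.
Qed.

Lemma cintegrable_dom f (h : T -> R) : cmeasurable f ->
  mu.-integrable setT (fun x => (h x)%:E) ->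
  (forall x, normc (f x) <= h x) -> cintegrable f.
Proof.
move=> mf inth fh; apply/cintegrableP; split=> //.
apply: (le_integrable measurableT _ _ inth); first exact/measurable_EFinP/measurable_normc.
move=> x _; rewrite /= lee_fin ger0_norm ?normc_ge0//.
exact: le_trans (fh x) (ler_norm _).
Qed.

Lemma cintegrableM_unit f g : cintegrable f -> cmeasurable g ->
  (forall x, nsq (g x) = 1) -> cintegrable (fun x => f x * g x).
Proof.
move=> intf mg g1; apply: (cintegrable_le _ intf).
  by apply: cmeasurableM => //; exact: cintegrable_cmeasurable.
by move=> x; rewrite normcM (normcE (g x)) g1 sqrtr1 mulr1.
Qed.

Lemma cintegrableZ (c : R[i]) f : cintegrable f -> cintegrable (fun x => c * f x).
Proof.
move=> intf; have mf := cintegrable_cmeasurable intf.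
case/cintegrableP : intf => _ intf.
apply: (cintegrable_dom (h := fun x => normc c * normc (f x))).
- by apply: cmeasurableM => //; exact: cmeasurable_cst.
- under eq_fun do rewrite EFinM.
  exact: integrableZl.
- by move=> x; rewrite normcM.
Qed.

Lemma cintegrableD f g : cintegrable f -> cintegrable g ->
  cintegrable (fun x => f x + g x).
Proof.
move=> [f1 f2] [g1 g2]; split.
  under eq_fun do rewrite raddfD EFinD; exact: integrableD.
under eq_fun do rewrite raddfD EFinD; exact: integrableD.
Qed.

Lemma cintegrableN f : cintegrable f -> cintegrable (fun x => - f x).
Proof.
move=> [f1 f2]; split; under eq_fun do rewrite raddfN EFinN; exact: integrableN.
Qed.

Lemma cintegrableB f g : cintegrable f -> cintegrable g ->
  cintegrable (fun x => f x - g x).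
Proof. by move=> intf intg; apply: cintegrableD => //; exact: cintegrableN. Qed.

Lemma cintegrable_conj f : cintegrable f -> cintegrable (fun x => conjc (f x)).
Proof.
move=> [f1 f2]; split.
  by rewrite (_ : (fun x => _) = fun x => (complex.Re (f x))%:E)//; apply/funext => x; case: (f x).
rewrite (_ : (fun x => _) = fun x => (- (complex.Im (f x))%:E)%E); first exact: integrableN.
by apply/funext => x; case: (f x).
Qed.

Lemma eq_cintegral g f : f =1 g -> cintegral mu f = cintegral mu g.
Proof. by move=> /funext ->. Qed.

Lemma cintegralD f g : cintegrable f -> cintegrable g ->
  cintegral mu (fun x => f x + g x) = cintegral mu f + cintegral mu g.
Proof.
move=> [f1 f2] [g1 g2]; apply/eqP; rewrite eq_complex /=; apply/andP; split; apply/eqP.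
  under eq_Rintegral do rewrite raddfD /=; exact: RintegralD.
under eq_Rintegral do rewrite raddfD /=; exact: RintegralD.
Qed.

Lemma cintegralZ (c : R[i]) f : cintegrable f ->
  cintegral mu (fun x => c * f x) = c * cintegral mu f.
Proof.
case: c => a b [f1 f2]; apply/eqP; rewrite eq_complex /=; apply/andP; split; apply/eqP.
  rewrite (@eq_Rintegral _ _ _ _ _ (fun x => a * complex.Re (f x) - b * complex.Im (f x))); last first.
    by move=> x _; case: (f x).
  rewrite RintegralB ?RintegralZl//.
    exact: integrable_scale.
  exact: integrable_scale.
rewrite (@eq_Rintegral _ _ _ _ _ (fun x => a * complex.Im (f x) + b * complex.Re (f x))); last first.
  by move=> x _; case: (f x).
rewrite RintegralD ?RintegralZl//.
  exact: integrable_scale.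
exact: integrable_scale.
Qed.

Lemma cintegralZr (c : R[i]) f : cintegrable f ->
  cintegral mu (fun x => f x * c) = cintegral mu f * c.
Proof.
by move=> intf; rewrite mulrC -cintegralZ//; apply: eq_cintegral => x; rewrite mulrC.
Qed.

Lemma cintegralN f : cintegrable f ->
  cintegral mu (fun x => - f x) = - cintegral mu f.
Proof.
by move=> intf; rewrite -mulN1r -cintegralZ//; apply: eq_cintegral => x; rewrite mulN1r.
Qed.

Lemma cintegralB f g : cintegrable f -> cintegrable g ->
  cintegral mu (fun x => f x - g x) = cintegral mu f - cintegral mu g.
Proof.
move=> intf intg; rewrite cintegralD ?cintegralN//; exact: cintegrableN.
Qed.

Lemma cintegral_conj f : cintegrable f ->
  cintegral mu (fun x => conjc (f x)) = conjc (cintegral mu f).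
Proof.
move=> [f1 f2]; apply/eqP; rewrite eq_complex /=; apply/andP; split; apply/eqP.
  by apply: eq_Rintegral => x _; case: (f x).
rewrite -mulN1r -RintegralZl//; apply: eq_Rintegral => x _.
by case: (f x) => a b; rewrite mulN1r.
Qed.

Lemma cintegral_real (r : T -> R) :
  cintegral mu (fun x => (r x)%:C) = (\int[mu]_x r x)%:C.
Proof.
by rewrite /cintegral /= /Rintegral/= integral0.
Qed.

End cintegrable.

Section fubini_real.
Context d1 d2 (T1 : measurableType d1) (T2 : measurableType d2) (R : realType).
Variables (m1 : {sigma_finite_measure set T1 -> \bar R})
  (m2 : {sigma_finite_measure set T2 -> \bar R}).

Lemma measurable_Rintegral2 (f : T1 * T2 -> R) : measurable_fun setT f ->
  measurable_fun setT (fun x => \int[m2]_y f (x, y)).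
Proof.
move=> mf; apply: measurableT_comp => //.
under eq_fun do rewrite integralE.
apply: emeasurable_funB.
  rewrite [X in measurable_fun _ X](_ : _ = fubini_F m2 (EFin \o f)^\+%E); last first.
    by apply/funext => x; apply: eq_integral => y _; rewrite !funeposE.
  apply: measurable_fun_fubini_tonelli_F => //; apply: measurable_funepos; exact/measurable_EFinP.
rewrite [X in measurable_fun _ X](_ : _ = fubini_F m2 (EFin \o f)^\-%E); last first.
    by apply/funext => x; apply: eq_integral => y _; rewrite !funenegE.
  apply: measurable_fun_fubini_tonelli_F => //; apply: measurable_funeneg; exact/measurable_EFinP.
Qed.

Lemma integrable_swap (f : T1 * T2 -> R) :
  (m1 \x m2)%E.-integrable setT (EFin \o f) ->
  (m2 \x m1)%E.-integrable setT (EFin \o f \o (fun z => (z.2, z.1))).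
Proof.
move=> intf; have mf : measurable_fun setT f by case/integrableP : (intf) => /measurable_EFinP.
apply/integrable12ltyP.
  apply/measurable_EFinP; apply: measurableT_comp => //.
  by apply/measurable_fun_pairP; split; [exact: measurable_snd|exact: measurable_fst].
by apply/(integrable21ltyP _ _ _).1 => //; exact/measurable_EFinP.
Qed.

End fubini_real.

Lemma measurable_Rintegral1 d1 d2 (T1 : measurableType d1) (T2 : measurableType d2)
  (R : realType) (m1 : {sigma_finite_measure set T1 -> \bar R}) (f : T1 * T2 -> R) :
  measurable_fun setT f -> measurable_fun setT (fun y => \int[m1]_x f (x, y)).
Proof.
move=> mf; apply: (measurable_Rintegral2 m1 (f := fun z => f (z.2, z.1))).
apply: (measurableT_comp mf).
by apply/measurable_fun_pairP; split; [exact: measurable_snd|exact: measurable_fst].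
Qed.

Section fubini_complex.
Context d1 d2 (T1 : measurableType d1) (T2 : measurableType d2) (R : realType).
Variables (m1 : {sigma_finite_measure set T1 -> \bar R})
  (m2 : {sigma_finite_measure set T2 -> \bar R}).

Lemma cmeasurable_cintegral2 (f : T1 * T2 -> R[i]) : cmeasurable f ->
  cmeasurable (fun x => cintegral m2 (fun y => f (x, y))).
Proof.
move=> [mf1 mf2]; split => /=.
  exact: (measurable_Rintegral2 m2 (f := fun z => complex.Re (f z))).
exact: (measurable_Rintegral2 m2 (f := fun z => complex.Im (f z))).
Qed.

Lemma cmeasurable_cintegral1 (f : T1 * T2 -> R[i]) : cmeasurable f ->
  cmeasurable (fun y => cintegral m1 (fun x => f (x, y))).
Proof.
move=> [mf1 mf2]; split => /=.
  exact: (measurable_Rintegral1 m1 (f := fun z => complex.Re (f z))).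
exact: (measurable_Rintegral1 m1 (f := fun z => complex.Im (f z))).
Qed.

Section integrable.
Variable f : T1 * T2 -> R.
Hypothesis intf : (m1 \x m2)%E.-integrable setT (EFin \o f).

Let mf : measurable_fun setT f.
Proof. by case/integrableP : intf => /measurable_EFinP. Qed.

Lemma integrable_Rintegral2 :
  m1.-integrable setT (fun x => (\int[m2]_y f (x, y))%:E).
Proof.
apply: (le_integrable measurableT _ _ (integrable_fubini_F intf)).
  exact/measurable_EFinP/measurable_Rintegral2.
by move=> x _; rewrite /Rintegral /fubini_F /=; case: integral => [r| |] //=; rewrite ?normr0 ?leey.
Qed.

Lemma integrable_Rintegral1 :
  m2.-integrable setT (fun y => (\int[m1]_x f (x, y))%:E).
Proof.
apply: (le_integrable measurableT _ _ (integrable_fubini_F (integrable_swap intf))).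
  exact/measurable_EFinP/measurable_Rintegral1.
by move=> x _; rewrite /Rintegral /fubini_F /=; case: integral => [r| |] //=; rewrite ?normr0 ?leey.
Qed.

Lemma Rfubini2 :
  \int[m1]_x (\int[m2]_y f (x, y)) = \int[(m1 \x m2)%E]_z f z.
Proof.
rewrite [RHS]/Rintegral -integral12_prod_meas1//.
rewrite {1}/Rintegral; congr fine.
apply: ae_eq_integral => //.
- exact/measurable_EFinP/measurable_Rintegral2.
- by apply: (measurable_fubini_F intf).
- have := integrable_ae measurableT (integrable_fubini_F intf).
  apply: filterS => x /(_ I) xfin _.
  by rewrite /Rintegral fineK.
Qed.

Lemma Rfubini1 :
  \int[m2]_y (\int[m1]_x f (x, y)) = \int[(m1 \x m2)%E]_z f z.
Proof.
rewrite [RHS]/Rintegral -integral21_prod_meas1//.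
rewrite {1}/Rintegral; congr fine.
apply: ae_eq_integral => //.
- exact/measurable_EFinP/measurable_Rintegral1.
- by apply: (measurable_fubini_G intf).
- have := integrable_ae measurableT (integrable_fubini_F (integrable_swap intf)).
  apply: filterS => x /(_ I) xfin _.
  by rewrite /Rintegral fineK.
Qed.

End integrable.

Section cintegrable.
Variable f : T1 * T2 -> R[i].
Hypothesis intf : cintegrable (m1 \x m2)%E f.

Lemma cintegrable_cintegral2 :
  cintegrable m1 (fun x => cintegral m2 (fun y => f (x, y))).
Proof.
case: intf => f1 f2; split => /=.
  exact: (integrable_Rintegral2 (f := fun z => complex.Re (f z))).
exact: (integrable_Rintegral2 (f := fun z => complex.Im (f z))).
Qed.

Lemma cintegrable_cintegral1 :
  cintegrable m2 (fun y => cintegral m1 (fun x => f (x, y))).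
Proof.
case: intf => f1 f2; split => /=.
  exact: (integrable_Rintegral1 (f := fun z => complex.Re (f z))).
exact: (integrable_Rintegral1 (f := fun z => complex.Im (f z))).
Qed.

Lemma cfubini2 :
  cintegral m1 (fun x => cintegral m2 (fun y => f (x, y))) = cintegral (m1 \x m2)%E f.
Proof.
case: intf => f1 f2; rewrite /cintegral /=; congr (_ +i* _).
  exact: (Rfubini2 (f := fun z => complex.Re (f z))).
exact: (Rfubini2 (f := fun z => complex.Im (f z))).
Qed.

Lemma cfubini1 :
  cintegral m2 (fun y => cintegral m1 (fun x => f (x, y))) = cintegral (m1 \x m2)%E f.
Proof.
case: intf => f1 f2; rewrite /cintegral /=; congr (_ +i* _).
  exact: (Rfubini1 (f := fun z => complex.Re (f z))).
exact: (Rfubini1 (f := fun z => complex.Im (f z))).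
Qed.

End cintegrable.

Lemma integrable_prod (f : T1 -> R) (g : T2 -> R) :
  m1.-integrable setT (fun x => (f x)%:E) ->
  m2.-integrable setT (fun y => (g y)%:E) ->
  (m1 \x m2)%E.-integrable setT (fun z => (f z.1 * g z.2)%:E).
Proof.
move=> intf intg.
have mf : measurable_fun setT f by case/integrableP : intf => /measurable_EFinP.
have mg : measurable_fun setT g by case/integrableP : intg => /measurable_EFinP.
apply/integrable12ltyP.
  apply/measurable_EFinP; apply: measurable_funM; exact: measurableT_comp.
rewrite (_ : (\int[m1]_x _)%E = (\int[m1]_x `|(f x)%:E| * \int[m2]_y `|(g y)%:E|)%E).
  case/integrableP : intf => _ ?; case/integrableP : intg => _ ?.
  by apply: lte_mul_pinfty => //; [exact: integral_ge0|rewrite ge0_fin_numE//; exact: integral_ge0].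
rewrite -ge0_integralZr//.
- apply: eq_integral => x _; rewrite -ge0_integralZl//.
  + by apply: eq_integral => y _; rewrite /= normrM EFinM.
  + by apply: measurableT_comp => //; exact/measurable_EFinP.
- by apply: measurableT_comp => //; exact/measurable_EFinP.
- exact: integral_ge0.
Qed.

Lemma cintegrable_prod (f : T1 -> R[i]) (g : T2 -> R[i]) :
  cintegrable m1 f -> cintegrable m2 g ->
  cintegrable (m1 \x m2)%E (fun z => f z.1 * g z.2).
Proof.
move=> intf intg.
have mf := cintegrable_cmeasurable intf.
have mg := cintegrable_cmeasurable intg.
apply: (cintegrable_dom (h := fun z => normc (f z.1) * normc (g z.2))).
- by apply: cmeasurableM; exact: cmeasurable_comp.
- case/cintegrableP : intf => _ intf; case/cintegrableP : intg => _ intg.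
  exact: (integrable_prod intf intg).
- by move=> z; rewrite normcM.
Qed.

Lemma cintegral_prod (f : T1 -> R[i]) (g : T2 -> R[i]) :
  cintegrable m1 f -> cintegrable m2 g ->
  cintegral (m1 \x m2)%E (fun z => f z.1 * g z.2) = cintegral m1 f * cintegral m2 g.
Proof.
move=> intf intg; rewrite -cfubini2/=; last exact: cintegrable_prod.
rewrite -cintegralZr//; apply: eq_cintegral => x.
by rewrite cintegralZ.
Qed.

End fubini_complex.

(** * Gaussian integrals *)

Definition affine_map {R : realType} (c b : R) (x : measurableTypeR R) :
  measurableTypeR R := c * x + b.

Lemma measurable_affine_map {R : realType} (c b : R) :
  measurable_fun [set: measurableTypeR R] (affine_map c b).
Proof. by apply: measurable_funD => //; exact: measurable_funM. Qed.

Definition affine_image {R : realType} (c b : R) :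
  {measure set (measurableTypeR R) -> \bar R}.
Proof.
refine (pushforward (@lebesgue_measure R) (affine_map c b) : {measure set _ -> \bar R}).
exact: measurable_affine_map.
Defined.

Definition reflection_image {R : realType} :
  {measure set (measurableTypeR R) -> \bar R}.
Proof.
refine (pushforward (@lebesgue_measure R) (-%R : _ -> measurableTypeR R) : {measure set _ -> \bar R}).
exact: oppr_measurable.
Defined.

Section affine_change_of_variables.
Context {R : realType}.
Local Notation leb := (@lebesgue_measure R).
Variables (c b : R).
Hypothesis c0 : 0 < c.
Local Notation phi := (affine_map c b).
Let mphi := measurable_affine_map c b.

Lemma lebesgue_measure_affine (A : set (measurableTypeR R)) : measurable A ->
  leb A = mscale (NngNum (ltW c0)) (affine_image c b) A.
Proof.
move=> mA; apply: lebesgue_measure_unique => // _ [[u v]] _ <-.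
rewrite [RHS]/= /mscale /= /pushforward -[X in _ = (_ * X)%E]/(leb (phi @^-1` `]u, v])).
have -> : phi @^-1` [set` Interval (BRight u) (BRight v)] =
    [set` Interval (BRight ((u - b) / c)) (BRight ((v - b) / c))].
  apply/seteqP; split=> x /=; rewrite !in_itv /= /affine_map.
    by rewrite ltr_pdivrMr// ler_pdivlMr// ltrBlDr lerBrDr mulrC.
  by rewrite ltr_pdivrMr// ler_pdivlMr// ltrBlDr lerBrDr mulrC.
rewrite !lebesgue_measure_itv /= !lte_fin ltr_pM2r ?invr_gt0// ltrD2r.
case: ifPn => _; last by rewrite mule0.
rewrite -!EFinB -EFinM; congr EFin.
by field; rewrite gt_eqF.
Qed.

Lemma ge0_integral_affine (f : R -> \bar R) : measurable_fun setT f ->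
  (forall x, 0 <= f x)%E ->
  (\int[leb]_x f (c * x + b)%R = (c^-1)%:E * \int[leb]_x f x)%E.
Proof.
move=> mf f0.
have -> : (\int[leb]_x f x = c%:E * \int[leb]_x f (c * x + b)%R)%E.
  rewrite (eq_measure_integral (mscale (NngNum (ltW c0)) (affine_image c b))); last first.
    by move=> A mA _; exact: lebesgue_measure_affine.
  rewrite ge0_integral_mscale//=; congr (_ * _)%E.
  by rewrite ge0_integral_pushforward//; exact: measurable_affine_map.
by rewrite muleA -EFinM mulVf ?mul1e// gt_eqF.
Qed.

Lemma Rintegral_affine (f : R -> R) : leb.-integrable setT (EFin \o f) ->
  \int[leb]_x f (c * x + b)%R = c^-1 * \int[leb]_x f x.
Proof.
move=> intf; have mf := measurable_int _ intf.
rewrite /Rintegral integralE [in RHS]integralE.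
have -> : (\int[leb]_x (fun x => (f (c * x + b)%R)%:E)^\+ x =
   (c^-1)%:E * \int[leb]_x (fun x => (f x)%:E)^\+ x)%E.
  rewrite -(ge0_integral_affine (f := (fun x => (f x)%:E)^\+%E))//; last exact: measurable_funepos.
  by apply: eq_integral => x _; rewrite !funeposE.
have -> : (\int[leb]_x (fun x => (f (c * x + b)%R)%:E)^\- x =
   (c^-1)%:E * \int[leb]_x (fun x => (f x)%:E)^\- x)%E.
  rewrite -(ge0_integral_affine (f := (fun x => (f x)%:E)^\-%E))//; last exact: measurable_funeneg.
  by apply: eq_integral => x _; rewrite !funenegE.
have fp := integrable_pos_fin_num measurableT intf.
have fn := integrable_neg_fin_num measurableT intf.
by rewrite -muleBr ?fin_num_adde_defr// fineM// fin_numB fp.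
Qed.

Lemma integrable_affine (f : R -> R) : leb.-integrable setT (EFin \o f) ->
  leb.-integrable setT (fun x => (f (c * x + b)%R)%:E).
Proof.
move=> /integrableP[mf foo]; apply/integrableP; split.
  by apply: (measurableT_comp mf); exact: mphi.
rewrite (ge0_integral_affine (f := fun x => `|(f x)%:E|%E))//.
  by rewrite lte_mul_pinfty// lee_fin invr_ge0 ltW.
exact: measurableT_comp.
Qed.

End affine_change_of_variables.

Section reflection.
Context {R : realType}.
Local Notation leb := (@lebesgue_measure R).

Lemma ge0_integral_opp (f : R -> \bar R) : measurable_fun setT f ->
  (forall x, 0 <= f x)%E ->
  (\int[leb]_x f (- x)%R = \int[leb]_x f x)%E.
Proof.
move=> mf f0; rewrite [RHS](eq_measure_integral (@reflection_image R)).
  by rewrite ge0_integral_pushforward.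
by move=> A mA _; rewrite /reflection_image /=; exact/esym/lebesgue_measureN.
Qed.

Lemma Rintegral_opp (f : R -> R) : measurable_fun setT f ->
  \int[leb]_x f (- x)%R = \int[leb]_x f x.
Proof.
move=> /measurable_EFinP mf.
rewrite /Rintegral integralE [in RHS]integralE.
rewrite -(ge0_integral_opp (f := (fun x => (f x)%:E)^\+%E))//; last exact: measurable_funepos.
rewrite -(ge0_integral_opp (f := (fun x => (f x)%:E)^\-%E))//; last exact: measurable_funeneg.
congr (fine (_ - _)%E); apply: eq_integral => x _; rewrite ?funeposE ?funenegE //.
Qed.

Lemma Rintegral_odd (f : R -> R) : leb.-integrable setT (EFin \o f) ->
  (forall x, f (- x) = - f x) -> \int[leb]_x f x = 0.
Proof.
move=> intf fN; have mf : measurable_fun setT f by case/integrableP : (intf) => /measurable_EFinP.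
suff : \int[leb]_x f x = - \int[leb]_x f x by lra.
rewrite -[LHS]Rintegral_opp// -mulN1r -RintegralZl//.
by apply: eq_Rintegral => x _; rewrite fN mulN1r.
Qed.

End reflection.

Lemma integral_inv1D (R : realType) :
  (\int[@lebesgue_measure R]_x ((1 + x ^+ 2)^-1)%:E)%E = pi%:E.
Proof.
rewrite ge0_symfun_integralT//.
- by rewrite -set_itvcy integral0y_oneDsqr -EFinM; congr EFin; field.
- by move=> x; rewrite invr_ge0 addr_ge0 ?sqr_ge0.
- exact: continuous_oneDsqrV.
- by move=> x /=; rewrite sqrrN.
Qed.

Lemma ge0_integrable d (T : measurableType d) (R : realType)
  (mu : {measure set T -> \bar R}) (f : T -> R) : measurable_fun setT f ->
  (forall x, 0 <= f x) -> (\int[mu]_x (f x)%:E < +oo)%E ->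
  mu.-integrable setT (fun x => (f x)%:E).
Proof.
move=> mf f0 foo; apply/integrableP; split; first exact/measurable_EFinP.
by under eq_integral do rewrite gee0_abs ?lee_fin//.
Qed.

Section gaussian_fourier.
Context {R : realType}.
Local Notation leb := (@lebesgue_measure R).

Lemma integrable_expRNsqr (a : R) : 0 < a ->
  leb.-integrable setT (fun x => (expR (- (a * x ^+ 2)))%:E).
Proof.
move=> a0; have sa : 0 < Num.sqrt a by rewrite sqrtr_gt0.
have := integrable_affine 0 sa (@integrableT_gauss R).
apply: eq_integrable => // x _; rewrite /gauss_fun addr0 exprMn sqr_sqrtr//.
exact: ltW.
Qed.

Lemma integral_expRNsqr (a : R) : 0 < a ->
  (\int[leb]_x (expR (- (a * x ^+ 2)))%:E)%E = (Num.sqrt (pi / a))%:E.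
Proof.
move=> a0; have sa : 0 < Num.sqrt a by rewrite sqrtr_gt0.
have mg : measurable_fun setT (EFin \o @gauss_fun R).
  by apply/measurable_EFinP; exact: measurable_gauss_fun.
transitivity (\int[leb]_x (gauss_fun (Num.sqrt a * x + 0))%:E)%E.
  by apply: eq_integral => x _; rewrite /gauss_fun addr0 exprMn sqr_sqrtr// ltW.
rewrite (ge0_integral_affine 0 sa (f := EFin \o gauss_fun))//; last first.
  by move=> x; rewrite lee_fin gauss_fun_ge0.
by rewrite integralT_gauss -EFinM mulrC sqrtrM ?pi_ge0// sqrtrV// ltW.
Qed.

Lemma norm_le_expR_sqr (x : R) : `|x| <= expR (x ^+ 2 / 2).
Proof.
apply: (le_trans _ (expR_ge1Dx _)).
have := sqr_ge0 (`|x| - 1); rewrite -(real_normK (num_real x)); nra.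
Qed.

Lemma integrable_norm_gauss :
  leb.-integrable setT (fun x : R => (`|x| * expR (- x ^+ 2))%:E).
Proof.
have h : (0 : R) < 1 / 2 by rewrite divr_gt0.
apply: (le_integrable measurableT _ _ (integrable_expRNsqr h)).
  apply/measurable_EFinP/measurable_funM; first exact: normr_measurable.
  exact: measurable_gauss_fun.
move=> x _; rewrite /= lee_fin ger0_norm ?mulr_ge0 ?expR_ge0// (ger0_norm (expR_ge0 _)).
apply: (le_trans (ler_wpM2r (expR_ge0 _) (norm_le_expR_sqr x))).
by rewrite -expRD ler_expR; nra.
Qed.

Lemma integral_norm_gauss :
  (\int[leb]_x (`|x| * expR (- x ^+ 2))%:E)%E = 1%:E.
Proof.
have cf : continuous (fun x : R => `|x| * expR (- x ^+ 2)).
  by move=> x; apply: cvgM; [exact: norm_continuous|exact: continuous_gauss_fun].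
rewrite ge0_symfun_integralT//.
- rewrite -set_itvcy.
  rewrite (@ge0_continuous_FTC2y _ _ (fun x => - (expR (- x ^+ 2) / 2)) _ 0)//.
  + by rewrite expr0n oppr0 expR0 -EFinB -EFinM; congr EFin; field.
  + exact: continuous_subspaceT.
  + rewrite -oppr0 -(mul0r (2^-1)); apply: cvgN; apply: cvgMr_tmp.
    exact: cvg_gauss_fun.
  + apply: cvg_at_right_filter; apply: cvgN; apply: cvgMr_tmp.
    exact: continuous_gauss_fun.
  + move=> x; rewrite in_itv /= andbT => x0.
    rewrite derive1E derive_val /= ger0_norm ?(ltW x0)//.
    have E (u v : R) : u *: (v : R^o) = u * v by [].
    by rewrite !E; field.
- by move=> x /=; rewrite sqrrN normrN.
Qed.

Definition gauss_cos (b : R) : R := \int[leb]_x (expR (- x ^+ 2) * cos (b * x)).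

Lemma integrable_gauss_bounded (h : R -> R) : measurable_fun setT h ->
  (forall x, `|h x| <= 1) ->
  leb.-integrable setT (fun x => (expR (- x ^+ 2) * h x)%:E).
Proof.
move=> mh h1; apply: (le_integrable measurableT _ _ (@integrableT_gauss R)).
  by apply/measurable_EFinP/measurable_funM => //; exact: measurable_gauss_fun.
move=> x _; rewrite /= lee_fin normrM ler_piMr//.
Qed.

Lemma measurable_cos_scale (b : R) : measurable_fun setT (fun x : R => cos (b * x)).
Proof.
apply: measurableT_comp; first exact: (continuous_measurable_fun (@continuous_cos R)).
exact: measurable_funM.
Qed.

Lemma measurable_sin_scale (b : R) : measurable_fun setT (fun x : R => sin (b * x)).
Proof.
apply: measurableT_comp; first exact: (continuous_measurable_fun (@continuous_sin R)).
exact: measurable_funM.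
Qed.

(* The x-derivative of [expR (- x ^+ 2) * sin (b * x)] has integral zero. *)
Lemma integral_gauss_sin_by_parts (b : R) :
  \int[leb]_x (expR (- x ^+ 2) * (b * cos (b * x) - 2 * x * sin (b * x))) = 0.
Proof.
pose H (x : R) := expR (- x ^+ 2) * sin (b * x).
pose h (x : R) := expR (- x ^+ 2) * (b * cos (b * x) - 2 * x * sin (b * x)).
pose m (x : R) := `|b| * (1 + x ^+ 2)^-1 + 2 * (`|x| * expR (- x ^+ 2)).
pose M (x : R) := `|b| * atan x - expR (- x ^+ 2).
have ch : continuous h.
  move=> x; apply: cvgM; first exact: continuous_gauss_fun.
  apply: cvgB; apply: cvgM; [exact: cvg_cst| |apply: cvgM; [exact: cvg_cst|exact: cvg_id]|].
  - apply: (@continuous_comp _ _ _ (fun x => b * x) cos); last exact: continuous_cos.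
    by apply: cvgM; [exact: cvg_cst|exact: cvg_id].
  - apply: (@continuous_comp _ _ _ (fun x => b * x) sin); last exact: continuous_sin.
    by apply: cvgM; [exact: cvg_cst|exact: cvg_id].
have cm : continuous m.
  move=> x; apply: cvgD; apply: cvgM; [exact: cvg_cst|exact: continuous_oneDsqrV|exact: cvg_cst|].
  by apply: cvgM; [exact: norm_continuous|exact: continuous_gauss_fun].
have gauss_le (x : R) : expR (- x ^+ 2) <= (1 + x ^+ 2)^-1.
  by rewrite expRN lef_pV2 ?posrE ?expR_gt0 ?ltr_wpDr ?sqr_ge0// expR_ge1Dx.
have hm x : `|h x| <= m x.
  rewrite /h /m mulrBr (le_trans (ler_normB _ _))// lerD//.
    rewrite mulrC -mulrA normrM ler_wpM2l//.
    rewrite normrM (ger0_norm (expR_ge0 _)) (le_trans _ (gauss_le x))//.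
    by rewrite ler_piMl ?expR_ge0// cos_max.
  rewrite !normrM (ger0_norm (expR_ge0 _)) (ger0_norm (ler0n _ 2)).
  rewrite [leLHS](_ : _ = 2 * (`|x| * expR (- x ^+ 2)) * `|sin (b * x)|); last by ring.
  by rewrite ler_piMr ?sin_max// !mulr_ge0// expR_ge0.
have inv0 (x : R) : 0 < 1 + x ^+ 2 by rewrite ltr_wpDr ?sqr_ge0.
have int1 : leb.-integrable setT (fun x : R => (`|b| * (1 + x ^+ 2)^-1)%:E).
  apply: (integrable_scale `|b|); apply: ge0_integrable.
  - by apply: continuous_measurable_fun; exact: continuous_oneDsqrV.
  - by move=> x; rewrite invr_ge0 ltW.
  - by rewrite integral_inv1D ltry.
have int2 := integrable_scale 2 integrable_norm_gauss.
have intm : leb.-integrable setT (EFin \o m).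
  exact: (integrableD measurableT int1 int2).
have inth : leb.-integrable setT (EFin \o h).
  apply: (le_integrable measurableT _ _ intm); first by apply/measurable_EFinP; exact: continuous_measurable_fun.
  move=> x _; rewrite /= lee_fin (le_trans (hm x))// ler_norm//.
have Im : \int[leb]_x m x = `|b| * pi + 2.
  rewrite RintegralD// !RintegralZl//; last 2 first.
    exact: integrable_norm_gauss.
    apply: ge0_integrable; last by rewrite integral_inv1D ltry.
      by apply: continuous_measurable_fun; exact: continuous_oneDsqrV.
    by move=> x; rewrite invr_ge0 ltW.
  by rewrite /Rintegral integral_inv1D integral_norm_gauss /= mulr1.
pose k x := h x + m x.
have k0 x : 0 <= k x.
  by rewrite /k; have := hm x; rewrite ler_norml => /andP[]; lra.
have ck : continuous k by move=> x; apply: cvgD; [exact: ch|exact: cm].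
have Ik : (\int[leb]_x (k x)%:E)%E = (`|b| * pi + 2)%:E.
  rewrite ge0_symfun_integralT//; last first.
    move=> x /=; rewrite /k /h /m !sqrrN !normrN !mulrN cosN sinN; ring.
  rewrite -set_itvcy.
  rewrite (@ge0_continuous_FTC2y _ _ (fun x => H x + M x) _ (`|b| * (pi / 2)))//.
  + rewrite /H /M mulr0 sin0 atan0 expr0n oppr0 expR0 -EFinB -EFinM; congr EFin; field; exact: isT.
  + exact: continuous_subspaceT.
  + rewrite -[X in _ --> X]add0r -[X in _ --> _ + X]subr0; apply: cvgD; last first.
      apply: cvgB; last exact: cvg_gauss_fun.
      by apply: cvgM; [exact: cvg_cst|exact: cvgy_atan].
    apply: (@squeeze_cvgr _ _ _ _ (fun x => - gauss_fun x) gauss_fun).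
    * near=> x; rewrite -ler_norml /H normrM (ger0_norm (expR_ge0 _)).
      by rewrite ler_piMr ?expR_ge0// sin_max.
    * by rewrite -oppr0; apply: cvgN; exact: cvg_gauss_fun.
    * exact: cvg_gauss_fun.
  + apply: cvg_at_right_filter; apply: cvgD.
      apply: cvgM; first exact: continuous_gauss_fun.
      apply: (@continuous_comp _ _ _ (fun x => b * x) sin); last exact: continuous_sin.
      by apply: cvgM; [exact: cvg_cst|exact: cvg_id].
    apply: cvgB; last exact: continuous_gauss_fun.
    by apply: cvgM; [exact: cvg_cst|exact: continuous_atan].
  + move=> x; rewrite in_itv /= andbT => x0.
    rewrite derive1E derive_val /= /k /h /m (ger0_norm (ltW x0)).
    have E (u v : R) : u *: (v : R^o) = u * v by [].
    rewrite !E; ring.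
have intk : leb.-integrable setT (EFin \o k) by apply: (integrableD measurableT inth intm).
have : \int[leb]_x h x = \int[leb]_x k x - \int[leb]_x m x.
  by rewrite -RintegralB//; apply: eq_Rintegral => x _; rewrite /k addrK.
by rewrite Im /Rintegral Ik /= subrr.
Unshelve. all: end_near. Qed.

Lemma is_derive_gauss_cos (b : R) :
  is_derive b (1 : R) gauss_cos (- (b / 2) * gauss_cos b).
Proof.
pose f (b x : R) := expR (- x ^+ 2) * cos (b * x).
have df b' x : is_derive b' (1 : R) (f ^~ x) (- (expR (- x ^+ 2) * (x * sin (b' * x)))).
  have E (u v : R) : u *: (v : R^o) = u * v by [].
  rewrite /f; apply: is_derive_eq; rewrite !E; ring.
have Ib : `]b - 1, b + 1[%classic b by rewrite /= in_itv /=; lra.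
have intf b' : leb.-integrable setT (EFin \o f b').
  apply: integrable_gauss_bounded; first exact: measurable_cos_scale.
  by move=> x; exact: cos_max.
have dG (b' x : R) : `|partial1of2 f b' x| <= `|x| * expR (- x ^+ 2).
  rewrite partial1of2E (@derive_val _ _ _ _ _ _ _ (df b' x)) normrN !normrM.
  rewrite (ger0_norm (expR_ge0 _)) mulrC ler_wpM2r ?expR_ge0//.
  by rewrite ler_piMr// sin_max.
have dfb x y : `]b - 1, b + 1[%classic x -> setT y -> derivable (f ^~ y) x 1.
  by move=> _ _; case: (df x y).
have G0 (y : R) : 0 <= `|y| * expR (- y ^+ 2) by rewrite mulr_ge0 ?expR_ge0.
have dI := @derivable_under_integral R _ _ leb f _ measurableT b _ _ Ib
  (fun x _ => intf x) dfb _ G0 integrable_norm_gauss (fun x y _ _ => dG x y).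
have DI := @differentiation_under_integral R _ _ leb f _ measurableT b _ _ Ib
  (fun x _ => intf x) dfb _ G0 integrable_norm_gauss (fun x y _ _ => dG x y).
apply: DeriveDef => //; rewrite -derive1E DI.
have ints : leb.-integrable setT (fun x : R => (expR (- x ^+ 2) * (x * sin (b * x)))%:E).
  apply: (le_integrable measurableT _ _ integrable_norm_gauss).
    apply/measurable_EFinP/measurable_funM; first exact: measurable_gauss_fun.
    by apply: measurable_funM => //; exact: measurable_sin_scale.
  move=> x _; rewrite /= lee_fin !normrM normr_id mulrC ler_wpM2r//.
  by rewrite ler_piMr// sin_max.
rewrite (_ : (\int[leb]_y _) = - (\int[leb]_x (expR (- x ^+ 2) * (x * sin (b * x))))); last first.
  rewrite -mulN1r -RintegralZl//; apply: eq_Rintegral => x _.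
  by rewrite partial1of2E (@derive_val _ _ _ _ _ _ _ (df b x)) mulN1r.
have := integral_gauss_sin_by_parts b.
rewrite (_ : (\int[leb]_x _) = b * gauss_cos b - 2 * \int[leb]_x (expR (- x ^+ 2) * (x * sin (b * x)))); first by lra.
have := intf b; rewrite /f /= => intfb.
rewrite /gauss_cos -!RintegralZl// -RintegralB//.
- by apply: eq_Rintegral => x _; ring.
- exact: integrable_scale.
- exact: integrable_scale.
Qed.

Lemma gauss_cosE (b : R) : gauss_cos b = Num.sqrt pi * expR (- (b ^+ 2 / 4)).
Proof.
pose F (b : R) := gauss_cos b * expR (b ^+ 2 / 4).
have dF x : is_derive x (1 : R) F 0.
  have E (u v : R) : u *: (v : R^o) = u * v by [].
  have := is_derive_gauss_cos x => dg.
  by rewrite /F; apply: is_derive_eq; rewrite !E; field.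
have Fc : F b = F 0 by exact: is_derive_0_is_cst.
have F0 : F 0 = Num.sqrt pi.
  rewrite /F expr0n mul0r expR0 mulr1 /gauss_cos /Rintegral.
  rewrite -[RHS]/(fine (Num.sqrt pi)%:E) -integralT_gauss; congr fine.
  by apply: eq_integral => x _; rewrite mul0r cos0 mulr1.
by rewrite -F0 -Fc /F -mulrA -expRD subrr expR0 mulr1.
Qed.

Lemma gauss_fourier (a b : R) : 0 < a ->
  cintegral leb (fun x => (expR (- (a * x ^+ 2)))%:C * expi (b * x)) =
  (Num.sqrt (pi / a) * expR (- (b ^+ 2 / (4 * a))))%:C.
Proof.
move=> a0; have sa : 0 < Num.sqrt a by rewrite sqrtr_gt0.
have sa2 : Num.sqrt a ^+ 2 = a by rewrite sqr_sqrtr// ltW.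
rewrite /cintegral; congr (_ +i* _).
  transitivity (\int[leb]_x (expR (- (Num.sqrt a * x + 0) ^+ 2) * cos (b / Num.sqrt a * (Num.sqrt a * x + 0)))).
    apply: eq_Rintegral => x _ /=; rewrite mul0r subr0 addr0 exprMn sa2.
    congr (_ * cos _); rewrite mulrA divfK// gt_eqF//.
  rewrite (Rintegral_affine 0 sa (f := fun x => expR (- x ^+ 2) * cos (b / Num.sqrt a * x))).
    have := gauss_cosE (b / Num.sqrt a); rewrite /gauss_cos => ->.
    rewrite sqrtrM ?pi_ge0// sqrtrV ?ltW// mulrA; congr (_ * _); first by rewrite mulrC.
    by congr (expR (- _)); rewrite exprMn exprVn sa2; field; rewrite gt_eqF.
  apply: integrable_gauss_bounded; first exact: measurable_cos_scale.
  by move=> x; exact: cos_max.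
transitivity (\int[leb]_x (expR (- (a * x ^+ 2)) * sin (b * x))).
  by apply: eq_Rintegral => x _ /=; rewrite mul0r addr0.
apply: Rintegral_odd; last by move=> x; rewrite sqrrN mulrN sinN mulrN.
apply: (le_integrable measurableT _ _ (integrable_expRNsqr a0)).
  apply/measurable_EFinP/measurable_funM; last exact: measurable_sin_scale.
  apply: measurableT_comp => //; apply: measurableT_comp => //.
  by apply: measurable_funM => //; exact: measurable_funX.
by move=> x _; rewrite /= lee_fin normrM ler_piMr// sin_max.
Qed.

Lemma cintegrable_gauss (a b : R) : 0 < a ->
  cintegrable leb (fun x => (expR (- (a * x ^+ 2)))%:C * expi (b * x)).
Proof.
move=> a0; apply: (@cintegrable_dom _ (measurableTypeR R) R _ _ (fun x : R => expR (- (a * x ^+ 2)))).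
- apply: cmeasurableM.
    apply: cmeasurable_real.
    apply: measurableT_comp => //; apply: measurableT_comp => //.
    by apply: measurable_funM => //; exact: measurable_funX.
  by apply: cmeasurable_expi; exact: measurable_funM.
- exact: integrable_expRNsqr.
- by move=> x; rewrite normcM !normcE nsq_expi nsq_real sqrtr1 mulr1 sqrtr_sqr ger0_norm ?expR_ge0.
Qed.

End gaussian_fourier.

(** * Schur's test *)

Section limits_of_integrals.
Context d (T : measurableType d) (R : realType) (mu : {measure set T -> \bar R}).

Lemma fatou_le (f_ : nat -> T -> \bar R) (f : T -> \bar R) (C : \bar R) :
  (forall n, measurable_fun setT (f_ n)) -> (forall n x, (0 <= f_ n x)%E) ->
  measurable_fun setT f -> (forall x, (0 <= f x)%E) ->
  {ae mu, forall x, f_ n x @[n --> \oo] --> f x} ->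
  (forall n, (\int[mu]_x f_ n x <= C)%E) -> (\int[mu]_x f x <= C)%E.
Proof.
move=> mf_ f_0 mf f0 cvgf leC.
have mliminf : measurable_fun setT (fun x => limn_einf (f_ ^~ x)).
  rewrite (_ : (fun x => _) = fun x => (- limn_esup (fun n => - f_ n x))%E)//.
  apply: measurableT_comp => //; apply: measurable_fun_limn_esup => n.
  exact: measurableT_comp.
rewrite (ae_eq_integral (fun x => limn_einf (f_ ^~ x)))//; last first.
  by apply: filterS cvgf => x cx _; rewrite (cvg_limn_einf_sup cx).1.
apply: (le_trans (fatou mu measurableT mf_ (fun n x _ => f_0 n x))).
rewrite limn_einf_lim; apply: lime_le; first exact: is_cvg_einfs.
apply: nearW => n; apply: le_trans (leC n).
by apply: ereal_inf_lbound; exists n => /=.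
Qed.

Lemma fatou_le_all (f_ : nat -> T -> \bar R) (f : T -> \bar R) (C : \bar R) :
  (forall n, measurable_fun setT (f_ n)) -> (forall n x, (0 <= f_ n x)%E) ->
  measurable_fun setT f -> (forall x, (0 <= f x)%E) ->
  (forall x, f_ n x @[n --> \oo] --> f x) ->
  (forall n, (\int[mu]_x f_ n x <= C)%E) -> (\int[mu]_x f x <= C)%E.
Proof. by move=> ? ? ? ? cvgf; apply: fatou_le => //; exact: aeW. Qed.

(* Removes the Gaussian weight that makes the Schur kernel explicit. *)
Lemma le_integral_weight (h : T -> R) (q : T -> R) (C : \bar R) :
  measurable_fun setT h -> (forall x, 0 <= h x) ->
  measurable_fun setT q -> (forall x, 0 <= q x) ->
  (forall e, 0 < e -> (\int[mu]_x (expR (- (e * q x)) * h x)%:E <= C)%E) ->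
  (\int[mu]_x (h x)%:E <= C)%E.
Proof.
move=> mh h0 mq q0 hC.
apply: (@fatou_le_all (fun n x => (expR (- (n.+1%:R^-1 * q x)) * h x)%:E)).
- move=> n; apply/measurable_EFinP; apply: measurable_funM => //.
  apply: measurableT_comp => //; apply: measurableT_comp => //.
  exact: measurable_funM.
- by move=> n x; rewrite lee_fin mulr_ge0 ?expR_ge0.
- exact/measurable_EFinP.
- by move=> x; rewrite lee_fin.
- move=> x; apply: cvg_EFin; first exact: nearW.
  rewrite -[X in _ --> X]mul1r; apply: cvgMr_tmp.
  rewrite -[X in _ --> X]expR0.
  apply: (@cvg_comp _ _ _ (fun n : nat => - (n.+1%:R^-1 * q x)) (@expR R)); last exact: continuous_expR.
  rewrite -oppr0 -(mul0r (q x)); apply: cvgN; apply: cvgMr_tmp.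
  exact: cvg_harmonic.
- by move=> n; apply: hC; rewrite invr_gt0.
Qed.

End limits_of_integrals.

Section sigma_finite_product.
Local Open Scope ereal_scope.
Context d1 d2 (T1 : measurableType d1) (T2 : measurableType d2) (R : realType).
Variable m1 : {sigma_finite_measure set T1 -> \bar R}.
Variable m2 : {sigma_finite_measure set T2 -> \bar R}.

Let product_sigma_finite : sigma_finite setT (m1 \x m2).
Proof.
have /sigma_finiteP[F [FT F_nd F_fin]] := sigma_finiteT m1.
have /sigma_finiteP[G [GT G_nd G_fin]] := sigma_finiteT m2.
exists (fun k => F k `*` G k); last first.
  move=> k; have [mF Foo] := F_fin k; have [mG Goo] := G_fin k.
  split; first exact: measurableX.
  by rewrite product_measure1E// lte_mul_pinfty// ge0_fin_numE.
apply/esym; rewrite -subTset => -[x y] _.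
have [i _ Fix] : (\bigcup_k F k) x by rewrite -FT.
have [j _ Gjy] : (\bigcup_k G k) y by rewrite -GT.
exists (maxn i j) => //; split => /=.
  exact: (subsetPset _ _ (F_nd _ _ (leq_maxl i j))).
exact: (subsetPset _ _ (G_nd _ _ (leq_maxr i j))).
Qed.

Let mix := Measure_isSigmaFinite.Build _ _ _ (m1 \x m2) product_sigma_finite.
(* [m1 \x m2] bundled as a sigma-finite measure, so that products can be iterated. *)
Definition sigma_finite_prod : {sigma_finite_measure set (T1 * T2)%type -> \bar R} := HB.pack (m1 \x m2) mix.

End sigma_finite_product.

Section schur.
Context dX dY (X : measurableType dX) (Y : measurableType dY) (R : realType).
Variables (mu : {sigma_finite_measure set X -> \bar R})
  (nu : {sigma_finite_measure set Y -> \bar R}).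
Variables (G : X -> R[i]) (theta : Y * X -> R) (w : Y -> R) (k : X * X -> R).
Hypothesis intG : cintegrable mu G.
Hypothesis mtheta : measurable_fun setT theta.
Hypothesis intw : nu.-integrable setT (fun y => (w y)%:E).
Hypothesis w0 : forall y, 0 <= w y.
Hypothesis wk : forall x x', cintegral nu
  (fun y => (w y)%:C * expi (theta (y, x) - theta (y, x'))) = (k (x, x'))%:C.

Definition oscillatory (y : Y) : R[i] :=
  cintegral mu (fun x => G x * expi (theta (y, x))).

Let Phi (p : Y * (X * X)) : R[i] :=
  (w p.1)%:C * ((G p.2.1 * expi (theta (p.1, p.2.1))) *
    conjc (G p.2.2 * expi (theta (p.1, p.2.2)))).

Let mG := cintegrable_cmeasurable intG.

Let mw : measurable_fun setT w.
Proof. by case/integrableP : intw => /measurable_EFinP. Qed.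

Let mPhi : cmeasurable Phi.
Proof.
have p1 : measurable_fun [set: Y * (X * X)] (fun p => p.1) by exact: measurable_fst.
have p2 : measurable_fun [set: Y * (X * X)] (fun p => p.2) by exact: measurable_snd.
have p21 : measurable_fun [set: Y * (X * X)] (fun p => p.2.1).
  exact: (measurableT_comp measurable_fst p2).
have p22 : measurable_fun [set: Y * (X * X)] (fun p => p.2.2).
  exact: (measurableT_comp measurable_snd p2).
apply: cmeasurableM.
  by apply: cmeasurable_real; exact: (measurableT_comp mw p1).
apply: cmeasurableM; last apply: cmeasurable_conj; apply: cmeasurableM.
- exact: (cmeasurable_comp p21 mG).
- apply: cmeasurable_expi; apply: (measurableT_comp mtheta).
  by apply/measurable_fun_pairP; split.
- exact: (cmeasurable_comp p22 mG).
- apply: cmeasurable_expi; apply: (measurableT_comp mtheta).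
  by apply/measurable_fun_pairP; split.
Qed.

Let mm := sigma_finite_prod mu mu.

Let intPhi : cintegrable (nu \x mm)%E Phi.
Proof.
have intGG : mm.-integrable setT (fun z : X * X => (normc (G z.1) * normc (G z.2))%:E) :=
  integrable_prod ((cintegrableP _ _).1 intG).2 ((cintegrableP _ _).1 intG).2.
have intwGG := integrable_prod intw intGG.
apply: (cintegrable_dom mPhi intwGG) => -[y [x x']] /=.
rewrite !normcM !(normcE (conjc _)) nsq_conj nsqM nsq_expi mulr1 -!normcE.
rewrite (normcE (expi _)) nsq_expi sqrtr1 mulr1.
by rewrite (normcE (_%:C)) nsq_real sqrtr_sqr ger0_norm.
Qed.

Let intGe y : cintegrable mu (fun x => G x * expi (theta (y, x))).
Proof.
apply: cintegrableM_unit => //; last by move=> x; exact: nsq_expi.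
apply: cmeasurable_expi; apply: (measurableT_comp mtheta).
exact: measurable_pair1.
Qed.

Let innerz y : cintegral (mu \x mu)%E (fun z => Phi (y, z)) = (w y * nsq (oscillatory y))%:C.
Proof.
rewrite /Phi /= cintegralZ; last first.
  exact: (cintegrable_prod (intGe y) (cintegrable_conj (intGe y))).
rewrite (cintegral_prod (intGe y) (cintegrable_conj (intGe y))).
by rewrite cintegral_conj// mul_conjc rmorphM.
Qed.

Let innery z : cintegral nu (fun y => Phi (y, z)) =
  G z.1 * conjc (G z.2) * (k z)%:C.
Proof.
case: z => x x' /=; rewrite -wk -cintegralZ.
  apply: eq_cintegral => y; rewrite /Phi /= conjcM expiD expiN; ring.
apply: cintegrableM_unit => //.
- by split => //=; exact: integrable0.
- apply: cmeasurable_expi; apply: measurable_funB; apply: (measurableT_comp mtheta);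
  exact: measurable_pair2.
- by move=> y; exact: nsq_expi.
Qed.

Lemma cmeasurable_oscillatory : cmeasurable oscillatory.
Proof.
apply: (@cmeasurable_cintegral2 _ _ _ _ R mu (fun z => G z.2 * expi (theta z))).
apply: cmeasurableM; first exact: (cmeasurable_comp measurable_snd mG).
exact: cmeasurable_expi.
Qed.

Lemma cintegrable_schur_kernel :
  cintegrable (mu \x mu)%E (fun z => G z.1 * conjc (G z.2) * (k z)%:C).
Proof.
have := cintegrable_cintegral1 intPhi.
by under eq_fun do rewrite innery.
Qed.

Lemma schur_identity :
  (\int[nu]_y (w y * nsq (oscillatory y))%:E =
  (complex.Re (cintegral (mu \x mu) (fun z => G z.1 * conjc (G z.2) * (k z)%:C)))%:E)%E.
Proof.
have := cfubini1 intPhi; rewrite -(cfubini2 intPhi).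
rewrite (eq_cintegral _ innery) (eq_cintegral _ innerz) => ->.
rewrite cintegral_real /= /Rintegral fineK//.
apply: integrable_fin_num => //.
have [+ _] := cintegrable_cintegral2 intPhi.
by under eq_fun do rewrite innerz.
Qed.

Hypothesis k0 : forall z, 0 <= k z.
Hypothesis mk : measurable_fun setT k.

Lemma schur_bound (C : R) : 0 <= C ->
  (forall x, (\int[mu]_x' (k (x, x'))%:E <= C%:E)%E) ->
  (forall x', (\int[mu]_x (k (x, x'))%:E <= C%:E)%E) ->
  (\int[nu]_y (w y * nsq (oscillatory y))%:E <=
   C%:E * \int[mu]_x (nsq (G x))%:E)%E.
Proof.
move=> C0 C1 C2; rewrite schur_identity.
have intK := cintegrable_schur_kernel.
have mn : measurable_fun setT (fun x => nsq (G x)) by exact: measurable_nsq.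
have mn1 : measurable_fun [set: X * X] (fun z => nsq (G z.1)) by exact: (measurableT_comp mn).
have mn2 : measurable_fun [set: X * X] (fun z => nsq (G z.2)) by exact: (measurableT_comp mn).
have [iRe _] := intK; rewrite /cintegral /= /Rintegral fineK; last exact: integrable_fin_num.
apply: (@le_trans _ _ (\int[(mu \x mu)%E]_z ((2^-1 * nsq (G z.1) * k z)%:E + (2^-1 * nsq (G z.2) * k z)%:E))%E).
  rewrite integralE -[leRHS]sube0; apply: leeB; last exact: integral_ge0.
  apply: ge0_le_integral => //.
  - by apply: measurable_funepos; case/integrableP : iRe.
  - apply: emeasurable_funD; apply/measurable_EFinP; apply: measurable_funM => //; exact: measurable_funM.
  - move=> z _; rewrite funeposE ge_max -EFinD !lee_fin; apply/andP; split; last first.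
      by rewrite addr_ge0// !mulr_ge0 ?nsq_ge0.
    apply: (le_trans (ler_norm _)); apply: (le_trans (Re_norm _)).
    rewrite !normcM (normcE (conjc _)) nsq_conj -normcE (normcE (_%:C)) nsq_real sqrtr_sqr ger0_norm//.
    rewrite -mulrDl ler_wpM2r// -!normc_sqr.
    have := sqr_ge0 (normc (G z.1) - normc (G z.2)); nra.
rewrite ge0_integralD//; last 4 first.
  by move=> z _; rewrite lee_fin !mulr_ge0 ?nsq_ge0.
  by apply/measurable_EFinP; apply: measurable_funM => //; exact: measurable_funM.
  by move=> z _; rewrite lee_fin !mulr_ge0 ?nsq_ge0.
  by apply/measurable_EFinP; apply: measurable_funM => //; exact: measurable_funM.
have half : (\int[mu]_x (2^-1 * nsq (G x) * C)%:E = (2^-1)%:E * (C%:E * \int[mu]_x (nsq (G x))%:E))%E.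
  rewrite muleA -EFinM -ge0_integralZl//.
  - by apply: eq_integral => x _; rewrite -EFinM; congr EFin; ring.
  - exact/measurable_EFinP.
  - by move=> x _; rewrite lee_fin nsq_ge0.
  - by rewrite lee_fin mulr_ge0.
have mh (g : X * X -> R) : measurable_fun setT g ->
    measurable_fun setT (fun z => (2^-1 * g z * k z)%:E).
  by move=> mg; apply/measurable_EFinP; apply: measurable_funM => //; exact: measurable_funM.
have h0 (g : X * X -> X) z : (0 <= (2^-1 * nsq (G (g z)) * k z)%:E)%E.
  by rewrite lee_fin !mulr_ge0 ?nsq_ge0.
have bound x (g : X -> R) : measurable_fun setT g -> (forall y, 0 <= g y) ->
    (\int[mu]_y (g y)%:E <= C%:E)%E ->
    (\int[mu]_y (2^-1 * nsq (G x) * g y)%:E <= (2^-1 * nsq (G x) * C)%:E)%E.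
  move=> mg g0 gC; under eq_integral do rewrite EFinM.
  rewrite ge0_integralZl//.
  - by rewrite [leRHS]EFinM lee_wpmul2l// lee_fin mulr_ge0 ?nsq_ge0.
  - exact/measurable_EFinP.
  - by move=> y _; rewrite lee_fin.
  - by rewrite lee_fin mulr_ge0 ?nsq_ge0.
have mhalf : measurable_fun setT (fun x => (2^-1 * nsq (G x) * C)%:E).
  by apply/measurable_EFinP; apply: measurable_funM => //; exact: measurable_funM.
have H1 : (\int[(mu \x mu)%E]_z (2^-1 * nsq (G z.1) * k z)%:E <= (2^-1)%:E * (C%:E * \int[mu]_x (nsq (G x))%:E))%E.
  rewrite -half (fubini_tonelli1 _ (mh _ mn1) (h0 fst)).
  apply: ge0_le_integral => //; last first.
  - by move=> x _; apply: bound => //; exact: (measurableT_comp mk (measurable_pair1 _)).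
  - exact: (measurable_fun_fubini_tonelli_F _ (mh _ mn1) (h0 fst)).
  - by move=> x _; apply: integral_ge0 => y _; exact: (h0 fst).
have H2 : (\int[(mu \x mu)%E]_z (2^-1 * nsq (G z.2) * k z)%:E <= (2^-1)%:E * (C%:E * \int[mu]_x (nsq (G x))%:E))%E.
  rewrite -half (fubini_tonelli1 _ (mh _ mn2) (h0 snd)) (fubini_tonelli _ (mh _ mn2) (h0 snd)).
  apply: ge0_le_integral => //; last first.
  - by move=> x _; apply: bound => //; exact: (measurableT_comp mk (measurable_pair2 _)).
  - exact: (measurable_fun_fubini_tonelli_G _ (mh _ mn2) (h0 snd)).
  - by move=> x _; apply: integral_ge0 => y _; exact: (h0 snd).
apply: (le_trans (leeD H1 H2)).
have I0 : (0 <= \int[mu]_x (nsq (G x))%:E)%E.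
  by apply: integral_ge0 => x _; rewrite lee_fin nsq_ge0.
rewrite -ge0_muleDl ?lee_fin// -EFinD (_ : 2^-1 + 2^-1 = 1 :> R) ?mul1e//; lra.
Qed.

End schur.

Section energy.
Context d (T : measurableType d) (R : realType) (mu : {measure set T -> \bar R}).
Implicit Types f g : T -> R[i].

Definition energy f : \bar R := (\int[mu]_x (nsq (f x))%:E)%E.

Lemma energy_ge0 f : (0 <= energy f)%E.
Proof. by apply: integral_ge0 => x _; rewrite lee_fin nsq_ge0. Qed.

Lemma energyZ (c : R[i]) f : cmeasurable f ->
  energy (fun x => c * f x) = ((nsq c)%:E * energy f)%E.
Proof.
move=> mf; rewrite /energy; under eq_integral do rewrite nsqM EFinM.
rewrite ge0_integralZl//.
- exact: emeasurable_nsq.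
- by move=> x _; rewrite lee_fin nsq_ge0.
- by rewrite lee_fin nsq_ge0.
Qed.

Lemma energyN f : energy (fun x => - f x) = energy f.
Proof. by apply: eq_integral => x _; rewrite nsqN. Qed.

Lemma energy_conj f : energy (fun x => conjc (f x)) = energy f.
Proof. by apply: eq_integral => x _; rewrite nsq_conj. Qed.

Lemma energy_parallelogram f g : cmeasurable f -> cmeasurable g ->
  (energy (fun x => (f x + g x)%R) + energy (fun x => (f x - g x)%R) =
   2%:E * energy f + 2%:E * energy g)%E.
Proof.
move=> mf mg; have ge0 (h : T -> R[i]) x : [set: T] x -> (0 <= (nsq (h x))%:E)%E.
  by rewrite lee_fin nsq_ge0.
have m (h : T -> R[i]) : cmeasurable h -> measurable_fun setT (fun x => (nsq (h x))%:E).
  by move=> mh; apply/measurable_EFinP; exact: measurable_nsq.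
rewrite /energy -ge0_integralD//; [|exact: (ge0 (fun x => f x + g x))|apply: m; exact: cmeasurableD
  |exact: (ge0 (fun x => f x - g x))|apply: m; exact: cmeasurableB].
rewrite -!ge0_integralZl//; [|exact: m|exact: ge0|exact: m|exact: ge0].
rewrite -ge0_integralD//; [|by move=> x _; rewrite mule_ge0// ge0|exact: measurable_funeM (m _ mf)
  |by move=> x _; rewrite mule_ge0// ge0|exact: measurable_funeM (m _ mg)].
by apply: eq_integral => x _; rewrite -EFinD nsqD_parallelogram.
Qed.

Lemma energyD_lty f g : cmeasurable f -> cmeasurable g ->
  (energy f < +oo)%E -> (energy g < +oo)%E ->
  (energy (fun x => (f x + g x)%R) < +oo)%E.
Proof.
move=> mf mg foo goo; have := energy_parallelogram mf mg => E.
apply: (@le_lt_trans _ _ (2%:E * energy f + 2%:E * energy g)%E).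
  by rewrite -E leeDl// energy_ge0.
by rewrite lte_add_pinfty// lte_mul_pinfty.
Qed.

Lemma energyZ_lty (c : R[i]) f : cmeasurable f ->
  (energy f < +oo)%E -> (energy (fun x => (c * f x)%R) < +oo)%E.
Proof. by move=> mf foo; rewrite energyZ// lte_mul_pinfty// lee_fin nsq_ge0. Qed.

End energy.

(** * Plancherel's theorem *)

Section fourier_line.
Context {R : realType}.
Local Notation leb := (@lebesgue_measure R).
Implicit Types f g : measurableTypeR R -> R[i].

Definition fourier1 f (xi : R) : R[i] :=
  cintegral leb (fun x : R => f x * expi (- (x * xi))).

Let theta (z : plane R) : R := - (z.2 * z.1).

Let mtheta : measurable_fun setT theta.
Proof.
by apply: measurableT_comp => //; apply: measurable_funM;
  [exact: measurable_snd|exact: measurable_fst].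
Qed.

Definition line_kernel (e : R) (z : plane R) : R :=
  Num.sqrt (pi / e) * expR (- ((z.2 - z.1) ^+ 2 / (4 * e))).

Lemma line_kernel_ge0 e z : 0 <= line_kernel e z.
Proof. by rewrite mulr_ge0 ?sqrtr_ge0 ?expR_ge0. Qed.

Lemma measurable_line_kernel e : measurable_fun setT (line_kernel e).
Proof.
apply: measurable_funM => //; apply: measurableT_comp => //.
apply: measurableT_comp => //; apply: measurable_funM => //.
apply: measurable_funX; apply: measurable_funB; [exact: measurable_snd|exact: measurable_fst].
Qed.

Lemma measurable_gauss_weight (e : R) : measurable_fun setT (fun y : R => expR (- (e * y ^+ 2))).
Proof.
apply: measurableT_comp => //; apply: measurableT_comp => //.
by apply: measurable_funM => //; exact: measurable_funX.
Qed.

Let kernelE e x x' : 0 < e -> cintegral leb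
  (fun y : measurableTypeR R => (expR (- (e * y ^+ 2)))%:C * expi (theta (y, x) - theta (y, x'))) =
  (line_kernel e (x, x'))%:C.
Proof.
move=> e0; rewrite -gauss_fourier//; apply: eq_cintegral => y.
by rewrite /theta /=; congr (_ * expi _); ring.
Qed.

Lemma integral_line_kernel e x : 0 < e ->
  (\int[leb]_x' (line_kernel e (x, x'))%:E)%E = (2 * pi)%:E.
Proof.
move=> e0; have a0 : 0 < (4 * e)^-1 by rewrite invr_gt0 mulr_gt0.
under eq_integral do rewrite /line_kernel /= EFinM.
rewrite ge0_integralZl//; last first.
  apply/measurable_EFinP; apply: measurableT_comp => //; apply: measurableT_comp => //.
  by apply: measurable_funM => //; apply: measurable_funX; exact: measurable_funB.
transitivity ((Num.sqrt (pi / e))%:E * \int[leb]_x' (expR (- ((4 * e)^-1 * (1 * x' + - x) ^+ 2)))%:E)%E.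
  by congr (_ * _)%E; apply: eq_integral => y _; rewrite mul1r mulrC.
rewrite (ge0_integral_affine (- x) ltr01 (f := fun y => (expR (- ((4 * e)^-1 * y ^+ 2)))%:E))//; last first.
  by apply/measurable_EFinP; exact: measurable_gauss_weight.
rewrite invr1 mul1e integral_expRNsqr// -EFinM -sqrtrM ?divr_ge0 ?pi_ge0 ?(ltW e0)//; congr EFin.
rewrite (_ : pi / e * (pi / (4 * e)^-1) = (2 * pi) ^+ 2); last by field; rewrite gt_eqF.
by rewrite sqrtr_sqr ger0_norm// mulr_ge0// pi_ge0.
Qed.

Lemma line_kernel_sym e x x' : line_kernel e (x, x') = line_kernel e (x', x).
Proof. by rewrite /line_kernel /= -sqrrN opprB. Qed.

Lemma cmeasurable_fourier1 f : cintegrable leb f -> cmeasurable (fourier1 f).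
Proof.
by move=> intf; exact: (cmeasurable_oscillatory intf mtheta).
Qed.

Lemma fourier1_le f : cintegrable leb f ->
  (\int[leb]_xi (nsq (fourier1 f xi))%:E <= (2 * pi)%:E * \int[leb]_x (nsq (f x))%:E)%E.
Proof.
move=> intf; have mF := cmeasurable_fourier1 intf.
apply: (@le_integral_weight _ (measurableTypeR R) R _ _ (fun y : R => y ^+ 2)).
- exact: measurable_nsq.
- by move=> y; exact: nsq_ge0.
- exact: measurable_funX.
- by move=> y; exact: sqr_ge0.
move=> e e0.
apply: (schur_bound (nu := leb) intf mtheta (integrable_expRNsqr e0) (fun y => expR_ge0 _)
   (fun x x' => kernelE x x' e0) (line_kernel_ge0 e) (measurable_line_kernel e)).
- by rewrite mulr_ge0// pi_ge0.
- by move=> x; rewrite integral_line_kernel.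
- by move=> x'; under eq_integral do rewrite line_kernel_sym; rewrite integral_line_kernel.
Qed.

Lemma fourier1_weighted f e : 0 < e -> cintegrable leb f ->
  (\int[leb]_y (expR (- (e * y ^+ 2)) * nsq (fourier1 f y))%:E =
  (complex.Re (cintegral (leb \x leb)
    (fun z => f z.1 * conjc (f z.2) * (line_kernel e z)%:C)))%:E)%E.
Proof.
move=> e0 intf.
exact: (schur_identity (nu := leb) intf mtheta (integrable_expRNsqr e0) (fun y => expR_ge0 _)
   (fun x x' => kernelE x x' e0)).
Qed.

Lemma fourier1_weighted_real (r : measurableTypeR R -> R) e : 0 < e ->
  cintegrable leb (fun x => (r x)%:C) ->
  (\int[leb]_y (expR (- (e * y ^+ 2)) * nsq (fourier1 (fun x => (r x)%:C) y))%:E =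
  \int[leb \x leb]_z (r z.1 * r z.2 * line_kernel e z)%:E)%E.
Proof.
move=> e0 intr; rewrite fourier1_weighted//.
have rE (z : plane R) :
    (r z.1)%:C * conjc (r z.2)%:C * (line_kernel e z)%:C =
    (r z.1 * r z.2 * line_kernel e z)%:C.
  by apply/eqP; rewrite eq_complex /=; apply/andP; split; apply/eqP; ring.
have [irk _] := cintegrable_schur_kernel intr mtheta (integrable_expRNsqr e0)
  (fun y => expR_ge0 _) (fun x x' => kernelE x x' e0).
rewrite (eq_cintegral _ rE) cintegral_real /= /Rintegral fineK//.
apply: integrable_fin_num => //; apply: eq_integrable irk => // z _.
by rewrite rE.
Qed.

Lemma cintegrable_indic (U : set (measurableTypeR R)) : measurable U ->
  (leb U < +oo)%E -> cintegrable leb (fun x => (\1_U x)%:C).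
Proof.
move=> mU Uoo; split => /=; last exact: integrable0.
apply: ge0_integrable; first exact: measurable_indic.
  by move=> x; rewrite indicE.
by rewrite integral_indic// setIT.
Qed.

Lemma energy_indic (U : set (measurableTypeR R)) : measurable U ->
  energy leb (fun x => (\1_U x)%:C) = leb U.
Proof.
move=> mU; rewrite /energy -[X in _ = leb X]setIT -integral_indic//.
apply: eq_integral => x _; rewrite nsq_real indicE.
by case: (x \in U); rewrite ?expr1n ?expr0n.
Qed.

(* As e tends to 0, the double integral of the Gaussian kernel over an open
   set is bounded below by Fatou's lemma. *)
Lemma fourier1_indic_open (U : set (measurableTypeR R)) : @open R U ->
  (leb U < +oo)%E ->
  ((2 * pi)%:E * leb U <= energy leb (fourier1 (fun x => (\1_U x)%:C)))%E.
Proof.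
move=> oU Uoo; have mU : measurable U by exact: open_measurable.
have intU := cintegrable_indic mU Uoo.
have mF := cmeasurable_fourier1 intU.
have leE (e : R) : 0 < e ->
    (\int[leb]_y (expR (- (e * y ^+ 2)) * nsq (fourier1 (fun x => (\1_U x)%:C) y))%:E <=
     energy leb (fourier1 (fun x => (\1_U x)%:C)))%E.
  move=> e0; apply: ge0_le_integral => //.
  - by move=> y _; rewrite lee_fin mulr_ge0 ?expR_ge0 ?nsq_ge0.
  - apply/measurable_EFinP; apply: measurable_funM; first exact: measurable_gauss_weight.
    exact: measurable_nsq.
  - exact: emeasurable_nsq.
  - move=> y _; rewrite lee_fin ler_piMl ?nsq_ge0// -expR0 ler_expR oppr_le0.
    by rewrite mulr_ge0 ?sqr_ge0// ltW.
have mU1 : measurable_fun setT (\1_U : measurableTypeR R -> R) by exact: measurable_indic.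
pose gz (z : R) : R := 2 * Num.sqrt pi * expR (- z ^+ 2).
have gz0 z : 0 <= gz z by rewrite !mulr_ge0 ?expR_ge0 ?sqrtr_ge0.
have mgz : measurable_fun setT (gz : measurableTypeR R -> R).
  by apply: measurable_funM => //; exact: measurable_gauss_fun.
pose g (z : plane R) : R := \1_U z.1 * gz z.2.
pose gn (d : R) (z : plane R) : R :=
  \1_U z.1 * (\1_U (d * z.2 + z.1) * gz z.2).
have mg : measurable_fun setT g.
  apply: measurable_funM; first exact: (measurableT_comp mU1 measurable_fst).
  exact: (measurableT_comp mgz measurable_snd).
have mgn d : measurable_fun setT (gn d).
  apply: measurable_funM; first exact: (measurableT_comp mU1 measurable_fst).
  apply: measurable_funM; last exact: (measurableT_comp mgz measurable_snd).
  apply: (measurableT_comp mU1); apply: measurable_funD; last exact: measurable_fst.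
  by apply: measurable_funM => //; exact: measurable_snd.
have -> : ((2 * pi)%:E * leb U = \int[leb \x leb]_z (g z)%:E)%E.
  rewrite (fubini_tonelli1 (fun z => (g z)%:E)); last 2 first.
    exact/measurable_EFinP.
    by move=> z; rewrite lee_fin mulr_ge0// indicE.
  transitivity (\int[leb]_x ((2 * pi)%:E * (\1_U x)%:E))%E.
    rewrite ge0_integralZl//; first by rewrite integral_indic// setIT.
    - exact/measurable_EFinP.
    - by rewrite lee_fin mulr_ge0 ?pi_ge0.
  apply: eq_integral => x _; rewrite /fubini_F /g /=.
  under [RHS]eq_integral do rewrite EFinM.
  rewrite ge0_integralZl//; last 2 first.
    exact/measurable_EFinP.
    by move=> y _; rewrite lee_fin.
  rewrite muleC; congr (_ * _)%E; rewrite /gz.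
  under [RHS]eq_integral do rewrite EFinM.
  rewrite ge0_integralZl//; try by apply/measurable_EFinP; exact: measurable_gauss_fun.
  rewrite integralT_gauss -EFinM -mulrA -expr2 sqr_sqrtr// pi_ge0//.
apply: (@fatou_le_all _ _ _ (leb \x leb)%E (fun n z => (gn n.+1%:R^-1 z)%:E)).
- by move=> n; exact/measurable_EFinP.
- by move=> n z; rewrite lee_fin !mulr_ge0.
- exact/measurable_EFinP.
- by move=> z; rewrite lee_fin mulr_ge0.
- move=> [x z] /=; rewrite /g /gn /=; case: (boolP (x \in U)) => [|xU]; last first.
    rewrite indicE (negbTE xU); under eq_fun do rewrite mul0r; rewrite mul0r; exact: cvg_cst.
  rewrite inE => Ux; apply: cvg_EFin; first exact: nearW.
  apply: cvgM; first exact: cvg_cst.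
  apply: cvg_near_cst.
  have : (n.+1%:R^-1 * z + x : R^o) @[n --> \oo] --> (0 * z + x : R^o).
    by apply: cvgD; last exact: cvg_cst; apply: cvgMr_tmp; exact: cvg_harmonic.
  rewrite mul0r add0r => cx.
  have : \forall n \near \oo, U (n.+1%:R^-1 * z + x) by apply: cx; exact: open_nbhs_nbhs.
  by apply: filterS => n Un; rewrite indicE mem_set// mul1r.
- move=> n; set d := n.+1%:R^-1; have d0 : 0 < d by rewrite invr_gt0.
  have e0 : 0 < (d / 2) ^+ 2 by rewrite exprn_gt0// divr_gt0.
  apply: le_trans (leE _ e0); rewrite fourier1_weighted_real//.
  rewrite (fubini_tonelli1 (fun z => (gn d z)%:E)); last 2 first.
    exact/measurable_EFinP.
    by move=> z; rewrite lee_fin !mulr_ge0.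
  rewrite fubini_tonelli1/=; last 2 first.
    apply/measurable_EFinP; apply: measurable_funM; last exact: measurable_line_kernel.
    by apply: measurable_funM; [exact: (measurableT_comp mU1 measurable_fst)|exact: (measurableT_comp mU1 measurable_snd)].
    by move=> z; rewrite lee_fin !mulr_ge0// line_kernel_ge0.
  apply: le_of_eq; apply: eq_integral => x _.
  rewrite /fubini_F /gn /=.
  pose h (y : R) : R := d * (\1_U x * (\1_U y * line_kernel ((d / 2) ^+ 2) (x, y))).
  transitivity (\int[leb]_y (h (d * y + x))%:E)%E.
    apply: eq_integral => y _; rewrite /h /gz /line_kernel /= addrK; congr EFin.
    have -> : Num.sqrt (pi / (d / 2) ^+ 2) = 2 * Num.sqrt pi / d.
      rewrite sqrtrM ?pi_ge0// sqrtrV ?sqr_ge0// sqrtr_sqr ger0_norm ?divr_ge0// ?(ltW d0)//.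
      by field; rewrite gt_eqF.
    have -> : (d * y) ^+ 2 / (4 * (d / 2) ^+ 2) = y ^+ 2 by field; rewrite gt_eqF.
    by field; rewrite gt_eqF.
  have mk : measurable_fun setT (fun y : measurableTypeR R => \1_U x * (\1_U y * line_kernel ((d / 2) ^+ 2) (x, y))).
    apply: measurable_funM => //; apply: measurable_funM => //.
    by apply: (measurableT_comp (measurable_line_kernel _)); exact: measurable_pair1.
  rewrite (ge0_integral_affine x d0 (f := fun y => (h y)%:E)); last 2 first.
    by apply/measurable_EFinP; exact: measurable_funM.
    by move=> y; rewrite lee_fin !mulr_ge0// ?line_kernel_ge0// ltW.
  rewrite /h; under eq_integral do rewrite EFinM.
  rewrite ge0_integralZl//; try exact/measurable_EFinP; try by rewrite lee_fin ltW.
    2: by move=> y _; rewrite lee_fin !mulr_ge0// line_kernel_ge0.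
  rewrite muleA -EFinM mulVf ?gt_eqF// mul1e.
  by apply: eq_integral => y _; rewrite mulrA.
Qed.

End fourier_line.

Lemma ge0_lty_EFin (R : realType) (x : \bar R) : (0 <= x)%E -> (x < +oo)%E ->
  exists2 r : R, 0 <= r & x = r%:E.
Proof. by case: x => [r r0 _|//|//]; exists r. Qed.

Section plancherel_line.
Context {R : realType}.
Local Notation leb := (@lebesgue_measure R).
Implicit Types f g : measurableTypeR R -> R[i].

Definition L12 f := cintegrable leb f /\ (energy leb f < +oo)%E.

Definition plancherel1 f :=
  (energy leb (fourier1 f) = (2 * pi)%:E * energy leb f)%E.

Let cintegrable_twist f xi : cintegrable leb f ->
  cintegrable leb (fun x : measurableTypeR R => f x * expi (- (x * xi))).
Proof.
move=> intf; apply: cintegrableM_unit => //; last by move=> x; exact: nsq_expi.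
by apply: cmeasurable_expi; apply: measurableT_comp => //; exact: measurable_funM.
Qed.

Lemma fourier1D f g xi : cintegrable leb f -> cintegrable leb g ->
  fourier1 (fun x => f x + g x) xi = fourier1 f xi + fourier1 g xi.
Proof.
move=> intf intg; rewrite /fourier1 -cintegralD; try exact: cintegrable_twist.
by apply: eq_cintegral => x; rewrite mulrDl.
Qed.

Lemma fourier1Z (c : R[i]) f xi : cintegrable leb f ->
  fourier1 (fun x => c * f x) xi = c * fourier1 f xi.
Proof.
move=> intf; rewrite /fourier1 -cintegralZ; last exact: cintegrable_twist.
by apply: eq_cintegral => x; rewrite mulrA.
Qed.

Lemma fourier1B f g xi : cintegrable leb f -> cintegrable leb g ->
  fourier1 (fun x => f x - g x) xi = fourier1 f xi - fourier1 g xi.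
Proof.
move=> intf intg; rewrite /fourier1 -cintegralB; try exact: cintegrable_twist.
by apply: eq_cintegral => x; rewrite mulrBl.
Qed.

Lemma L12D f g : L12 f -> L12 g -> L12 (fun x => f x + g x).
Proof.
move=> [intf foo] [intg goo]; split; first exact: cintegrableD.
by apply: energyD_lty => //; [exact: cintegrable_cmeasurable intf|exact: cintegrable_cmeasurable intg].
Qed.

Lemma L12Z c f : L12 f -> L12 (fun x => c * f x).
Proof.
move=> [intf foo]; split; first exact: cintegrableZ.
by apply: energyZ_lty => //; exact: cintegrable_cmeasurable intf.
Qed.

Lemma L12B f g : L12 f -> L12 g -> L12 (fun x => f x - g x).
Proof.
move=> Lf Lg; have := L12D Lf (L12Z (-1) Lg).
by rewrite (_ : (fun x => _) = (fun x => f x - g x))//; apply/funext => x; rewrite mulN1r.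
Qed.

(* The deficit [2 pi |f|^2 - |fourier1 f|^2] is a nonnegative quadratic form, so
   by the parallelogram law it vanishes on a closed linear subspace. *)
Lemma fourier1_deficit f : L12 f -> exists a b : R,
  [/\ energy leb (fourier1 f) = a%:E, energy leb f = b%:E, 0 <= a, 0 <= b & a <= 2 * pi * b].
Proof.
move=> [intf foo]; have [b b0 bE] := ge0_lty_EFin (energy_ge0 leb f) foo.
have := fourier1_le intf; rewrite -!/(energy leb _) bE -EFinM => le.
have [a a0 aE] := ge0_lty_EFin (energy_ge0 leb (fourier1 f)) (le_lt_trans le (ltry _)).
by exists a, b; split=> //; move: le; rewrite aE lee_fin.
Qed.

Lemma fourier1_parallelogram f g : L12 f -> L12 g ->
  (energy leb (fourier1 (fun x => (f x + g x)%R)) + energy leb (fourier1 (fun x => (f x - g x)%R)) =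
   2%:E * energy leb (fourier1 f) + 2%:E * energy leb (fourier1 g))%E.
Proof.
move=> [intf _] [intg _].
rewrite -energy_parallelogram; try exact: cmeasurable_fourier1.
congr (_ + _)%E; apply: eq_integral => xi _; first by rewrite fourier1D.
by rewrite fourier1B.
Qed.

Lemma plancherel1D f g : L12 f -> L12 g -> plancherel1 f -> plancherel1 g ->
  plancherel1 (fun x => f x + g x).
Proof.
move=> Lf Lg; rewrite /plancherel1.
have E1 := fourier1_parallelogram Lf Lg.
have E2 := energy_parallelogram leb (cintegrable_cmeasurable Lf.1) (cintegrable_cmeasurable Lg.1).
have [a1 [b1 [A1 B1 _ _ h1]]] := fourier1_deficit (L12D Lf Lg).
have [a2 [b2 [A2 B2 _ _ h2]]] := fourier1_deficit (L12B Lf Lg).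
have [a3 [b3 [A3 B3 _ _ _]]] := fourier1_deficit Lf.
have [a4 [b4 [A4 B4 _ _ _]]] := fourier1_deficit Lg.
move: E1 E2; rewrite A1 A2 A3 A4 B1 B2 B3 B4 -!EFinM -!EFinD => -[E1] [E2] [E3] [E4].
congr EFin; set c := 2 * pi in h1 h2 E3 E4 *.
have : c * (b1 + b2) = c * (2 * b3 + 2 * b4) by rewrite E2.
lra.
Qed.

Lemma plancherel1Z c f : L12 f -> plancherel1 f -> plancherel1 (fun x => c * f x).
Proof.
move=> [intf _] pf; rewrite /plancherel1 energyZ; last exact: cintegrable_cmeasurable intf.
transitivity ((nsq c)%:E * energy leb (fourier1 f))%E; last by rewrite pf muleCA.
rewrite -energyZ; last exact: cmeasurable_fourier1.
by apply: eq_integral => xi _; rewrite fourier1Z.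
Qed.

Lemma plancherel1_closed f : L12 f ->
  (forall e : R, 0 < e -> exists g, [/\ L12 g, plancherel1 g &
    (energy leb (fun x => (f x - g x)%R) <= e%:E)%E]) -> plancherel1 f.
Proof.
move=> Lf apx; have [a [b [A B a0 b0 ab]]] := fourier1_deficit Lf.
rewrite /plancherel1 A B -EFinM; congr EFin; apply/eqP; rewrite eq_le ab /=.
apply/ler_addgt0Pr => e e0; have pi0 := pi_gt0 R.
have e1 : 0 < e / (4 * pi) by rewrite divr_gt0// mulr_gt0.
have [g [Lg pg]] := apx _ e1.
have E1 := fourier1_parallelogram (L12B Lf Lg) Lg.
have E2 := energy_parallelogram leb (cintegrable_cmeasurable (L12B Lf Lg).1) (cintegrable_cmeasurable Lg.1).
have [a1 [b1 [A1 B1 _ _ h1]]] := fourier1_deficit (L12B Lf Lg).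
have [a2 [b2 [A2 B2 _ _ h2]]] := fourier1_deficit (L12B (L12B Lf Lg) Lg).
have [a3 [b3 [A3 B3 _ _ _]]] := fourier1_deficit Lg.
have fE : (fun x => f x - g x + g x) = f by apply/funext => x; rewrite subrK.
move: E1 E2 pg; rewrite /plancherel1 !fE A A1 A2 A3 B B1 B2 B3 lee_fin -!EFinM -!EFinD.
move=> -[E1] [E2] [E3] ge1.
have : 4 * pi * b1 <= e by rewrite mulrC -ler_pdivlMr// mulr_gt0.
have a10 : 0 <= a1 by move: (energy_ge0 leb (fourier1 (fun x => f x - g x))); rewrite A1.
have : 2 * pi * (b + b2) = 2 * pi * (2 * b1 + 2 * b3) by rewrite E2.
lra.
Qed.

Lemma plancherel1_indic_open (U : set (measurableTypeR R)) : @open R U ->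
  (leb U < +oo)%E -> plancherel1 (fun x => (\1_U x)%:C).
Proof.
move=> oU Uoo; have mU : measurable U by exact: open_measurable.
apply/eqP; rewrite eq_le fourier1_le /=; last exact: cintegrable_indic.
by rewrite energy_indic// fourier1_indic_open.
Qed.

Lemma L12_indic (U : set (measurableTypeR R)) : measurable U ->
  (leb U < +oo)%E -> L12 (fun x => (\1_U x)%:C).
Proof. by move=> mU Uoo; split; [exact: cintegrable_indic|rewrite energy_indic]. Qed.

Lemma plancherel1_indic (A : set (measurableTypeR R)) : measurable A ->
  (leb A < +oo)%E -> plancherel1 (fun x => (\1_A x)%:C).
Proof.
move=> mA Aoo; apply: plancherel1_closed; first exact: L12_indic.
move=> e e0; have [U [oU AU Ue]] := lebesgue_regularity_outer mA Aoo e0.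
have mU : measurable U by exact: open_measurable.
have mUA : measurable (U `\` A) by exact: measurableD.
have Uoo : (leb U < +oo)%E.
  rewrite -(setDUK AU) measureU//; last by rewrite setDIK.
  by rewrite lte_add_pinfty// (lt_trans Ue)// ltry.
exists (fun x => (\1_U x)%:C); split; [exact: L12_indic|exact: plancherel1_indic_open|].
rewrite (_ : energy leb _ = leb (U `\` A)); first exact: ltW.
rewrite -energy_indic//; apply: eq_integral => x _; congr EFin.
rewrite -rmorphB !nsq_real !indicE in_setD.
have [xA|xA] := boolP (x \in A); last by rewrite /= andbT sub0r sqrrN.
by rewrite (mem_set (AU _ (set_mem xA))) /= subrr.
Qed.

End plancherel_line.

Section plancherel_line_total.
Context {R : realType}.
Local Notation leb := (@lebesgue_measure R).
Implicit Types f g : measurableTypeR R -> R[i].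

Lemma L12_plancherel1_0 : L12 (fun _ : measurableTypeR R => 0 : R[i]) /\
  plancherel1 (fun _ : measurableTypeR R => 0 : R[i]).
Proof.
have m0 : measurable (set0 : set (measurableTypeR R)) by exact: measurable0.
have L0 := L12_indic m0; rewrite measure0 in L0; have {}L0 := L0 (ltry 0).
have P0 := plancherel1_indic m0; rewrite measure0 in P0; have {}P0 := P0 (ltry 0).
have -> : (fun _ => 0 : R[i]) = (fun x : measurableTypeR R => 0 * (\1_(set0 : set (measurableTypeR R)) x)%:C).
  by apply/funext => x; rewrite mul0r.
by split; [exact: L12Z|exact: plancherel1Z].
Qed.

Import HBNNSimple.

Lemma plancherel1_sum (I : Type) (s : seq I) (F : I -> measurableTypeR R -> R[i]) :
  (forall i, L12 (F i) /\ plancherel1 (F i)) ->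
  L12 (fun x => \sum_(i <- s) F i x) /\ plancherel1 (fun x => \sum_(i <- s) F i x).
Proof.
move=> FP; elim: s => [|i s [IL IP]].
  by under eq_fun do rewrite big_nil; exact: L12_plancherel1_0.
have [Li Pi] := FP i.
under eq_fun do rewrite big_cons.
by split; [exact: L12D|exact: plancherel1D].
Qed.

Lemma plancherel1_ge0 (r : measurableTypeR R -> R) : measurable_fun setT r ->
  (forall x, 0 <= r x) -> L12 (fun x => (r x)%:C) -> plancherel1 (fun x => (r x)%:C).
Proof.
move=> mr r0 Lr; have intr : leb.-integrable setT (fun x => (r x)%:E) by case: Lr => -[].
have mrE : measurable_fun setT (EFin \o r) by exact/measurable_EFinP.
have r0E x : [set: measurableTypeR R] x -> (0 <= (EFin \o r) x)%E by rewrite lee_fin.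
pose h := nnsfun_approx measurableT mrE.
have hr x : h n x @[n --> \oo] --> r x.
  by have /fine_cvgP[_] := cvg_nnsfun_approx measurableT mrE r0E (I : [set: measurableTypeR R] x).
have hle n x : h n x <= r x.
  rewrite -(cvg_lim _ (hr x))//; apply: nondecreasing_cvgn_le.
    by move=> i j ij; apply/lefP; exact: nd_nnsfun_approx.
  by apply/cvg_ex; exists (r x).
have h0 n x : 0 <= h n x by exact: fun_ge0.
have Ph n : L12 (fun x => (h n x)%:C) /\ plancherel1 (fun x => (h n x)%:C).
  pose F (y : R) (x : measurableTypeR R) : R[i] := y%:C * (\1_(h n @^-1` [set y]) x)%:C.
  have -> : (fun x => (h n x)%:C) =
      (fun x => \sum_(y <- finmap.enum_fset (fset_set (range (h n)))) F y x).
    apply/funext => x; rewrite fimfunE fsbig_finite// rmorph_sum; apply: eq_bigr => i _.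
    by rewrite rmorphM.
  apply: plancherel1_sum => y; rewrite /F.
  have [->|y0] := eqVneq y 0.
    under eq_fun do rewrite mul0r; exact: L12_plancherel1_0.
  set A := h n @^-1` [set y].
  have mA : measurable A by exact: measurable_funPTI.
  have Aoo : (leb A < +oo)%E.
    have [yneg|] := ltP y 0.
      rewrite (_ : A = set0) ?measure0 ?ltry// -subset0 => x; rewrite /A /= => hy.
      by have := h0 n x; rewrite hy leNgt yneg.
    rewrite le_eqVlt eq_sym (negbTE y0) /= => {}y0.
    have : (\int[leb]_x (y * \1_A x)%:E <= \int[leb]_x (r x)%:E)%E.
      apply: ge0_le_integral => //.
      - by move=> x _; rewrite lee_fin mulr_ge0// ltW.
      - by apply/measurable_EFinP; apply: measurable_funM => //; exact: measurable_indic.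
      - move=> x _; rewrite lee_fin indicE; have [|] := boolP (x \in A); last by rewrite mulr0.
        by rewrite inE /A /= mulr1 => <-.
    under eq_integral do rewrite EFinM.
    rewrite ge0_integralZl//; last 2 first.
      by apply/measurable_EFinP; exact: measurable_indic.
      by rewrite lee_fin ltW.
    rewrite integral_indic// setIT => le.
    have : (y%:E * leb A < +oo)%E.
      by apply: (le_lt_trans le); exact: integrable_lty intr.
    by apply: contraTT; rewrite -!leNgt !leye_eq => /eqP ->; rewrite gt0_muley// lte_fin.
  by split; [apply: L12Z; exact: L12_indic|apply: plancherel1Z; [exact: L12_indic|exact: plancherel1_indic]].
apply: plancherel1_closed => // e e0.
pose g_ n (x : measurableTypeR R) := ((r x - h n x) ^+ 2)%:E.
have intr2 : leb.-integrable setT (fun x => (r x ^+ 2)%:E).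
  apply: ge0_integrable; [exact: measurable_funX|by move=> x; exact: sqr_ge0|].
  by case: Lr => _; rewrite /energy; under eq_integral do rewrite nsq_real.
have mg_ n : measurable_fun setT (g_ n).
  apply/measurable_EFinP; apply: measurable_funX; apply: measurable_funB => //.
have g_0 : {ae leb, forall x, [set: measurableTypeR R] x -> g_ ^~ x @ \oo --> cst 0%E x}.
  apply: aeW => x _; apply: cvg_EFin; first exact: nearW.
  rewrite (_ : (0 : R) = (r x - r x) * (r x - r x)); last by rewrite subrr mul0r.
  under eq_fun do rewrite /g_ /= expr2.
  by apply: cvgM; (apply: cvgB; first exact: cvg_cst); exact: hr.
have g_r : {ae leb, forall x n, [set: measurableTypeR R] x -> (`|g_ n x| <= (r x ^+ 2)%:E)%E}.
  apply: aeW => x n _; rewrite gee0_abs ?lee_fin ?sqr_ge0//.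
  have := hle n x; have := h0 n x; nra.
have [_ _ cvg0] := dominated_convergence measurableT mg_ (measurable_cst _) g_0 intr2 g_r.
rewrite integral0 in cvg0.
have /fine_cvgP[/= fin cvgf] := cvg0.
have /cvgrPdist_lt /(_ e e0) near_e := cvgf.
near \oo => n.
exists (fun x => (h n x)%:C); split; [exact: (Ph n).1|exact: (Ph n).2|].
have -> : energy leb (fun x => (r x)%:C - (h n x)%:C) = (\int[leb]_x g_ n x)%E.
  by apply: eq_integral => x _; rewrite -rmorphB nsq_real.
have fn : (\int[leb]_x g_ n x)%E \is a fin_num by near: n.
rewrite -(fineK fn) lee_fin ltW//.
have : `|0 - fine (\int[leb]_x g_ n x)%E| < e by near: n.
by rewrite sub0r normrN; apply: le_lt_trans; exact: ler_norm.
Unshelve. all: end_near. Qed.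

Lemma L12_le f g : cmeasurable g -> L12 f -> (forall x, nsq (g x) <= nsq (f x)) -> L12 g.
Proof.
move=> mg [intf foo] gf; split.
  by apply: (cintegrable_le mg intf) => x; rewrite !normcE ler_wsqrtr.
apply: le_lt_trans foo; apply: ge0_le_integral => //.
- by move=> x _; rewrite lee_fin nsq_ge0.
- exact: emeasurable_nsq.
- by apply: emeasurable_nsq; exact: cintegrable_cmeasurable intf.
- by move=> x _; rewrite lee_fin.
Qed.

Lemma plancherel1_real (r : measurableTypeR R -> R) : measurable_fun setT r ->
  L12 (fun x => (r x)%:C) -> plancherel1 (fun x => (r x)%:C).
Proof.
move=> mr Lr.
have Lp : L12 (fun x => (Num.max (r x) 0)%:C).
  apply: (L12_le _ Lr); first by apply: cmeasurable_real; exact: measurable_maxr.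
  by move=> x; rewrite !nsq_real; case: (leP (r x) 0) => h; nra.
have Ln : L12 (fun x => (Num.max (- r x) 0)%:C).
  apply: (L12_le _ Lr).
    by apply: cmeasurable_real; apply: measurable_maxr => //; exact: measurableT_comp.
  by move=> x; rewrite !nsq_real; case: (leP (- r x) 0) => h; nra.
have -> : (fun x => (r x)%:C) = (fun x => (Num.max (r x) 0)%:C + (-1) * (Num.max (- r x) 0)%:C).
  apply/funext => x; rewrite mulN1r -rmorphB; congr (_%:C).
  by case: (leP (r x) 0) => h1; case: (leP (- r x) 0) => h2; lra.
apply: plancherel1D => //; first exact: L12Z.
  apply: plancherel1_ge0 => //; first exact: measurable_maxr.
  by move=> x; rewrite le_max lexx orbT.
apply: plancherel1Z => //; apply: plancherel1_ge0 => //.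
  by apply: measurable_maxr => //; exact: measurableT_comp.
by move=> x; rewrite le_max lexx orbT.
Qed.

Lemma plancherel_line f : L12 f -> plancherel1 f.
Proof.
move=> Lf; have [mf1 mf2] := cintegrable_cmeasurable Lf.1.
have L1 : L12 (fun x => (complex.Re (f x))%:C).
  apply: (L12_le _ Lf); first exact: cmeasurable_real.
  by move=> x; rewrite nsq_real lerDl sqr_ge0.
have L2 : L12 (fun x => (complex.Im (f x))%:C).
  apply: (L12_le _ Lf); first exact: cmeasurable_real.
  by move=> x; rewrite nsq_real lerDr sqr_ge0.
have -> : f = (fun x => (complex.Re (f x))%:C + 'i%C * (complex.Im (f x))%:C).
  by apply/funext => x; case: (f x) => a b; apply/eqP; rewrite eq_complex /=; apply/andP; split; apply/eqP; ring.
by apply: plancherel1D => //; [exact: L12Z|exact: plancherel1_real|apply: plancherel1Z => //; exact: plancherel1_real].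
Qed.

End plancherel_line_total.

Section almost_everywhere.
Context d (T : measurableType d) (R : realType) (mu : {measure set T -> \bar R}).

Lemma ae_eq_cintegral (f g : T -> R[i]) : cmeasurable f -> cmeasurable g ->
  {ae mu, forall x, f x = g x} -> cintegral mu f = cintegral mu g.
Proof.
move=> [mf1 mf2] [mg1 mg2] fg; rewrite /cintegral /Rintegral; congr (fine _ +i* fine _).
  apply: ae_eq_integral => //; [exact/measurable_EFinP|exact/measurable_EFinP|].
  by apply: filterS fg => x + _ => ->.
apply: ae_eq_integral => //; [exact/measurable_EFinP|exact/measurable_EFinP|].
by apply: filterS fg => x + _ => ->.
Qed.

Lemma ae_eq_energy (f g : T -> R[i]) : cmeasurable f -> cmeasurable g ->
  {ae mu, forall x, f x = g x} -> energy mu f = energy mu g.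
Proof.
move=> mf mg fg; apply: ae_eq_integral => //.
- exact: emeasurable_nsq.
- exact: emeasurable_nsq.
- by apply: filterS fg => x + _ => ->.
Qed.

Lemma ae_lty (f : T -> \bar R) : measurable_fun setT f -> (forall x, 0 <= f x)%E ->
  (\int[mu]_x f x < +oo)%E -> {ae mu, forall x, (f x < +oo)%E}.
Proof.
move=> mf f0 foo.
have intf : mu.-integrable setT f.
  by apply/integrableP; split=> //; under eq_integral do rewrite gee0_abs//.
have := integrable_ae measurableT intf.
by apply: filterS => x /(_ I); rewrite ge0_fin_numE.
Qed.

End almost_everywhere.

Section Rn_integrals.
Context {R : realType}.
Local Notation leb := (@lebesgue_measure R).
Local Notation mu n := (lebesgue_Rn R n).

Definition cons_image n : {measure set (Rn R n.+1) -> \bar R}.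
Proof.
refine (pushforward (leb \x mu n)%E (@cons_Rn R n) : {measure set _ -> \bar R}).
exact: measurable_cons_Rn.
Defined.

Definition split_Rn n (x : Rn R n.+1) : spacetime R n :=
  (thead x, [tuple of behead x]).

Lemma measurable_split_Rn n : measurable_fun setT (@split_Rn n).
Proof.
apply/measurable_fun_pairP; split; first exact: measurable_tnth.
exact: measurable_behead.
Qed.

Lemma split_RnK n : cancel (@split_Rn n) (@cons_Rn R n).
Proof. by move=> x; rewrite [RHS]tuple_eta; exact/val_inj. Qed.

Lemma measurable_consP d (T : measurableType d) n (f : Rn R n.+1 -> T) :
  measurable_fun setT (f \o @cons_Rn R n) -> measurable_fun setT f.
Proof.
move=> mf; rewrite (_ : f = (f \o @cons_Rn R n) \o @split_Rn n).
  by apply: measurableT_comp => //; exact: measurable_split_Rn.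
by apply/funext => x /=; rewrite split_RnK.
Qed.

Lemma ge0_integral_cons n (f : Rn R n.+1 -> \bar R) : measurable_fun setT f ->
  (forall x, 0 <= f x)%E ->
  (\int[mu n.+1]_x f x = \int[leb \x mu n]_z f (cons_Rn z))%E.
Proof.
move=> mf f0; rewrite (eq_measure_integral (cons_image n))//.
by rewrite ge0_integral_pushforward//; exact: measurable_cons_Rn.
Qed.

Lemma ge0_integral_cons2 n (f : Rn R n.+1 -> \bar R) : measurable_fun setT f ->
  (forall x, 0 <= f x)%E ->
  (\int[mu n.+1]_x f x = \int[leb]_a \int[mu n]_x f (cons_Rn (a, x)))%E.
Proof.
move=> mf f0; rewrite ge0_integral_cons//.
by rewrite (fubini_tonelli1 (fun z => f (cons_Rn z)))//; exact: measurableT_comp.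
Qed.

Lemma Rintegral_cons n (f : Rn R n.+1 -> R) : measurable_fun setT f ->
  \int[mu n.+1]_x f x = \int[(leb \x mu n)%E]_z f (cons_Rn z).
Proof.
move=> mf; have mfE : measurable_fun setT (EFin \o f) by exact/measurable_EFinP.
rewrite /Rintegral integralE [in RHS]integralE; congr (fine (_ - _)%E).
  rewrite ge0_integral_cons//; last exact: measurable_funepos.
  by apply: eq_integral => x _; rewrite !funeposE.
rewrite ge0_integral_cons//; last exact: measurable_funeneg.
by apply: eq_integral => x _; rewrite !funenegE.
Qed.

Lemma cintegral_cons n (f : Rn R n.+1 -> R[i]) : cmeasurable f ->
  cintegral (mu n.+1) f = cintegral (leb \x mu n)%E (fun z => f (cons_Rn z)).
Proof.
move=> [mf1 mf2]; rewrite /cintegral; congr (_ +i* _).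
  by rewrite (Rintegral_cons mf1).
by rewrite (Rintegral_cons mf2).
Qed.

Lemma cmeasurable_cons n (f : Rn R n.+1 -> R[i]) :
  cmeasurable f <-> cmeasurable (fun z => f (cons_Rn z)).
Proof.
split=> [mf|[mf1 mf2]]; first exact: (cmeasurable_comp (@measurable_cons_Rn R n) mf).
by split; exact: measurable_consP.
Qed.

Lemma cintegrable_cons n (f : Rn R n.+1 -> R[i]) :
  cintegrable (mu n.+1) f <-> cintegrable (leb \x mu n)%E (fun z => f (cons_Rn z)).
Proof.
have E : cmeasurable f -> (\int[mu n.+1]_x `|(normc (f x))%:E| = \int[leb \x mu n]_z `|(normc (f (cons_Rn z)))%:E|)%E.
  move=> mf; rewrite ge0_integral_cons//.
  by apply: measurableT_comp => //; apply/measurable_EFinP; exact: measurable_normc.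
split=> /cintegrableP[mf /integrableP[mn oo]]; apply/cintegrableP.
  split; first exact/cmeasurable_cons.
  apply/integrableP; split; last by rewrite -E.
  by apply/measurable_EFinP; apply: measurable_normc; exact/cmeasurable_cons.
have {}mf : cmeasurable f by exact/cmeasurable_cons.
split=> //; apply/integrableP; split; last by rewrite E.
by apply/measurable_EFinP; exact: measurable_normc.
Qed.

Lemma dot_cons n (z w : spacetime R n) :
  dot (cons_Rn z) (cons_Rn w) = z.1 * w.1 + dot z.2 w.2.
Proof.
rewrite /dot big_ord_recl /= !tnth0; congr (_ + _).
by apply: eq_bigr => i _; rewrite !tnthS.
Qed.

Lemma measurable_dot n d (T : measurableType d) (f g : T -> Rn R n) :
  measurable_fun setT f -> measurable_fun setT g ->
  measurable_fun setT (fun x => dot (f x) (g x)).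
Proof.
move=> mf mg; rewrite /dot; apply: measurable_sum => i.
by apply: measurable_funM; apply: (measurableT_comp (measurable_tnth i)).
Qed.

Lemma energy_cons n (f : Rn R n.+1 -> R[i]) : cmeasurable f ->
  energy (mu n.+1) f = energy (leb \x mu n)%E (fun z => f (cons_Rn z)).
Proof.
move=> mf; rewrite /energy ge0_integral_cons//.
  exact: emeasurable_nsq.
by move=> x; rewrite lee_fin nsq_ge0.
Qed.

Lemma cintegral_Rn0 (f : Rn R 0 -> R[i]) : cmeasurable f ->
  cintegral (mu 0) f = f [tuple].
Proof.
move=> [mf1 mf2]; rewrite /cintegral /Rintegral /= !integral_dirac//; last 2 first.
  exact/measurable_EFinP.
  exact/measurable_EFinP.
by rewrite !diracT !mul1e /=; case: (f _).
Qed.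

Lemma energy_Rn0 (f : Rn R 0 -> R[i]) : cmeasurable f ->
  energy (mu 0) f = (nsq (f [tuple]))%:E.
Proof.
move=> mf; rewrite /energy /= integral_dirac//.
  by rewrite diracT mul1e.
exact: emeasurable_nsq.
Qed.

Lemma dot_Rn0 (x y : Rn R 0) : dot x y = 0.
Proof. by rewrite /dot big_ord0. Qed.

Lemma cmeasurable_fourier n (f : Rn R n -> R[i]) : cmeasurable f ->
  cmeasurable (fourier_integral f).
Proof.
move=> mf; apply: (@cmeasurable_cintegral2 _ _ _ _ R (mu n)
  (fun z => f z.2 * expi (- dot z.2 z.1))).
apply: cmeasurableM; first exact: (cmeasurable_comp measurable_snd mf).
apply: cmeasurable_expi; apply: measurableT_comp => //.
by apply: measurable_dot; [exact: measurable_snd|exact: measurable_fst].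
Qed.

Lemma cintegrable_Rn_twist n (f : Rn R n -> R[i]) (h : Rn R n -> R) :
  measurable_fun setT h -> cintegrable (mu n) f ->
  cintegrable (mu n) (fun x => f x * expi (h x)).
Proof.
move=> mh intf; apply: cintegrableM_unit => //; first exact: cmeasurable_expi.
by move=> x; exact: nsq_expi.
Qed.

Lemma cintegrable_gauss_Rn n (a : R) (b : Rn R n) : 0 < a ->
  cintegrable (mu n) (fun x => (expR (- (a * dot x x)))%:C * expi (dot b x)).
Proof.
move=> a0; elim: n b => [|n IH] b.
  under eq_fun do rewrite !dot_Rn0 mulr0 oppr0 expR0 expi0 mulr1.
  split => /=; last exact: integrable0.
  apply: ge0_integrable => //.
  by rewrite integral_dirac// diracT mul1e ltry.
apply/cintegrable_cons.
have := cintegrable_prod (cintegrable_gauss (split_Rn b).1 a0) (IH (split_Rn b).2).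
congr cintegrable; apply/funext => z.
rewrite -[in RHS](split_RnK b) !dot_cons mulrDr opprD expRD expiD rmorphM -expr2.
ring.
Qed.

Lemma cintegrable_gaussian_Rn n (a : R) : 0 < a ->
  cintegrable (mu n) (fun x => (expR (- (a * dot x x)))%:C).
Proof.
move=> a0; have := cintegrable_gauss_Rn [tuple of nseq n 0] a0.
congr cintegrable; apply/funext => x.
rewrite (_ : dot [tuple of nseq n 0] x = 0) ?expi0 ?mulr1//.
by rewrite /dot big1// => i _; rewrite tnth_nseq mul0r.
Qed.

Lemma gauss_fourier_Rn n (a : R) (b : Rn R n) : 0 < a ->
  cintegral (mu n) (fun x => (expR (- (a * dot x x)))%:C * expi (dot b x)) =
  (Num.sqrt (pi / a) ^+ n * expR (- (dot b b / (4 * a))))%:C.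
Proof.
move=> a0; elim: n b => [|n IH] b.
  under eq_fun do rewrite !dot_Rn0 mulr0 oppr0 expR0 expi0 mulr1.
  rewrite cintegral_Rn0; last exact: cmeasurable_cst.
  by rewrite dot_Rn0 mul0r oppr0 expR0 mulr1.
rewrite cintegral_cons; last exact: cintegrable_cmeasurable (cintegrable_gauss_Rn _ a0).
have E (z : spacetime R n) : (expR (- (a * dot (cons_Rn z) (cons_Rn z))))%:C * expi (dot b (cons_Rn z)) =
  ((expR (- (a * z.1 ^+ 2)))%:C * expi ((split_Rn b).1 * z.1)) *
  ((expR (- (a * dot z.2 z.2)))%:C * expi (dot (split_Rn b).2 z.2)).
  rewrite -[in LHS](split_RnK b) !dot_cons mulrDr opprD expRD expiD rmorphM -expr2.
  ring.
rewrite (eq_cintegral _ E).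
rewrite (cintegral_prod (cintegrable_gauss (split_Rn b).1 a0) (cintegrable_gauss_Rn (split_Rn b).2 a0)).
rewrite gauss_fourier// IH -rmorphM; congr (_%:C).
have -> : dot b b / (4 * a) = (split_Rn b).1 ^+ 2 / (4 * a) + dot (split_Rn b).2 (split_Rn b).2 / (4 * a).
  by rewrite -[in LHS](split_RnK b) dot_cons mulrDl expr2.
set A := _ / (4 * a); set B := _ / (4 * a).
by rewrite (opprD A B) expRD exprS; ring.
Qed.

Lemma fourier_Rn0 (f : Rn R 0 -> R[i]) : cmeasurable f ->
  fourier_integral f [tuple] = f [tuple].
Proof.
move=> mf; rewrite /fourier_integral; under eq_fun do rewrite dot_Rn0 oppr0 expi0 mulr1.
exact: cintegral_Rn0.
Qed.

Section plancherel_step.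
Variables (n : nat) (f : Rn R n.+1 -> R[i]).
Hypothesis intf : cintegrable (mu n.+1) f.
Hypothesis foo : (energy (mu n.+1) f < +oo)%E.

Let mf := cintegrable_cmeasurable intf.
Let intfc : cintegrable (leb \x mu n)%E (fun z => f (cons_Rn z)) := (cintegrable_cons f).1 intf.
Let mfc : cmeasurable (fun z => f (cons_Rn z)) := cintegrable_cmeasurable intfc.

Let h (z : spacetime R n) : R[i] :=
  fourier1 (fun a => f (cons_Rn (a, z.2))) z.1.

Let mh : cmeasurable h.
Proof.
pose F (w : measurableTypeR R * (spacetime R n)) : R[i] :=
  f (cons_Rn (w.1, w.2.2)) * expi (- (w.1 * w.2.1)).
have : cmeasurable F.
  have m21 : measurable_fun setT (fun w : measurableTypeR R * (spacetime R n) => w.2.1).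
    exact: (measurableT_comp measurable_fst measurable_snd).
  have m22 : measurable_fun setT (fun w : measurableTypeR R * (spacetime R n) => w.2.2).
    exact: (measurableT_comp measurable_snd measurable_snd).
  apply: cmeasurableM.
    apply: (cmeasurable_comp _ mfc).
    by apply/measurable_fun_pairP; split => //; exact: measurable_fst.
  apply: cmeasurable_expi; apply: measurableT_comp => //.
  by apply: measurable_funM => //; exact: measurable_fst.
exact: (@cmeasurable_cintegral1 _ _ _ _ R leb F).
Qed.

Let int_twist a : cintegrable (leb \x mu n)%E
  (fun z : spacetime R n => f (cons_Rn z) * expi (- (z.1 * a))).
Proof.
apply: cintegrableM_unit => //; last by move=> x; exact: nsq_expi.
apply: cmeasurable_expi; apply: measurableT_comp => //.
by apply: measurable_funM => //; exact: measurable_fst.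
Qed.

Let inth a : cintegrable (mu n) (fun x => h (a, x)).
Proof. exact: (cintegrable_cintegral1 (int_twist a)). Qed.

Let fourierE z : fourier_integral f (cons_Rn z) = fourier_integral (fun x => h (z.1, x)) z.2.
Proof.
case: z => a x /=; rewrite /fourier_integral cintegral_cons; last first.
  apply: cmeasurableM => //; apply: cmeasurable_expi; apply: measurableT_comp => //.
  exact: measurable_dot.
have E (z : spacetime R n) : f (cons_Rn z) * expi (- dot (cons_Rn z) (cons_Rn (a, x))) =
    (f (cons_Rn z) * expi (- (z.1 * a))) * expi (- dot z.2 x).
  by rewrite dot_cons opprD expiD mulrA.
have intE : cintegrable (leb \x mu n)%E (fun z : spacetime R n =>
    f (cons_Rn z) * expi (- (z.1 * a)) * expi (- dot z.2 x)).
  apply: cintegrableM_unit => //; last by move=> z; exact: nsq_expi.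
  apply: cmeasurable_expi; apply: measurableT_comp => //.
  by apply: measurable_dot => //; exact: measurable_snd.
rewrite (eq_cintegral _ E) -(cfubini1 intE).
apply: ae_eq_cintegral.
- exact: cintegrable_cmeasurable (cintegrable_cintegral1 intE).
- apply: cmeasurableM; first exact: cintegrable_cmeasurable (inth a).
  apply: cmeasurable_expi; apply: measurableT_comp => //.
  exact: measurable_dot.
have [i1 i2] := int_twist a.
apply: filterS2 (ae_integrable2 i1) (ae_integrable2 i2) => y j1 j2.
exact: (cintegralZr (expi (- dot y x)) (conj j1 j2)).
Qed.

Let ae_slice : {ae mu n, forall x, L12 (fun a => f (cons_Rn (a, x)))}.
Proof.
have [i1 i2] := intfc.
have mE : measurable_fun setT (fun z => (nsq (f (cons_Rn z)))%:E).
  exact: emeasurable_nsq.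
have E0 z : (0 <= (nsq (f (cons_Rn z)))%:E)%E by rewrite lee_fin nsq_ge0.
have foo' : (\int[mu n]_x energy leb (fun a => f (cons_Rn (a, x))) < +oo)%E.
  by move: foo; rewrite energy_cons// /energy fubini_tonelli2.
have ae3 := ae_lty (measurable_fun_fubini_tonelli_G _ mE E0) (fun x => energy_ge0 _ _) foo'.
by apply: filterS3 (ae_integrable2 i1) (ae_integrable2 i2) ae3 => y j1 j2 j3; split.
Qed.

Let energy_h : energy (leb \x mu n)%E h = ((2 * pi)%:E * energy (mu n.+1) f)%E.
Proof.
have mE : measurable_fun setT (fun z => (nsq (f (cons_Rn z)))%:E).
  exact: emeasurable_nsq.
have E0 z : (0 <= (nsq (f (cons_Rn z)))%:E)%E by rewrite lee_fin nsq_ge0.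
have mEh : measurable_fun setT (fun z => (nsq (h z))%:E).
  exact: emeasurable_nsq.
have Eh0 z : (0 <= (nsq (h z))%:E)%E by rewrite lee_fin nsq_ge0.
rewrite energy_cons// /energy !fubini_tonelli2// -ge0_integralZl//; last 3 first.
- exact: measurable_fun_fubini_tonelli_G.
- by move=> x _; exact: integral_ge0.
- by rewrite lee_fin mulr_ge0 ?pi_ge0.
apply: ae_eq_integral => //.
- exact: measurable_fun_fubini_tonelli_G.
- by apply: measurable_funeM; exact: measurable_fun_fubini_tonelli_G.
- by apply: filterS ae_slice => x Lx _; exact: (plancherel_line Lx).
Qed.

Lemma plancherel_succ (c : R) : 0 <= c ->
  (forall g, cintegrable (mu n) g -> (energy (mu n) g < +oo)%E ->
    energy (mu n) (fourier_integral g) = (c%:E * energy (mu n) g)%E) ->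
  energy (mu n.+1) (fourier_integral f) = ((2 * pi * c)%:E * energy (mu n.+1) f)%E.
Proof.
move=> c0 IH; have mF := cmeasurable_fourier mf.
have mFE : measurable_fun setT (fun z => (nsq (fourier_integral (fun x => h (z.1, x)) z.2))%:E).
  under eq_fun do rewrite -fourierE.
  by apply: emeasurable_nsq; exact/cmeasurable_cons.
have mEh : measurable_fun setT (fun z => (nsq (h z))%:E).
  exact: emeasurable_nsq.
have Eh0 z : (0 <= (nsq (h z))%:E)%E by rewrite lee_fin nsq_ge0.
rewrite energy_cons// /energy; under eq_integral do rewrite fourierE.
rewrite fubini_tonelli1//; last by move=> z; rewrite lee_fin nsq_ge0.
rewrite mulrC EFinM -muleA -energy_h /energy fubini_tonelli1// -ge0_integralZl//; last 2 first.
- exact: measurable_fun_fubini_tonelli_F.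
- by move=> x _; exact: integral_ge0.
have hoo : (\int[leb]_a energy (mu n) (fun x => h (a, x)) < +oo)%E.
  have := energy_h; rewrite /energy fubini_tonelli1// => ->.
  by rewrite lte_mul_pinfty// lee_fin mulr_ge0 ?pi_ge0.
apply: ae_eq_integral => //.
- by apply: measurable_fun_fubini_tonelli_F => // z; rewrite lee_fin nsq_ge0.
- by apply: measurable_funeM; exact: measurable_fun_fubini_tonelli_F.
- have := ae_lty (measurable_fun_fubini_tonelli_F _ mEh Eh0) (fun x => energy_ge0 _ _) hoo.
  by apply: filterS => a oo _; exact: (IH _ (inth a) oo).
Qed.

End plancherel_step.

Theorem plancherel n (f : Rn R n -> R[i]) : cintegrable (mu n) f ->
  (energy (mu n) f < +oo)%E ->
  energy (mu n) (fourier_integral f) = (((2 * pi) ^+ n)%:E * energy (mu n) f)%E.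
Proof.
elim: n f => [|n IH] f intf foo; last first.
  by rewrite exprS; apply: plancherel_succ => //; rewrite exprn_ge0// mulr_ge0 ?pi_ge0.
have mf := cintegrable_cmeasurable intf.
by rewrite expr0 mul1e !energy_Rn0//; [rewrite fourier_Rn0|exact: cmeasurable_fourier].
Qed.

End Rn_integrals.

(** * The Fourier transform on L2 *)

Section L2_norm.
Context d (T : measurableType d) (R : realType) (mu : {measure set T -> \bar R}).
Implicit Types f g : T -> R[i].
Local Notation N2 := (cLnorm mu 2).

Lemma Lnorm2_real (r : T -> R) :
  ('N[mu]_2%:E[EFin \o r] = (\int[mu]_x (r x ^+ 2)%:E) `^ 2^-1)%E.
Proof.
rewrite unlock; congr (_ `^ _)%E; apply: eq_integral => x _.
by rewrite abse_EFin poweR_EFin powR_mulrn// -normrX ger0_norm// sqr_ge0.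
Qed.

Lemma cLnorm2E f : N2 f = (energy mu f `^ 2^-1)%E.
Proof.
rewrite /cLnorm Lnorm2_real; congr (_ `^ _)%E; apply: eq_integral => x _.
by rewrite normc_sqr.
Qed.

Lemma cLnorm2_lty f : (N2 f < +oo)%E <-> (energy mu f < +oo)%E.
Proof.
rewrite cLnorm2E; split; last exact: poweR_lty.
by apply: lty_poweRy; rewrite invr_eq0.
Qed.

Lemma cLnorm2_ge0 f : (0 <= N2 f)%E.
Proof. by rewrite cLnorm2E poweR_ge0. Qed.

Lemma sqr_cLnorm2 f : (N2 f * N2 f)%E = energy mu f.
Proof.
rewrite cLnorm2E; have := energy_ge0 mu f; case: (energy mu f) => [r r0| _|//].
  by rewrite poweR_EFin -EFinM powR12_sqrt// -expr2 sqr_sqrtr.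
by rewrite poweRyr ?invr_eq0// mulyy.
Qed.

Lemma cLnorm2D f g : cmeasurable f -> cmeasurable g ->
  (N2 (fun x => (f x + g x)%R) <= N2 f + N2 g)%E.
Proof.
move=> mf mg.
apply: (@le_trans _ _ ('N[mu]_2%:E[EFin \o ((fun x => normc (f x)) \+ (fun x => normc (g x)))%R])%E).
  rewrite cLnorm2E Lnorm2_real; apply: gt0_ler_poweR.
  - by rewrite invr_ge0.
  - by rewrite in_itv /= energy_ge0 leey.
  - by rewrite in_itv /= leey andbT; apply: integral_ge0 => x _; rewrite lee_fin sqr_ge0.
  - apply: ge0_le_integral => //.
    + by move=> x _; rewrite lee_fin nsq_ge0.
    + by apply: emeasurable_nsq; exact: cmeasurableD.
    + apply/measurable_EFinP; apply: measurable_funX; apply: measurable_funD; exact: measurable_normc.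
    + move=> x _; rewrite lee_fin -normc_sqr lerXn2r ?nnegrE ?addr_ge0 ?normc_ge0//.
      exact: normcD.
apply: eminkowski; [exact: measurable_normc|exact: measurable_normc|].
by rewrite lee_fin ler1n.
Qed.

Lemma cLnorm2_subC f g : N2 (fun x => f x - g x) = N2 (fun x => g x - f x).
Proof. by rewrite !cLnorm2E -energyN; congr (_ `^ _)%E; apply: eq_integral => x _; rewrite opprB. Qed.

Lemma cLnorm2_triangle f g h : cmeasurable f -> cmeasurable g -> cmeasurable h ->
  (N2 (fun x => (f x - h x)%R) <= N2 (fun x => (f x - g x)%R) + N2 (fun x => (g x - h x)%R))%E.
Proof.
move=> mf mg mh.
rewrite (_ : (fun x => f x - h x) = (fun x => (f x - g x) + (g x - h x))); last first.
  by apply/funext => x; rewrite addrA subrK.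
by apply: cLnorm2D; exact: cmeasurableB.
Qed.

Lemma cLp2P f : cLp mu 2 f <-> cmeasurable f /\ (energy mu f < +oo)%E.
Proof. by split=> -[mf foo]; split => //; exact/cLnorm2_lty. Qed.

Lemma cLp1P f : cLp mu 1 f <-> cintegrable mu f.
Proof.
have E : cmeasurable f -> cLnorm mu 1 f = (\int[mu]_x `|(normc (f x))%:E|)%E by move=> _; rewrite /cLnorm Lnorm1.
split=> [[mf]|intf].
  rewrite E// => foo; apply/cintegrableP; split => //; apply/integrableP; split => //.
  by apply/measurable_EFinP; exact: measurable_normc.
have [mf /integrableP[_ foo]] := (cintegrableP _ _).1 intf.
by split=> //; rewrite E.
Qed.

Lemma integrable_Re_mul f g : cmeasurable f -> cmeasurable g ->
  (energy mu f < +oo)%E -> (energy mu g < +oo)%E ->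
  cintegrable mu (fun x => f x * conjc (g x)).
Proof.
move=> mf mg foo goo.
have mm : cmeasurable (fun x => f x * conjc (g x)).
  by apply: cmeasurableM => //; exact: cmeasurable_conj.
have i1 : mu.-integrable setT (fun x => (nsq (f x))%:E).
  by apply: ge0_integrable => //; [exact: measurable_nsq|move=> x; exact: nsq_ge0].
have i2 : mu.-integrable setT (fun x => (nsq (g x))%:E).
  by apply: ge0_integrable => //; [exact: measurable_nsq|move=> x; exact: nsq_ge0].
apply: (cintegrable_dom mm (integrableD measurableT i1 i2)) => x.
rewrite normcM (normcE (conjc _)) nsq_conj -normcE -!normc_sqr.
have := sqr_ge0 (normc (f x) - normc (g x)); have := normc_ge0 (f x); have := normc_ge0 (g x); nra.
Qed.

Lemma energyB f g : cmeasurable f -> cmeasurable g ->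
  (energy mu f < +oo)%E -> (energy mu g < +oo)%E ->
  energy mu (fun x => f x - g x) =
  (fine (energy mu f) + fine (energy mu g) -
   2 * complex.Re (cintegral mu (fun x => f x * conjc (g x))))%:E.
Proof.
move=> mf mg foo goo.
have i1 : mu.-integrable setT (fun x => (nsq (f x))%:E).
  by apply: ge0_integrable => //; [exact: measurable_nsq|move=> x; exact: nsq_ge0].
have i2 : mu.-integrable setT (fun x => (nsq (g x))%:E).
  by apply: ge0_integrable => //; [exact: measurable_nsq|move=> x; exact: nsq_ge0].
have [i3 _] := integrable_Re_mul mf mg foo goo.
have i4 := integrable_scale 2 i3.
have i12 := integrableD measurableT i1 i2.
have i124 := integrableB measurableT i12 i4.
have -> : energy mu (fun x => f x - g x) = (\int[mu]_x (nsq (f x) + nsq (g x) - 2 * complex.Re (f x * conjc (g x)))%:E)%E.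
  by apply: eq_integral => x _; rewrite nsqB.
rewrite -[LHS]fineK; last exact: (integrable_fin_num measurableT i124).
congr EFin; rewrite -/(Rintegral _ _ _) RintegralB// RintegralD// RintegralZl//.
Qed.

End L2_norm.

Section duality.
Context {R : realType} (n : nat).
Local Notation mu := (lebesgue_Rn R n).
Local Notation c := ((2 * pi : R) ^+ n).
Implicit Types (f g G : Rn R n -> R[i]).

Definition inverse_fourier G (x : Rn R n) : R[i] :=
  (c^-1)%:C * cintegral mu (fun xi => G xi * expi (dot x xi)).

Lemma two_pi_gt0 : 0 < c.
Proof. by rewrite exprn_gt0// mulr_gt0// pi_gt0. Qed.

Lemma inverse_fourierE G x : cintegrable mu G ->
  inverse_fourier G x = (c^-1)%:C * conjc (fourier_integral (fun xi => conjc (G xi)) x).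
Proof.
move=> intG; rewrite /inverse_fourier /fourier_integral -cintegral_conj.
  congr (_ * _); apply: eq_cintegral => xi.
  rewrite conjcM expiN !conjcK; congr (_ * expi _).
  by rewrite /dot; apply: eq_bigr => i _; rewrite mulrC.
apply: cintegrable_Rn_twist; last exact: cintegrable_conj.
by apply: measurableT_comp => //; exact: measurable_dot.
Qed.

Lemma cmeasurable_inverse_fourier G : cintegrable mu G -> cmeasurable (inverse_fourier G).
Proof.
move=> intG; rewrite (_ : inverse_fourier G = fun x => (c^-1)%:C *
  conjc (fourier_integral (fun xi => conjc (G xi)) x)); last first.
  by apply/funext => x; rewrite inverse_fourierE.
apply: cmeasurableM; first exact: cmeasurable_cst.
apply: cmeasurable_conj; apply: cmeasurable_fourier; apply: cmeasurable_conj.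
exact: cintegrable_cmeasurable intG.
Qed.

Lemma energy_inverse_fourier G : cintegrable mu G -> (energy mu G < +oo)%E ->
  energy mu (inverse_fourier G) = ((c^-1)%:E * energy mu G)%E.
Proof.
move=> intG Goo.
rewrite (_ : inverse_fourier G = fun x => (c^-1)%:C *
  conjc (fourier_integral (fun xi => conjc (G xi)) x)); last first.
  by apply/funext => x; rewrite inverse_fourierE.
have mF : cmeasurable (fourier_integral (fun xi => conjc (G xi))).
  by apply: cmeasurable_fourier; apply: cmeasurable_conj; exact: cintegrable_cmeasurable intG.
rewrite energyZ; last exact: cmeasurable_conj.
rewrite energy_conj plancherel; [|exact: cintegrable_conj|by rewrite energy_conj].
rewrite energy_conj muleA -EFinM nsq_real; congr (_%:E * _)%E.
by field; rewrite gt_eqF// two_pi_gt0.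
Qed.

Lemma fourier_adjoint f G : cintegrable mu f -> cintegrable mu G ->
  cintegral mu (fun x => inverse_fourier G x * conjc (f x)) =
  (c^-1)%:C * cintegral mu (fun xi => G xi * conjc (fourier_integral f xi)).
Proof.
move=> intf intG.
pose F (z : Rn R n * Rn R n) : R[i] := G z.2 * expi (dot z.1 z.2) * conjc (f z.1).
have intF : cintegrable (mu \x mu)%E F.
  have i0 := cintegrable_prod (cintegrable_conj intf) intG.
  rewrite (_ : F = fun z : Rn R n * Rn R n => (conjc (f z.1) * G z.2) * expi (dot z.1 z.2)); last first.
    by apply/funext => z; rewrite /F; ring.
  apply: cintegrableM_unit => //; last by move=> z; exact: nsq_expi.
  by apply: cmeasurable_expi; apply: measurable_dot; [exact: measurable_fst|exact: measurable_snd].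
have inner1 x : cintegrable mu (fun xi => G xi * expi (dot x xi)).
  by apply: cintegrable_Rn_twist => //; exact: measurable_dot.
have inner2 xi : cintegrable mu (fun x => f x * expi (- dot x xi)).
  apply: cintegrable_Rn_twist => //; apply: measurableT_comp => //; exact: measurable_dot.
transitivity ((c^-1)%:C * cintegral mu (fun x => cintegral mu (fun xi => F (x, xi)))).
  rewrite -cintegralZ; last exact: cintegrable_cintegral2 intF.
  by apply: eq_cintegral => x; rewrite /F /= cintegralZr// /inverse_fourier mulrA.
congr (_ * _); rewrite (cfubini2 intF) -(cfubini1 intF); apply: eq_cintegral => xi.
rewrite /F /fourier_integral -cintegral_conj// -cintegralZ; last exact: cintegrable_conj.
by apply: eq_cintegral => x /=; rewrite conjcM expiN conjcK; ring.
Qed.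

Lemma energy_fourier_sub f G : cintegrable mu f -> (energy mu f < +oo)%E ->
  cintegrable mu G -> (energy mu G < +oo)%E ->
  energy mu (fun x => inverse_fourier G x - f x) =
  ((c^-1)%:E * energy mu (fun xi => (G xi - fourier_integral f xi)%R))%E.
Proof.
move=> intf foo intG Goo.
have c0 := two_pi_gt0.
have mf := cintegrable_cmeasurable intf; have mG := cintegrable_cmeasurable intG.
have EG := energy_inverse_fourier intG Goo; have Ef := plancherel intf foo.
have mI := cmeasurable_inverse_fourier intG; have mF := cmeasurable_fourier mf.
have Ioo : (energy mu (inverse_fourier G) < +oo)%E.
  by rewrite EG lte_mul_pinfty// lee_fin invr_ge0 ltW.
have Foo : (energy mu (fourier_integral f) < +oo)%E.
  by rewrite Ef lte_mul_pinfty// lee_fin ltW.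
rewrite energyB// energyB// fourier_adjoint// EG Ef -EFinM; congr EFin.
have [a a0 aE] := ge0_lty_EFin (energy_ge0 mu f) foo.
have [b b0 bE] := ge0_lty_EFin (energy_ge0 mu G) Goo.
rewrite aE bE -!EFinM /= mul0r subr0.
by field; rewrite gt_eqF.
Qed.

End duality.

Lemma ereal_le_limit (R : realType) (x y : \bar R) (u : nat -> \bar R) :
  (forall k, (x <= u k + y)%E) -> u k @[k --> \oo] --> 0%E -> (x <= y)%E.
Proof.
move=> xy u0; apply/lee_addgt0Pr => e e0.
have /fine_cvgP[fin cu] := u0.
have /cvgrPdist_lt /(_ e e0) near_e := cu.
near \oo => k.
apply: (le_trans (xy k)); rewrite addeC leeD2l//.
have fk : u k \is a fin_num by near: k.
rewrite -(fineK fk) lee_fin ltW//.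
have : `|0 - fine (u k)| < e by near: k.
by rewrite sub0r normrN; apply: le_lt_trans; exact: ler_norm.
Unshelve. all: end_near. Qed.

Lemma cvge_add_scale0 (R : realType) (a b : R) (u v : nat -> \bar R) :
  u k @[k --> \oo] --> 0%E -> v k @[k --> \oo] --> 0%E ->
  (a%:E * u k + b%:E * v k)%E @[k --> \oo] --> 0%E.
Proof.
move=> u0 v0; rewrite -[X in _ --> X]adde0; apply: cvgeD => //.
  by rewrite -(mule0 a%:E); apply: cvgeZl.
by rewrite -(mule0 b%:E); apply: cvgeZl.
Qed.

Section is_fourier.
Context {R : realType} (n : nat).
Local Notation mu := (lebesgue_Rn R n).
Local Notation c := ((2 * pi : R) ^+ n).
Local Notation N2 := (cLnorm mu 2).
Implicit Types (f g G : Rn R n -> R[i]).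

Lemma cLnorm2_scale f g (a : R) : 0 <= a ->
  energy mu f = (a%:E * energy mu g)%E -> N2 f = ((Num.sqrt a)%:E * N2 g)%E.
Proof.
move=> a0 E; rewrite !cLnorm2E E poweRM ?lee_fin ?energy_ge0//.
by rewrite poweR_EFin powR12_sqrt.
Qed.

Lemma fourier_integralB f g xi : cintegrable mu f -> cintegrable mu g ->
  fourier_integral (fun x => f x - g x) xi = fourier_integral f xi - fourier_integral g xi.
Proof.
move=> intf intg; have tw h : cintegrable mu h -> cintegrable mu (fun x => h x * expi (- dot x xi)).
  move=> inth; apply: cintegrable_Rn_twist => //; apply: measurableT_comp => //; exact: measurable_dot.
rewrite /fourier_integral -cintegralB; [|exact: tw|exact: tw].
by apply: eq_cintegral => x; rewrite mulrBl.
Qed.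

Lemma cLnorm2_fourier f : cintegrable mu f -> (energy mu f < +oo)%E ->
  N2 (fourier_integral f) = ((Num.sqrt c)%:E * N2 f)%E.
Proof.
move=> intf foo; apply: cLnorm2_scale; first by rewrite ltW// two_pi_gt0.
exact: plancherel.
Qed.

Lemma cLnorm2_fourier_sub f G : cintegrable mu f -> (energy mu f < +oo)%E ->
  cintegrable mu G -> (energy mu G < +oo)%E ->
  N2 (fun x => inverse_fourier G x - f x) =
  ((Num.sqrt c^-1)%:E * N2 (fun xi => (G xi - fourier_integral f xi)%R))%E.
Proof.
move=> intf foo intG Goo; apply: cLnorm2_scale; first by rewrite invr_ge0 ltW// two_pi_gt0.
exact: energy_fourier_sub.
Qed.

Lemma is_fourier_le f g : is_fourier f g -> (N2 g <= (Num.sqrt c)%:E * N2 f)%E.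
Proof.
move=> [Lf Lg [f_ [Lf_ cf cg]]].
apply: (@ereal_le_limit _ _ _ (fun k => 1%:E * N2 (fun xi => (fourier_integral (f_ k) xi - g xi)%R) +
    (Num.sqrt c)%:E * N2 (fun x => (f_ k x - f x)%R))%E); last exact: cvge_add_scale0.
move=> k; have [/cLp1P int_ /cLp2P[m_ oo_]] := Lf_ k.
have mF := cmeasurable_fourier m_.
rewrite mul1e -addeA -ge0_muleDr ?cLnorm2_ge0//.
have -> : N2 g = N2 (fun xi => (g xi - fourier_integral (f_ k) xi) + fourier_integral (f_ k) xi).
  by congr (cLnorm _ _ _); apply/funext => xi; rewrite subrK.
apply: (le_trans (cLnorm2D _ _ _)) => //; first by apply: cmeasurableB => //; case: Lg.
rewrite cLnorm2_subC leeD2l// cLnorm2_fourier// lee_wpmul2l ?lee_fin ?sqrtr_ge0//.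
have -> : N2 (f_ k) = N2 (fun x => (f_ k x - f x) + f x).
  by congr (cLnorm _ _ _); apply/funext => x; rewrite subrK.
by apply: cLnorm2D; [apply: cmeasurableB => //; case: Lf|case: Lf].
Qed.

Lemma is_fourier_inverse_le f g G : is_fourier f g ->
  cintegrable mu G -> (energy mu G < +oo)%E ->
  (N2 (fun x => (inverse_fourier G x - f x)%R) <= (Num.sqrt c^-1)%:E * N2 (fun xi => (G xi - g xi)%R))%E.
Proof.
move=> [Lf Lg [f_ [Lf_ cf cg]]] intG Goo.
apply: (@ereal_le_limit _ _ _ (fun k => (Num.sqrt c^-1)%:E * N2 (fun xi => (fourier_integral (f_ k) xi - g xi)%R) +
    1%:E * N2 (fun x => (f_ k x - f x)%R))%E); last exact: cvge_add_scale0.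
move=> k; have [/cLp1P int_ /cLp2P[m_ oo_]] := Lf_ k.
have mF := cmeasurable_fourier m_; have mG := cintegrable_cmeasurable intG.
have mI := cmeasurable_inverse_fourier intG.
have [mf _] := Lf; have [mg _] := Lg.
apply: (le_trans (cLnorm2_triangle mu mI m_ mf)).
rewrite mul1e addeAC leeD2r// cLnorm2_fourier_sub// -ge0_muleDr ?cLnorm2_ge0//.
rewrite lee_wpmul2l ?lee_fin ?sqrtr_ge0// addeC.
rewrite [X in (_ <= _ + X)%E]cLnorm2_subC.
exact: cLnorm2_triangle.
Qed.

Lemma is_fourier_unique f g : cintegrable mu f -> is_fourier f g ->
  energy mu (fun xi => (g xi - fourier_integral f xi)%R) = 0%E.
Proof.
move=> intf [Lf Lg [f_ [Lf_ cf cg]]]; have [mf foo] := (cLp2P _ _).1 Lf; have [mg _] := Lg.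
have mFf := cmeasurable_fourier mf.
suff : (N2 (fun xi => (g xi - fourier_integral f xi)%R) <= 0)%E.
  move=> le; rewrite -sqr_cLnorm2; have -> : N2 (fun xi => g xi - fourier_integral f xi) = 0%E.
    by apply/eqP; rewrite eq_le le cLnorm2_ge0.
  by rewrite mule0.
apply: (@ereal_le_limit _ _ _ (fun k => 1%:E * N2 (fun xi => (fourier_integral (f_ k) xi - g xi)%R) +
    (Num.sqrt c)%:E * N2 (fun x => (f_ k x - f x)%R))%E); last exact: cvge_add_scale0.
move=> k; have [/cLp1P int_ /cLp2P[m_ oo_]] := Lf_ k.
have mF := cmeasurable_fourier m_.
rewrite adde0 mul1e -cLnorm2_fourier; last 2 first.
  exact: cintegrableB.
  rewrite (_ : (fun x => f_ k x - f x) = (fun x => f_ k x + (-1) * f x)); last first.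
    by apply/funext => x; rewrite mulN1r.
  apply: energyD_lty => //; last exact: energyZ_lty.
  by apply: cmeasurableM => //; exact: cmeasurable_cst.
apply: (le_trans (cLnorm2_triangle mu mg mF mFf)).
rewrite cLnorm2_subC leeD2l//; apply: le_of_eq.
by congr (cLnorm _ _ _); apply/funext => xi; rewrite fourier_integralB.
Qed.

Lemma energy0 : energy mu (fun=> 0) = 0%E.
Proof. by rewrite /energy; under eq_integral do rewrite nsq_real expr0n; rewrite integral0. Qed.

Lemma is_fourier_of_energy0 f g : cintegrable mu f -> (energy mu f < +oo)%E ->
  cLp mu 2 g -> energy mu (fun xi => (fourier_integral f xi - g xi)%R) = 0%E ->
  is_fourier f g.
Proof.
move=> intf foo Lg E; have mf := cintegrable_cmeasurable intf.
split => //; first exact/cLp2P.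
exists (fun=> f); split.
- by move=> _; split; [exact/cLp1P|exact/cLp2P].
- rewrite (_ : (fun x => f x - f x) = fun=> 0); last by apply/funext => x; rewrite subrr.
  by rewrite cLnorm2E energy0 poweR0r ?invr_eq0//; exact: cvg_cst.
- by rewrite cLnorm2E E poweR0r ?invr_eq0//; exact: cvg_cst.
Qed.

Lemma is_fourier_integral f : cintegrable mu f -> (energy mu f < +oo)%E ->
  is_fourier f (fourier_integral f).
Proof.
move=> intf foo; have mf := cintegrable_cmeasurable intf.
apply: is_fourier_of_energy0 => //.
  apply/cLp2P; split; first exact: cmeasurable_fourier.
  by rewrite plancherel// lte_mul_pinfty// lee_fin ltW// two_pi_gt0.
rewrite -[RHS]energy0; congr energy; apply/funext => xi; exact: subrr.
Qed.

Lemma is_fourier_inverse G : cintegrable mu G -> (energy mu G < +oo)%E ->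
  cintegrable mu (inverse_fourier G) -> is_fourier (inverse_fourier G) G.
Proof.
move=> intG Goo intI; have mG := cintegrable_cmeasurable intG.
have c0 := two_pi_gt0 (R := R) n.
have Ioo : (energy mu (inverse_fourier G) < +oo)%E.
  by rewrite energy_inverse_fourier// lte_mul_pinfty// lee_fin invr_ge0 ltW.
apply: is_fourier_of_energy0 => //; first exact/cLp2P.
have := energy_fourier_sub intI Ioo intG Goo.
rewrite (_ : (fun x => _ - _) = fun=> 0); last by apply/funext => x; rewrite subrr.
rewrite energy0 => /esym/eqP; rewrite mule_eq0 eqe gt_eqF ?invr_gt0//= => /eqP <-.
by rewrite -energyN; congr energy; apply/funext => xi; rewrite opprB.
Qed.

End is_fourier.

(** * Convolutions of the paraboloid *)

Section polar_coordinates.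
Context {R : realType}.
Local Notation leb := (@lebesgue_measure R).
Variable g : R -> R.
Hypothesis cg : continuous g.
Hypothesis g0 : forall r, 0 <= g r.

Let mg : measurable_fun setT g. Proof. exact: continuous_measurable_fun. Qed.

Lemma radial_integral_le (k : R) : 0 < k ->
  (\int[leb]_a (g (a ^+ 2 * k) * `|a|)%:E <= (k^-1)%:E * \int[leb]_r (g r)%:E)%E.
Proof.
move=> k0.
have E (u v : R) : u *: (v : R^o) = u * v by [].
pose F (a : R) : R := a ^+ 2 * k.
have dF (x : R) : is_derive x (1 : R) F (2 * k * x).
  by rewrite /F; apply: is_derive_eq; rewrite !E; ring.
have F'E : (derive1 F) = (fun x => 2 * k * x).
  by apply/funext => x; rewrite derive1E derive_val.
have cF' : continuous (derive1 F).
  by rewrite F'E => x; apply: cvgM; [exact: cvg_cst|exact: cvg_id].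
have cF : continuous F.
  by move=> x; apply: cvgM; [exact: exprn_continuous|exact: cvg_cst].
have cgF : continuous (fun a : R => g (F a)).
  by move=> x; apply: (@continuous_comp _ _ _ F g); [exact: cF|exact: cg].
rewrite (ge0_symfun_integralT (f := fun a => g (a ^+ 2 * k) * `|a|)); last 3 first.
- by move=> x; rewrite mulr_ge0.
- by move=> x; apply: cvgM; [exact: cgF|exact: norm_continuous].
- by move=> x /=; rewrite sqrrN normrN.
rewrite -set_itvcy.
have -> : (\int[leb]_(x in `[0%R, +oo[) (g (x ^+ 2 * k) * `|x|)%:E =
    (2 * k)^-1%:E * \int[leb]_(x in `[0%R, +oo[) (g (F x) * (2 * k * `|x|))%:E)%E.
  rewrite -ge0_integralZl//; last 3 first.
  - apply/measurable_EFinP; apply: measurable_funTS; apply: measurable_funM.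
      exact: continuous_measurable_fun.
    by apply: measurable_funM => //; exact: normr_measurable.
  - by move=> x _; rewrite lee_fin !mulr_ge0// ltW.
  - by rewrite lee_fin invr_ge0 mulr_ge0// ltW.
  apply: eq_integral => x _; rewrite -EFinM; congr EFin.
  by rewrite /F; field; rewrite gt_eqF.
rewrite muleA -EFinM (_ : 2 * (2 * k)^-1 = k^-1); last by field; rewrite gt_eqF.
rewrite lee_wpmul2l ?lee_fin ?invr_ge0 ?(ltW k0)//.
have h0 x : 0 <= g (F x) * (2 * k * `|x|) by rewrite !mulr_ge0// ltW.
have mh : measurable_fun setT (fun x : R => g (F x) * (2 * k * `|x|)).
  apply: measurable_funM; first exact: continuous_measurable_fun.
  by apply: measurable_funM => //; exact: normr_measurable.
have cvgI := @ge0_cvgn_integral R leb _ h0 mh.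
rewrite -(cvg_lim _ cvgI)//; apply: lime_le; first by apply/cvg_ex; eexists; exact: cvgI.
apply: nearW => N.
have -> : (\int[leb]_(x in `[0%R, N%:R]) (g (F x) * (2 * k * `|x|))%:E =
    \int[leb]_(x in `[0%R, N%:R]) (((g \o F) * (derive1 F))%R x)%:E)%E.
  apply: eq_integral => x; rewrite inE /= in_itv /= => /andP[x0 _].
  by rewrite F'E /= ger0_norm.
rewrite -integration_by_substitution_increasing//.
- apply: ge0_subset_integral => //.
  + exact/measurable_EFinP.
  + by move=> x _; rewrite lee_fin.
- move=> x y; rewrite !in_itv /= => /andP[x0 _] /andP[y0 _] xy.
  by rewrite /F ltr_pM2r// ltrXn2r.
- by apply/cvg_ex; exists ((derive1 F) 0); apply: cvg_at_right_filter; exact: cF'.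
- by apply/cvg_ex; exists ((derive1 F) N%:R); apply: cvg_at_left_filter; exact: cF'.
- split.
  + by move=> x _; case: (dF x).
  + by apply: cvg_at_right_filter; exact: cF.
  + by apply: cvg_at_left_filter; exact: cF.
- exact: continuous_subspaceT.
Qed.

Lemma planar_integral_le :
  (\int[leb]_a \int[leb]_b (g (a ^+ 2 + b ^+ 2))%:E <= pi%:E * \int[leb]_r (g r)%:E)%E.
Proof.
pose h (z : plane R) : R := g (z.1 ^+ 2 * (1 + z.2 ^+ 2)) * `|z.1|.
have mh : measurable_fun setT h.
  have m1 : measurable_fun setT (fun z : plane R => z.1) by exact: measurable_fst.
  have m2 : measurable_fun setT (fun z : plane R => z.2) by exact: measurable_snd.
  apply: measurable_funM; last by apply: (measurableT_comp (@normr_measurable R setT)).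
  apply: (measurableT_comp mg); apply: measurable_funM; first exact: measurable_funX.
  by apply: measurable_funD => //; exact: measurable_funX.
have h0 z : (0 <= (h z)%:E)%E by rewrite lee_fin mulr_ge0.
have mhE : measurable_fun setT (EFin \o h) by exact/measurable_EFinP.
have -> : (\int[leb]_a \int[leb]_b (g (a ^+ 2 + b ^+ 2))%:E = \int[leb]_a \int[leb]_s (h (a, s))%:E)%E.
  apply: ae_eq_integral => //.
  - apply: (@measurable_fun_fubini_tonelli_F _ _ (measurableTypeR R) (measurableTypeR R) R leb (fun z => (g (z.1 ^+ 2 + z.2 ^+ 2))%:E)).
      apply/measurable_EFinP; apply: (measurableT_comp mg); apply: measurable_funD; apply: measurable_funX.
        exact: measurable_fst.
      exact: measurable_snd.
    by move=> z; rewrite lee_fin.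
  - exact: (measurable_fun_fubini_tonelli_F _ mhE h0).
  - exists [set 0]; split => //=; first exact: lebesgue_measure_set1.
    move=> a; apply: contra_notP => a0 _.
    have na : 0 < `|a| by rewrite normr_gt0; apply/eqP.
    have mf : measurable_fun setT (fun b : R => (g (a ^+ 2 + b ^+ 2))%:E).
      by apply/measurable_EFinP; apply: (measurableT_comp mg); exact: measurable_funD.
    have := ge0_integral_affine 0 na mf (fun b => g0 _).
    move=> /(congr1 (fun x => (`|a|%:E * x)%E)); rewrite muleA -EFinM divff ?gt_eqF// mul1e => <-.
    rewrite -ge0_integralZl//; last 2 first.
      apply/measurable_EFinP; apply: (measurableT_comp mg); apply: measurable_funD => //.
      by apply: measurable_funX; apply: measurable_funD => //; exact: measurable_funM.
      by move=> x _; rewrite lee_fin.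
    apply: eq_integral => s _; rewrite -EFinM /h /= mulrC; congr (g _ * _)%:E.
    by rewrite addr0 exprMn real_normK ?num_real//; ring.
rewrite (fubini_tonelli (fun z => (h z)%:E))//.
apply: (@le_trans _ _ (\int[leb]_s ((\int[leb]_r (g r)%:E) * ((1 + s ^+ 2)^-1)%:E))%E).
  apply: ge0_le_integral => //.
  - by move=> s _; exact: integral_ge0.
  - exact: (measurable_fun_fubini_tonelli_G _ mhE h0).
  - apply: emeasurable_funM => //; apply/measurable_EFinP.
    by apply: continuous_measurable_fun; exact: continuous_oneDsqrV.
  - move=> s _; rewrite /fubini_G /h /= muleC; apply: radial_integral_le.
    by rewrite ltr_wpDr ?sqr_ge0.
rewrite ge0_integralZl//.
- by rewrite integral_inv1D muleC.
- by apply/measurable_EFinP; apply: continuous_measurable_fun; exact: continuous_oneDsqrV.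
- by move=> s _; rewrite lee_fin invr_ge0 ltW// ltr_wpDr ?sqr_ge0.
- by apply: integral_ge0 => r _; rewrite lee_fin.
Qed.

End polar_coordinates.

Section planar_quadratic.
Context {R : realType}.
Local Notation leb := (@lebesgue_measure R).
Variable g : R -> R.
Hypothesis cg : continuous g.
Hypothesis g0 : forall r, 0 <= g r.

Let mg : measurable_fun setT g. Proof. exact: continuous_measurable_fun. Qed.

(* The shift [q x] is whatever completing the square in [y] produces. *)
Lemma planar_quadratic_le (A B p T : R) (q : R -> R) : 0 < A -> 0 < B ->
  (\int[leb]_x \int[leb]_y (g (T + A * (x - p) ^+ 2 + B * (y - q x) ^+ 2))%:E <=
   (pi / (Num.sqrt A * Num.sqrt B))%:E * \int[leb]_r (g r)%:E)%E.
Proof.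
move=> A0 B0; have sA : 0 < Num.sqrt A by rewrite sqrtr_gt0.
have sB : 0 < Num.sqrt B by rewrite sqrtr_gt0.
have sA2 : Num.sqrt A ^+ 2 = A by rewrite sqr_sqrtr// ltW.
have sB2 : Num.sqrt B ^+ 2 = B by rewrite sqr_sqrtr// ltW.
pose K (a : R) : \bar R := (\int[leb]_b (g (T + (a ^+ 2 + b ^+ 2)))%:E)%E.
have K0 a : (0 <= K a)%E by apply: integral_ge0 => b _; rewrite lee_fin.
have mK : measurable_fun setT K.
  apply: (@measurable_fun_fubini_tonelli_F _ _ (measurableTypeR R) (measurableTypeR R) R leb (fun z => (g (T + (z.1 ^+ 2 + z.2 ^+ 2)))%:E)).
    apply/measurable_EFinP; apply: (measurableT_comp mg); apply: measurable_funD => //.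
    apply: measurable_funD; apply: measurable_funX; first exact: measurable_fst.
    exact: measurable_snd.
  by move=> z; rewrite lee_fin.
have inner x : (\int[leb]_y (g (T + A * (x - p) ^+ 2 + B * (y - q x) ^+ 2))%:E =
    ((Num.sqrt B)^-1)%:E * K (Num.sqrt A * x + - (Num.sqrt A * p))%R)%E.
  rewrite /K -(ge0_integral_affine (- (Num.sqrt B * q x)) sB); last 2 first.
  - apply/measurable_EFinP; apply: (measurableT_comp mg); apply: measurable_funD => //.
    by apply: measurable_funD => //; exact: measurable_funX.
  - by move=> b; rewrite lee_fin.
  apply: eq_integral => y _; congr (g _)%:E.
  by rewrite -!mulrBr !exprMn sA2 sB2 addrA.
under eq_integral do rewrite inner.
rewrite ge0_integralZl//; last first.
  by apply: (measurableT_comp mK); apply: measurable_funD => //; exact: measurable_funM.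
rewrite (ge0_integral_affine (- (Num.sqrt A * p)) sA mK K0) muleA -EFinM.
have cgT : continuous (fun r => g (r + T)).
  by move=> x; apply: (@continuous_comp _ _ _ (fun r => r + T) g); [apply: cvgD; [exact: cvg_id|exact: cvg_cst]|exact: cg].
have KE : (\int[leb]_a K a <= pi%:E * \int[leb]_r (g r)%:E)%E.
  have := planar_integral_le cgT (fun r => g0 _).
  have -> : (\int[leb]_r (g (r + T))%:E = \int[leb]_r (g r)%:E)%E.
    transitivity (\int[leb]_r (g (1 * r + T))%:E)%E.
      by apply: eq_integral => r _; rewrite mul1r.
    rewrite (ge0_integral_affine T ltr01 (f := fun r => (g r)%:E)).
    - by rewrite invr1 mul1e.
    - exact/measurable_EFinP.
    - by move=> r; rewrite lee_fin.
  apply: le_trans; apply: le_of_eq.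
  by apply: eq_integral => a _; apply: eq_integral => b _; rewrite addrC.
rewrite (_ : pi / _ = (Num.sqrt B)^-1 / Num.sqrt A * pi); last by field; rewrite !gt_eqF.
rewrite [in leRHS]EFinM -muleA lee_wpmul2l// lee_fin divr_ge0 ?invr_ge0 ?ltW//.
Qed.

End planar_quadratic.

Section gauss_kernels.
Context {R : realType}.
Local Notation leb := (@lebesgue_measure R).
Local Notation mu n := (lebesgue_Rn R n).

Definition gauss1 (e r : R) : R := Num.sqrt (pi / e) * expR (- (r ^+ 2 / (4 * e))).

Lemma gauss1_ge0 e r : 0 <= gauss1 e r.
Proof. by rewrite mulr_ge0 ?sqrtr_ge0 ?expR_ge0. Qed.

Lemma gauss1N e r : gauss1 e (- r) = gauss1 e r.
Proof. by rewrite /gauss1 sqrrN. Qed.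

Lemma continuous_gauss1 e : continuous (gauss1 e).
Proof.
move=> r; apply: cvgM; first exact: cvg_cst.
apply: (@continuous_comp _ _ _ (fun r : R => - (r ^+ 2 / (4 * e))) expR); last exact: continuous_expR.
by apply: cvgN; apply: cvgM; [exact: exprn_continuous|exact: cvg_cst].
Qed.

Lemma measurable_gauss1 e : measurable_fun setT (gauss1 e).
Proof. by apply: continuous_measurable_fun; exact: continuous_gauss1. Qed.

Lemma integral_gauss1 e : 0 < e -> (\int[leb]_r (gauss1 e r)%:E)%E = (2 * pi)%:E.
Proof.
move=> e0; rewrite -(integral_line_kernel 0 e0); apply: eq_integral => r _.
by rewrite /line_kernel /= subr0.
Qed.

Lemma integral_gauss1_sub e z : 0 < e -> (\int[leb]_r (gauss1 e (z - r))%:E)%E = (2 * pi)%:E.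
Proof.
move=> e0; rewrite -(integral_line_kernel z e0); apply: eq_integral => r _.
by rewrite /line_kernel /gauss1 /= -sqrrN opprB.
Qed.

Section swap.
Context d (S : measurableType d) (m : {sigma_finite_measure set S -> \bar R}).

Lemma swap_pair (F : plane R * S -> \bar R) :
  measurable_fun setT F -> (forall z, 0 <= F z)%E ->
  (\int[leb]_x \int[leb]_y \int[m]_s F ((x, y), s) =
   \int[m]_s \int[leb]_x \int[leb]_y F ((x, y), s))%E.
Proof.
move=> mF F0; pose ll := sigma_finite_prod leb leb.
transitivity (\int[ll]_z \int[m]_s F (z, s))%E.
  rewrite (@fubini_tonelli1 _ _ _ _ _ leb leb (fun z => \int[m]_s F (z, s))%E)//.
    exact: (measurable_fun_fubini_tonelli_F _ mF F0).
  by move=> z; exact: integral_ge0.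
rewrite (@fubini_tonelli _ _ _ _ _ ll m F)//; apply: eq_integral => s _.
rewrite (@fubini_tonelli1 _ _ _ _ _ leb leb (fun z => F (z, s)))//.
exact: (measurableT_comp mF (measurable_pair2 s)).
Qed.

End swap.

Lemma ge0_integral_shift (f : R -> \bar R) (b : R) : measurable_fun setT f ->
  (forall x, 0 <= f x)%E -> (\int[leb]_x f (x - b)%R = \int[leb]_x f x)%E.
Proof.
move=> mf f0; have := ge0_integral_affine (- b) ltr01 mf f0.
by rewrite invr1 mul1e => <-; apply: eq_integral => x _; rewrite mul1r.
Qed.

(* Substitute [s = x + y + z] for [z] and complete the square. *)
Lemma parabola_convolution_le e (T Z : R) : 0 < e ->
  (\int[leb]_x \int[leb]_y \int[leb]_z
     (gauss1 e (T - (x ^+ 2 + (y ^+ 2 + z ^+ 2))) * gauss1 e (Z - (x + (y + z))))%:E <=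
   ((2 * pi) ^+ 2 * (pi / Num.sqrt 3))%:E)%E.
Proof.
move=> e0; have g0 := gauss1_ge0 e; have mg := measurable_gauss1 e.
pose F (w : plane R * measurableTypeR R) : R :=
  gauss1 e (T - (w.1.1 ^+ 2 + (w.1.2 ^+ 2 + (w.2 - (w.1.1 + w.1.2)) ^+ 2))) * gauss1 e (Z - w.2).
have F0 w : (0 <= (F w)%:E)%E by rewrite lee_fin mulr_ge0.
have m2 : measurable_fun setT (fun w : plane R * measurableTypeR R => w.2) by exact: measurable_snd.
have m11 : measurable_fun setT (fun w : plane R * measurableTypeR R => w.1.1).
  exact: (measurableT_comp measurable_fst measurable_fst).
have m12 : measurable_fun setT (fun w : plane R * measurableTypeR R => w.1.2).
  exact: (measurableT_comp measurable_snd measurable_fst).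
have mF : measurable_fun setT (fun w => (F w)%:E).
  apply/measurable_EFinP; apply: measurable_funM; apply: (measurableT_comp mg); apply: measurable_funB => //.
  apply: measurable_funD; first exact: measurable_funX.
  apply: measurable_funD; first exact: measurable_funX.
  by apply: measurable_funX; apply: measurable_funB => //; exact: measurable_funD.
have -> : (\int[leb]_x \int[leb]_y \int[leb]_z
     (gauss1 e (T - (x ^+ 2 + (y ^+ 2 + z ^+ 2))) * gauss1 e (Z - (x + (y + z))))%:E =
    \int[leb]_x \int[leb]_y \int[leb]_s (F ((x, y), s))%:E)%E.
  apply: eq_integral => x _; apply: eq_integral => y _.
  rewrite -(ge0_integral_shift (x + y)); last 2 first.
  - apply/measurable_EFinP; apply: measurable_funM; apply: (measurableT_comp mg); apply: measurable_funB => //.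
      by do 2! apply: measurable_funD => //; exact: measurable_funX.
    by do 2! apply: measurable_funD => //.
  - by move=> z; rewrite lee_fin mulr_ge0.
  apply: eq_integral => s _; rewrite /F /=; congr (gauss1 _ _ * gauss1 _ _)%:E; ring.
rewrite (swap_pair leb mF F0).
apply: (@le_trans _ _ (\int[leb]_s ((2 * pi * (pi / Num.sqrt 3))%:E * (gauss1 e (Z - s))%:E))%E).
  apply: ge0_le_integral => //.
  - by move=> s _; apply: integral_ge0 => x _; apply: integral_ge0.
  - have := @measurable_fun_fubini_tonelli_G _ _ _ _ _ (sigma_finite_prod leb leb) _ mF F0.
    apply: eq_measurable_fun => s _; rewrite /fubini_G.
    rewrite (@fubini_tonelli1 _ _ _ _ _ leb leb (fun z => (F (z, s))%:E))//.
    exact: (measurableT_comp mF (measurable_pair2 s)).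
  - apply: measurable_funeM; apply/measurable_EFinP; apply: (measurableT_comp mg).
    exact: measurable_funB.
  - move=> s _.
    pose g r := gauss1 e (Z - s) * gauss1 e r.
    have cg : continuous g by move=> r; apply: cvgM; [exact: cvg_cst|exact: continuous_gauss1].
    have gg0 r : 0 <= g r by rewrite mulr_ge0.
    have h1 : (0 : R) < 3 / 2 by rewrite divr_gt0.
    have h2 : (0 : R) < 2 by [].
    have := planar_quadratic_le cg gg0 (s / 3) (- T + s ^+ 2 / 3) (fun x => (s - x) / 2) h1 h2.
    rewrite -sqrtrM ?(ltW h1)// (_ : 3 / 2 * 2 = 3); last by field.
    have -> : (\int[leb]_r (g r)%:E = (gauss1 e (Z - s))%:E * (2 * pi)%:E)%E.
      rewrite -(integral_gauss1 e0) -ge0_integralZl//.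
      - exact/measurable_EFinP.
      - by move=> r _; rewrite lee_fin.
      - by rewrite lee_fin.
    rewrite [X in (_ <= X)%E -> _](_ : _ = (2 * pi * (pi / Num.sqrt 3))%:E * (gauss1 e (Z - s))%:E)%E; last first.
      by rewrite -!EFinM; congr EFin; ring.
    apply: le_trans; apply: le_of_eq.
    apply: eq_integral => x _; apply: eq_integral => y _; rewrite /F /g /= mulrC; congr (_ * _)%:E.
    by rewrite -gauss1N; congr gauss1; field.
rewrite ge0_integralZl//; last 3 first.
- by apply/measurable_EFinP; apply: (measurableT_comp mg); exact: measurable_funB.
- by move=> s _; rewrite lee_fin.
- by rewrite lee_fin !mulr_ge0 ?pi_ge0// invr_ge0 sqrtr_ge0.
by rewrite integral_gauss1_sub// -EFinM lee_fin; apply: le_of_eq; ring.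
Qed.

Lemma paraboloid_convolution_le e (T Z1 Z2 : R) : 0 < e ->
  (\int[leb]_x \int[leb]_y \int[leb]_u \int[leb]_v
     (gauss1 e (T - ((x ^+ 2 + y ^+ 2) + (u ^+ 2 + v ^+ 2))) *
      (gauss1 e (Z1 - (x + u)) * gauss1 e (Z2 - (y + v))))%:E <=
   ((2 * pi) ^+ 3 * (pi / 2))%:E)%E.
Proof.
move=> e0; have g0 := gauss1_ge0 e; have mg := measurable_gauss1 e.
pose ll := sigma_finite_prod leb leb.
pose F (w : plane R * plane R) : R :=
  gauss1 e (T - ((w.1.1 ^+ 2 + w.1.2 ^+ 2) + ((w.2.1 - w.1.1) ^+ 2 + (w.2.2 - w.1.2) ^+ 2))) *
  (gauss1 e (Z1 - w.2.1) * gauss1 e (Z2 - w.2.2)).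
have F0 w : (0 <= (F w)%:E)%E by rewrite lee_fin !mulr_ge0.
have mF : measurable_fun setT (fun w => (F w)%:E).
  have m21 : measurable_fun setT (fun w : plane R * plane R => w.2.1).
    exact: (measurableT_comp measurable_fst measurable_snd).
  have m22 : measurable_fun setT (fun w : plane R * plane R => w.2.2).
    exact: (measurableT_comp measurable_snd measurable_snd).
  have m11 : measurable_fun setT (fun w : plane R * plane R => w.1.1).
    exact: (measurableT_comp measurable_fst measurable_fst).
  have m12 : measurable_fun setT (fun w : plane R * plane R => w.1.2).
    exact: (measurableT_comp measurable_snd measurable_fst).
  apply/measurable_EFinP; apply: measurable_funM; last first.
    by apply: measurable_funM; apply: (measurableT_comp mg); exact: measurable_funB.
  apply: (measurableT_comp mg); apply: measurable_funB => //.
  by apply: measurable_funD; apply: measurable_funD; apply: measurable_funX => //; exact: measurable_funB.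
have mFz z : measurable_fun setT (fun w => (F (z, w))%:E).
  exact: (measurableT_comp mF (measurable_pair1 z)).
have -> : (\int[leb]_x \int[leb]_y \int[leb]_u \int[leb]_v
     (gauss1 e (T - ((x ^+ 2 + y ^+ 2) + (u ^+ 2 + v ^+ 2))) *
      (gauss1 e (Z1 - (x + u)) * gauss1 e (Z2 - (y + v))))%:E =
    \int[leb]_x \int[leb]_y \int[ll]_s (F ((x, y), s))%:E)%E.
  apply: eq_integral => x _; apply: eq_integral => y _.
  have EF := @fubini_tonelli1 _ _ _ _ _ leb leb (fun s => (F ((x, y), s))%:E) (mFz (x, y)) (fun w => F0 _).
  transitivity (\int[leb]_u fubini_F leb (fun s => (F ((x, y), s))%:E) u)%E; last exact: esym EF.
  pose f (w : plane R) : R := gauss1 e (T - ((x ^+ 2 + y ^+ 2) + (w.1 ^+ 2 + w.2 ^+ 2))) *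
      (gauss1 e (Z1 - (x + w.1)) * gauss1 e (Z2 - (y + w.2))).
  have f0 w : (0 <= (f w)%:E)%E by rewrite lee_fin !mulr_ge0.
  have mf : measurable_fun setT (fun w => (f w)%:E).
    have m1 : measurable_fun setT (fun w : plane R => w.1) by exact: measurable_fst.
    have m2 : measurable_fun setT (fun w : plane R => w.2) by exact: measurable_snd.
    apply/measurable_EFinP; apply: measurable_funM; last first.
      by apply: measurable_funM; apply: (measurableT_comp mg); apply: measurable_funB => //; exact: measurable_funD.
    apply: (measurableT_comp mg); apply: measurable_funB => //.
    by apply: measurable_funD => //; apply: measurable_funD; exact: measurable_funX.
  rewrite -(ge0_integral_shift x (f := fun u => (\int[leb]_v (f (u, v))%:E)%E)); last 2 first.
  - exact: (measurable_fun_fubini_tonelli_F _ mf f0).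
  - by move=> u; exact: integral_ge0.
  apply: eq_integral => u _; rewrite /fubini_F -(ge0_integral_shift y (f := fun v => (f (u - x, v))%:E)%E); last 2 first.
  - exact: (measurableT_comp mf (measurable_pair1 _)).
  - by move=> v.
  apply: eq_integral => v _; rewrite /F /f /=; congr (_ * (gauss1 _ _ * gauss1 _ _))%:E; ring.
rewrite (swap_pair ll mF F0).
have mgg : measurable_fun setT (fun s : plane R => (gauss1 e (Z1 - s.1) * gauss1 e (Z2 - s.2))%:E).
  apply/measurable_EFinP; apply: measurable_funM; apply: (measurableT_comp mg); apply: measurable_funB => //.
apply: (@le_trans _ _ (\int[ll]_s ((2 * pi * (pi / 2))%:E * (gauss1 e (Z1 - s.1) * gauss1 e (Z2 - s.2))%:E))%E).
  apply: ge0_le_integral => //.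
  - by move=> s _; apply: integral_ge0 => x _; apply: integral_ge0.
  - have := @measurable_fun_fubini_tonelli_G _ _ _ _ _ (sigma_finite_prod leb leb) _ mF F0.
    apply: eq_measurable_fun => s _; rewrite /fubini_G.
    rewrite (@fubini_tonelli1 _ _ _ _ _ leb leb (fun z => (F (z, s))%:E))//.
    exact: (measurableT_comp mF (measurable_pair2 s)).
  - exact: measurable_funeM.
  - move=> [s1 s2] _ /=.
    pose g r := gauss1 e (Z1 - s1) * gauss1 e (Z2 - s2) * gauss1 e r.
    have cg : continuous g by move=> r; apply: cvgM; [exact: cvg_cst|exact: continuous_gauss1].
    have gg0 r : 0 <= g r by rewrite !mulr_ge0.
    have h2 : (0 : R) < 2 by [].
    have := planar_quadratic_le cg gg0 (s1 / 2) (- T + (s1 ^+ 2 + s2 ^+ 2) / 2) (fun x => s2 / 2) h2 h2.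
    rewrite -expr2 sqr_sqrtr//.
    have -> : (\int[leb]_r (g r)%:E = (gauss1 e (Z1 - s1) * gauss1 e (Z2 - s2))%:E * (2 * pi)%:E)%E.
      rewrite -(integral_gauss1 e0) -ge0_integralZl//.
      - exact/measurable_EFinP.
      - by move=> r _; rewrite lee_fin.
      - by rewrite lee_fin mulr_ge0.
    rewrite [X in (_ <= X)%E -> _](_ : _ = (2 * pi * (pi / 2))%:E * (gauss1 e (Z1 - s1) * gauss1 e (Z2 - s2))%:E)%E; last first.
      by rewrite -!EFinM; congr EFin; ring.
    apply: le_trans; apply: le_of_eq.
    apply: eq_integral => x _; apply: eq_integral => y _; rewrite /F /g /= mulrC; congr (_ * _)%:E.
    by rewrite -gauss1N; congr gauss1; field.
rewrite ge0_integralZl//; last 2 first.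
- by move=> s _; rewrite lee_fin mulr_ge0.
- by rewrite lee_fin !mulr_ge0 ?pi_ge0.
rewrite (@fubini_tonelli1 _ _ _ _ _ leb leb (fun s => (gauss1 e (Z1 - s.1) * gauss1 e (Z2 - s.2))%:E))//; last first.
  by move=> s; rewrite lee_fin mulr_ge0.
have mgZ Z : measurable_fun setT (fun s : R => (gauss1 e (Z - s))%:E).
  by apply/measurable_EFinP; apply: (measurableT_comp mg); exact: measurable_funB.
rewrite (_ : (\int[leb]_x _)%E = (\int[leb]_x ((2 * pi)%:E * (gauss1 e (Z1 - x))%:E))%E); last first.
  apply: eq_integral => x _; rewrite /fubini_F /=; under eq_integral do rewrite EFinM.
  rewrite ge0_integralZl//; last 3 first.
    exact: mgZ.
    by move=> r _; rewrite lee_fin.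
    by rewrite lee_fin.
  by rewrite integral_gauss1_sub// muleC.
rewrite ge0_integralZl//; last 3 first.
- exact: mgZ.
- by move=> s _; rewrite lee_fin.
- by rewrite lee_fin !mulr_ge0 ?pi_ge0.
by rewrite integral_gauss1_sub// -!EFinM lee_fin; apply: le_of_eq; ring.
Qed.

End gauss_kernels.

(** * The Strichartz inequality *)

Section space_time_bound.
Context {R : realType} (n : nat) dX (X : measurableType dX).
Local Notation leb := (@lebesgue_measure R).
Variables (mu : {sigma_finite_measure set X -> \bar R})
  (tau : X -> R) (zeta : X -> Rn R n) (G : X -> R[i]) (K : R).
Hypothesis mtau : measurable_fun setT tau.
Hypothesis mzeta : measurable_fun setT zeta.
Hypothesis intG : cintegrable mu G.
Hypothesis K0 : 0 <= K.
Hypothesis convolution_le : forall (e T : R) (Z : Rn R n), 0 < e ->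
  (\int[mu]_x (gauss1 e (T - tau x) *
     \prod_(i < n) gauss1 e (tnth Z i - tnth (zeta x) i))%:E <= K%:E)%E.

Let nu := sigma_finite_prod leb (lebesgue_Rn R n).

Let theta (z : spacetime R n * X) : R :=
  z.1.1 * tau z.2 + dot z.1.2 (zeta z.2).

Let mtheta : measurable_fun setT theta.
Proof.
have m11 : measurable_fun [set: spacetime R n * X] (fun z => z.1.1).
  exact: (measurableT_comp measurable_fst measurable_fst).
have m12 : measurable_fun [set: spacetime R n * X] (fun z => z.1.2).
  exact: (measurableT_comp measurable_snd measurable_fst).
apply: measurable_funD; first apply: measurable_funM => //.
  exact: (measurableT_comp mtau measurable_snd).
by apply: measurable_dot => //; exact: (measurableT_comp mzeta measurable_snd).
Qed.

Let k (e : R) (z : X * X) : R := gauss1 e (tau z.1 - tau z.2) *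
  \prod_(i < n) gauss1 e (tnth (zeta z.1) i - tnth (zeta z.2) i).

Let k0 e z : 0 <= k e z.
Proof. by rewrite mulr_ge0 ?gauss1_ge0// prodr_ge0// => i _; exact: gauss1_ge0. Qed.

Let mk e : measurable_fun setT (k e).
Proof.
apply: measurable_funM.
  apply: (measurableT_comp (measurable_gauss1 e)); apply: measurable_funB.
    exact: (measurableT_comp mtau measurable_fst).
  exact: (measurableT_comp mtau measurable_snd).
apply: measurable_prod => i _.
apply: (measurableT_comp (measurable_gauss1 e)); apply: measurable_funB.
  by apply: (measurableT_comp (measurable_tnth i)); exact: (measurableT_comp mzeta measurable_fst).
by apply: (measurableT_comp (measurable_tnth i)); exact: (measurableT_comp mzeta measurable_snd).
Qed.

Let weight (e : R) (y : spacetime R n) : R :=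
  expR (- (e * y.1 ^+ 2)) * expR (- (e * dot y.2 y.2)).

Let int_weight e : 0 < e -> nu.-integrable setT (fun y => (weight e y)%:E).
Proof.
move=> e0; have [i2 _] := cintegrable_gaussian_Rn n e0.
exact: (integrable_prod (m1 := leb) (m2 := lebesgue_Rn R n) (integrable_expRNsqr e0) i2).
Qed.

Let weight_fourier e x x' : 0 < e ->
  cintegral nu (fun y => (weight e y)%:C * expi (theta (y, x) - theta (y, x'))) = (k e (x, x'))%:C.
Proof.
move=> e0; pose b : Rn R n := [tuple (tnth (zeta x) i - tnth (zeta x') i) | i < n].
have bE y : dot y (zeta x) - dot y (zeta x') = dot b y.
  by rewrite /dot -sumrB; apply: eq_bigr => i _; rewrite tnth_mktuple; ring.
pose F1 (t : measurableTypeR R) : R[i] := (expR (- (e * t ^+ 2)))%:C * expi ((tau x - tau x') * t).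
pose F2 (y : Rn R n) : R[i] := (expR (- (e * dot y y)))%:C * expi (dot b y).
rewrite (@eq_cintegral _ _ _ _ (fun y => F1 y.1 * F2 y.2)); last first.
  move=> [t y]; rewrite /weight /theta /F1 /F2 /= -bE.
  rewrite (_ : _ - _ = (tau x - tau x') * t + (dot y (zeta x) - dot y (zeta x'))); last by ring.
  by rewrite (expiD (_ * t)) [X in X * _ = _]rmorphM /= mulrACA.
rewrite (cintegral_prod (cintegrable_gauss _ e0) (cintegrable_gauss_Rn b e0)).
rewrite gauss_fourier// gauss_fourier_Rn// -rmorphM; congr (_%:C).
rewrite /k /= /gauss1; congr (_ * _).
rewrite big_split /= prodr_const card_ord; congr (_ * _).
rewrite -expR_sum; congr expR; rewrite /dot sumrN mulr_suml; congr (- _).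
by apply: eq_bigr => i _; rewrite tnth_mktuple -expr2.
Qed.

Lemma space_time_bound :
  (\int[leb \x lebesgue_Rn R n]_y
     (nsq (cintegral mu (fun x => G x * expi (y.1 * tau x + dot y.2 (zeta x)))))%:E <=
   K%:E * energy mu G)%E.
Proof.
have mosc := cmeasurable_oscillatory intG mtheta.
apply: (@le_integral_weight _ _ _ nu (fun y => nsq (oscillatory mu G theta y))
  (fun y => y.1 ^+ 2 + dot y.2 y.2)).
- exact: measurable_nsq.
- by move=> y; exact: nsq_ge0.
- apply: measurable_funD; first by apply: measurable_funX; exact: measurable_fst.
  by apply: measurable_dot; exact: measurable_snd.
- move=> y; apply: addr_ge0; first exact: sqr_ge0.
  by apply: sumr_ge0 => i _; rewrite -expr2 sqr_ge0.
- move=> e e0; have := schur_bound (nu := nu) intG mtheta (int_weight e0) _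
    (fun x x' => weight_fourier x x' e0) (@k0 e) (@mk e) K0.
  move=> H; apply: (@le_trans _ _ (\int[nu]_y (weight e y * nsq (oscillatory mu G theta y))%:E)%E).
    apply: le_of_eq; apply: eq_integral => y _.
    by rewrite (mulrDr e) opprD expRD.
  apply: H.
  + by move=> y; rewrite mulr_ge0 ?expR_ge0.
  + by move=> x; exact: (convolution_le (tau x) (zeta x) e0).
  + move=> x; apply: le_trans (convolution_le (tau x) (zeta x) e0).
    apply: le_of_eq; apply: eq_integral => x' _.
    rewrite /k /= -gauss1N opprB; congr (_ * _)%:E.
    by apply: eq_bigr => i _; rewrite -gauss1N opprB.
Qed.

End space_time_bound.

Section low_dimensional_integrals.
Context {R : realType}.
Local Notation leb := (@lebesgue_measure R).
Local Notation mu n := (lebesgue_Rn R n).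

Definition line_point (a : measurableTypeR R) : Rn R 1 := cons_Rn (a, [tuple]).

Definition plane_point (a b : measurableTypeR R) : Rn R 2 := cons_Rn (a, line_point b).

Lemma ge0_integral_Rn0 (f : Rn R 0 -> \bar R) : measurable_fun setT f ->
  (forall x, 0 <= f x)%E -> (\int[mu 0]_x f x = f [tuple])%E.
Proof. by move=> mf f0; rewrite integral_dirac// diracT mul1e. Qed.

Lemma ge0_integral_Rn1 (f : Rn R 1 -> \bar R) : measurable_fun setT f ->
  (forall x, 0 <= f x)%E -> (\int[mu 1]_x f x = \int[leb]_a f (line_point a))%E.
Proof.
move=> mf f0; rewrite ge0_integral_cons2//; apply: eq_integral => a _.
rewrite ge0_integral_Rn0//; apply: (measurableT_comp mf).
exact: (measurableT_comp (measurable_cons_Rn (n := 0)) (measurable_pair1 a)).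
Qed.

Lemma ge0_integral_Rn2 (f : Rn R 2 -> \bar R) : measurable_fun setT f ->
  (forall x, 0 <= f x)%E ->
  (\int[mu 2]_x f x = \int[leb]_a \int[leb]_b f (plane_point a b))%E.
Proof.
move=> mf f0; rewrite ge0_integral_cons2//; apply: eq_integral => a _.
rewrite ge0_integral_Rn1//; apply: (measurableT_comp mf).
exact: (measurableT_comp (measurable_cons_Rn (n := 1)) (measurable_pair1 a)).
Qed.

Lemma dot_line a b : dot (line_point a) (line_point b) = a * b.
Proof. by rewrite dot_cons dot_Rn0 addr0. Qed.

Lemma dot_plane a b c d : dot (plane_point a b) (plane_point c d) = a * c + b * d.
Proof. by rewrite dot_cons dot_line. Qed.

End low_dimensional_integrals.

Section energy_product.
Context d1 d2 (T1 : measurableType d1) (T2 : measurableType d2) (R : realType).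
Variables (m1 : {sigma_finite_measure set T1 -> \bar R})
  (m2 : {sigma_finite_measure set T2 -> \bar R}).

Lemma energy_prod (f : T1 -> R[i]) (g : T2 -> R[i]) : cmeasurable f -> cmeasurable g ->
  (energy m1 f < +oo)%E -> (energy m2 g < +oo)%E ->
  energy (m1 \x m2)%E (fun z => f z.1 * g z.2) = (energy m1 f * energy m2 g)%E.
Proof.
move=> mf mg foo goo; have [a a0 fE] := ge0_lty_EFin (energy_ge0 m1 f) foo.
have [b b0 gE] := ge0_lty_EFin (energy_ge0 m2 g) goo.
have mfg : cmeasurable (fun z : T1 * T2 => f z.1 * g z.2).
  apply: cmeasurableM; first exact: (cmeasurable_comp measurable_fst mf).
  exact: (cmeasurable_comp measurable_snd mg).
rewrite /energy (@fubini_tonelli1 _ _ _ _ _ m1 m2 (fun z => (nsq (f z.1 * g z.2))%:E))//; last 2 first.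
- exact: emeasurable_nsq.
- by move=> z; rewrite lee_fin nsq_ge0.
transitivity (\int[m1]_x ((nsq (f x))%:E * b%:E))%E.
  apply: eq_integral => x _; rewrite /fubini_F /= -gE /energy.
  rewrite -ge0_integralZl//.
  - by apply: eq_integral => y _; rewrite nsqM EFinM.
  - exact: emeasurable_nsq.
  - by move=> y _; rewrite lee_fin nsq_ge0.
  - by rewrite lee_fin nsq_ge0.
rewrite ge0_integralZr//.
- by rewrite -/(energy m1 f) -/(energy m2 g) fE gE.
- exact: emeasurable_nsq.
- by move=> x _; rewrite lee_fin nsq_ge0.
Qed.

End energy_product.

Section strichartz_frequency.
Context {R : realType}.
Local Notation leb := (@lebesgue_measure R).
Local Notation mu n := (lebesgue_Rn R n).

Definition extension n (g : Rn R n -> R[i]) (z : spacetime R n) : R[i] :=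
  cintegral (mu n) (fun xi => g xi * expi (z.1 * dot xi xi + dot z.2 xi)).

Let phase n (z : spacetime R n) xi := z.1 * dot xi xi + dot z.2 xi.

Let int_phase n (g : Rn R n -> R[i]) z : cintegrable (mu n) g ->
  cintegrable (mu n) (fun xi => g xi * expi (phase z xi)).
Proof.
move=> ig; apply: cintegrable_Rn_twist => //; apply: measurable_funD.
  by apply: measurable_funM => //; apply: measurable_dot.
exact: measurable_dot.
Qed.

Let dot_add n (y a b : Rn R n) :
  dot y [tuple (tnth a i + tnth b i) | i < n] = dot y a + dot y b.
Proof.
by rewrite /dot -big_split /=; apply: eq_bigr => i _; rewrite tnth_mktuple mulrDr.
Qed.

Let add_Rn n (a b : Rn R n) : Rn R n := [tuple (tnth a i + tnth b i) | i < n].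

Let measurable_add n d (T : measurableType d) (f g : T -> Rn R n) :
  measurable_fun setT f -> measurable_fun setT g ->
  measurable_fun setT (fun x => add_Rn (f x) (g x)).
Proof.
move=> mf mg; apply/measurable_fun_tnthP => i.
rewrite (_ : _ \o _ = fun x => tnth (f x) i + tnth (g x) i); last first.
  by apply/funext => x /=; rewrite tnth_mktuple.
by apply: measurable_funD; apply: (measurableT_comp (measurable_tnth i)).
Qed.

Lemma extension_line_le (g : Rn R 1 -> R[i]) : cintegrable (mu 1) g ->
  (energy (mu 1) g < +oo)%E ->
  (\int[leb \x mu 1]_z (nsq (extension g z) ^+ 3)%:E <=
   ((2 * pi) ^+ 2 * (pi / Num.sqrt 3))%:E * (energy (mu 1) g * (energy (mu 1) g * energy (mu 1) g)))%E.
Proof.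
move=> ig goo; have mg := cintegrable_cmeasurable ig.
pose m := sigma_finite_prod (mu 1) (sigma_finite_prod (mu 1) (mu 1)).
pose tau (x : Rn R 1 * (Rn R 1 * Rn R 1)) : R :=
  dot x.1 x.1 + (dot x.2.1 x.2.1 + dot x.2.2 x.2.2).
pose zeta (x : Rn R 1 * (Rn R 1 * Rn R 1)) := add_Rn x.1 (add_Rn x.2.1 x.2.2).
pose G (x : Rn R 1 * (Rn R 1 * Rn R 1)) := g x.1 * (g x.2.1 * g x.2.2).
have m1 : measurable_fun [set: Rn R 1 * (Rn R 1 * Rn R 1)] (fun x => x.1) by exact: measurable_fst.
have m21 : measurable_fun [set: Rn R 1 * (Rn R 1 * Rn R 1)] (fun x => x.2.1).
  exact: (measurableT_comp measurable_fst measurable_snd).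
have m22 : measurable_fun [set: Rn R 1 * (Rn R 1 * Rn R 1)] (fun x => x.2.2).
  exact: (measurableT_comp measurable_snd measurable_snd).
have mtau : measurable_fun setT tau.
  by apply: measurable_funD; [|apply: measurable_funD]; exact: measurable_dot.
have mzeta : measurable_fun setT zeta by do 2 ?apply: measurable_add.
have igg : cintegrable (sigma_finite_prod (mu 1) (mu 1)) (fun x => g x.1 * g x.2).
  exact: cintegrable_prod.
have iG : cintegrable m G by exact: (cintegrable_prod ig igg).
have EG : energy m G = (energy (mu 1) g * (energy (mu 1) g * energy (mu 1) g))%E.
  have Egg := energy_prod mg mg goo goo.
  rewrite -Egg -(energy_prod (m2 := sigma_finite_prod (mu 1) (mu 1)) mg (cintegrable_cmeasurable igg) goo)//.
  by rewrite [X in (X < _)%E]Egg lte_mul_pinfty// ?energy_ge0// ge0_fin_numE// energy_ge0.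
rewrite -EG.
have C0 : 0 <= (2 * pi) ^+ 2 * (pi / Num.sqrt 3) :> R.
  by rewrite mulr_ge0 ?exprn_ge0 ?divr_ge0 ?sqrtr_ge0 ?mulr_ge0 ?pi_ge0.
have := @space_time_bound _ _ _ _ m tau zeta G _ mtau mzeta iG C0.
rewrite (_ : (\int[_]_z _)%E = (\int[leb \x mu 1]_z (nsq (extension g z) ^+ 3)%:E)%E); last first.
  apply: eq_integral => z _; congr EFin.
  rewrite (@eq_cintegral _ _ _ _ (fun x => (g x.1 * expi (phase z x.1)) *
    ((g x.2.1 * expi (phase z x.2.1)) * (g x.2.2 * expi (phase z x.2.2))))); last first.
    move=> x; rewrite /G /tau /zeta !dot_add.
    rewrite (_ : _ + _ = phase z x.1 + (phase z x.2.1 + phase z x.2.2)); last by rewrite /phase; ring.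
    by rewrite !expiD; ring.
  rewrite (cintegral_prod (m2 := sigma_finite_prod (mu 1) (mu 1)) (int_phase z ig)
    (g := fun x => (g x.1 * expi (phase z x.1)) * (g x.2 * expi (phase z x.2)))); last first.
    exact: (cintegrable_prod (int_phase z ig) (int_phase z ig)).
  rewrite (cintegral_prod (int_phase z ig) (int_phase z ig)) !nsqM.
  by rewrite -/(extension g z) exprS expr2.
apply => e T Z e0.
pose F (x : Rn R 1 * (Rn R 1 * Rn R 1)) : R :=
  gauss1 e (T - tau x) * \prod_(i < 1) gauss1 e (tnth Z i - tnth (zeta x) i).
have F0 x : (0 <= (F x)%:E)%E.
  by rewrite lee_fin mulr_ge0 ?gauss1_ge0// prodr_ge0// => i _; exact: gauss1_ge0.
have mF : measurable_fun setT (fun x => (F x)%:E).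
  apply/measurable_EFinP; apply: measurable_funM.
    by apply: (measurableT_comp (measurable_gauss1 e)); exact: measurable_funB.
  apply: measurable_prod => i _; apply: (measurableT_comp (measurable_gauss1 e)).
  by apply: measurable_funB => //; exact: (measurableT_comp (measurable_tnth i) mzeta).
have -> : (\int[m]_x (F x)%:E = \int[leb]_x \int[leb]_y \int[leb]_z
   (gauss1 e (T - (x ^+ 2 + (y ^+ 2 + z ^+ 2))) * gauss1 e (tnth Z ord0 - (x + (y + z))))%:E)%E.
  rewrite (@fubini_tonelli1 _ _ _ _ _ (mu 1) (sigma_finite_prod (mu 1) (mu 1)) (fun x => (F x)%:E))//.
  rewrite ge0_integral_Rn1; last 2 first.
  - exact: (measurable_fun_fubini_tonelli_F _ mF F0).
  - by move=> x; exact: integral_ge0.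
  apply: eq_integral => a _; rewrite /fubini_F.
  have mFa := measurableT_comp mF (measurable_pair1 (line_point a)).
  rewrite (@fubini_tonelli1 _ _ _ _ _ (mu 1) (mu 1) (fun x => (F (line_point a, x))%:E))//.
  rewrite ge0_integral_Rn1; last 2 first.
  - exact: (measurable_fun_fubini_tonelli_F _ mFa (fun x => F0 _)).
  - by move=> x; exact: integral_ge0.
  apply: eq_integral => b _; rewrite /fubini_F ge0_integral_Rn1//; last first.
    exact: (measurableT_comp mFa (measurable_pair1 _)).
  apply: eq_integral => c _; rewrite /F /tau /zeta /= !dot_line big_ord1 !tnth_mktuple.
  by rewrite /line_point /cons_Rn /= !tnth0 -!expr2.
exact: parabola_convolution_le.
Qed.

Lemma extension_plane_le (g : Rn R 2 -> R[i]) : cintegrable (mu 2) g ->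
  (energy (mu 2) g < +oo)%E ->
  (\int[leb \x mu 2]_z (nsq (extension g z) ^+ 2)%:E <=
   ((2 * pi) ^+ 3 * (pi / 2))%:E * (energy (mu 2) g * energy (mu 2) g))%E.
Proof.
move=> ig goo; have mg := cintegrable_cmeasurable ig.
pose m := sigma_finite_prod (mu 2) (mu 2).
pose tau (x : Rn R 2 * Rn R 2) : R := dot x.1 x.1 + dot x.2 x.2.
pose zeta (x : Rn R 2 * Rn R 2) := add_Rn x.1 x.2.
have m1 : measurable_fun [set: Rn R 2 * Rn R 2] (fun x => x.1) by exact: measurable_fst.
have m2 : measurable_fun [set: Rn R 2 * Rn R 2] (fun x => x.2) by exact: measurable_snd.
have mtau : measurable_fun setT tau by apply: measurable_funD; exact: measurable_dot.
have mzeta : measurable_fun setT zeta by exact: measurable_add.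
have iG : cintegrable m (fun x => g x.1 * g x.2) by exact: cintegrable_prod.
have EG := energy_prod mg mg goo goo; rewrite -EG.
have C0 : 0 <= (2 * pi) ^+ 3 * (pi / 2) :> R.
  by rewrite mulr_ge0 ?exprn_ge0 ?divr_ge0 ?mulr_ge0 ?pi_ge0.
have := @space_time_bound _ _ _ _ m tau zeta _ _ mtau mzeta iG C0.
rewrite (_ : (\int[_]_z _)%E = (\int[leb \x mu 2]_z (nsq (extension g z) ^+ 2)%:E)%E); last first.
  apply: eq_integral => z _; congr EFin.
  rewrite (@eq_cintegral _ _ _ _ (fun x => (g x.1 * expi (phase z x.1)) *
    (g x.2 * expi (phase z x.2)))); last first.
    move=> x; rewrite /tau /zeta !dot_add.
    rewrite (_ : _ + _ = phase z x.1 + phase z x.2); last by rewrite /phase; ring.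
    by rewrite !expiD; ring.
  by rewrite (cintegral_prod (int_phase z ig) (int_phase z ig)) nsqM expr2.
apply => e T Z e0.
pose F (x : Rn R 2 * Rn R 2) : R :=
  gauss1 e (T - tau x) * \prod_(i < 2) gauss1 e (tnth Z i - tnth (zeta x) i).
have F0 x : (0 <= (F x)%:E)%E.
  by rewrite lee_fin mulr_ge0 ?gauss1_ge0// prodr_ge0// => i _; exact: gauss1_ge0.
have mF : measurable_fun setT (fun x => (F x)%:E).
  apply/measurable_EFinP; apply: measurable_funM.
    by apply: (measurableT_comp (measurable_gauss1 e)); exact: measurable_funB.
  apply: measurable_prod => i _; apply: (measurableT_comp (measurable_gauss1 e)).
  by apply: measurable_funB => //; exact: (measurableT_comp (measurable_tnth i) mzeta).
have -> : (\int[m]_x (F x)%:E = \int[leb]_x \int[leb]_y \int[leb]_u \int[leb]_v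
     (gauss1 e (T - ((x ^+ 2 + y ^+ 2) + (u ^+ 2 + v ^+ 2))) *
      (gauss1 e (tnth Z ord0 - (x + u)) * gauss1 e (tnth Z (lift ord0 ord0) - (y + v))))%:E)%E.
  rewrite (@fubini_tonelli1 _ _ _ _ _ (mu 2) (mu 2) (fun x => (F x)%:E))//.
  rewrite ge0_integral_Rn2; last 2 first.
  - exact: (measurable_fun_fubini_tonelli_F _ mF F0).
  - by move=> x; exact: integral_ge0.
  apply: eq_integral => a _; apply: eq_integral => b _; rewrite /fubini_F.
  rewrite ge0_integral_Rn2//; last first.
    exact: (measurableT_comp mF (measurable_pair1 _)).
  apply: eq_integral => c _; apply: eq_integral => d _.
  rewrite /F /tau /zeta /= !dot_plane big_ord_recl big_ord1 !tnth_mktuple.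
  by rewrite /plane_point /line_point /cons_Rn /= !tnth0 !tnthS !tnth0 -!expr2.
exact: paraboloid_convolution_le.
Qed.

End strichartz_frequency.

Lemma ae_cvg_of_summable d (T : measurableType d) (R : realType)
  (mu : {measure set T -> \bar R}) (h : nat -> T -> \bar R) (C : R) : 0 <= C ->
  (forall j, measurable_fun setT (h j)) -> (forall j x, (0 <= h j x)%E) ->
  (forall j, (\int[mu]_x h j x <= (C / (2 ^ j.+1)%:R)%:E)%E) ->
  {ae mu, forall x, h j x @[j --> \oo] --> 0%E}.
Proof.
move=> C0 mh h0 hC; pose S x := (\sum_(0 <= j <oo) h j x)%E.
have mS : measurable_fun setT S by exact: ge0_emeasurable_sum.
have S0 x : (0 <= S x)%E by exact: nneseries_ge0.
have Soo : (\int[mu]_x S x < +oo)%E.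
  rewrite integral_nneseries//; apply: (@le_lt_trans _ _ C%:E); last exact: ltry.
  apply: le_trans (epsilon_trick0 xpredT C0); apply: lee_nneseries => // j _ _.
  exact: integral_ge0.
apply: filterS (ae_lty mS S0 Soo) => x Sx.
have tail := nneseries_tail_cvg Sx (fun k _ => h0 k x).
apply: (squeeze_cvge _ (cvg_cst 0%E) tail); apply: nearW => j; rewrite h0 /=.
have := @nneseries_lim_ge R (h ^~ x) xpredT j j.+1 (fun i _ _ => h0 i x).
by rewrite big_nat1.
Qed.

Lemma cvg_nsq (R : realType) (w : nat -> R[i]) (z : R[i]) :
  nsq (w j - z) @[j --> \oo] --> (0 : R) -> nsq (w j) @[j --> \oo] --> nsq z.
Proof.
move=> w0; have s0 : Num.sqrt (nsq (w j - z)) @[j --> \oo] --> (0 : R).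
  rewrite -[X in _ --> X]sqrtr0.
  by apply: (@cvg_comp _ _ _ (fun j => nsq (w j - z)) (@Num.sqrt R)); [exact: w0|exact: sqrt_continuous].
have part (p : R[i] -> R) : (forall a b, p (a - b) = p a - p b) ->
    (forall a, `|p a| <= normc a) -> p (w j) @[j --> \oo] --> p z.
  move=> pB ple; apply/subr_cvg0/norm_cvg0P => /=.
  apply: (squeeze_cvgr _ (cvg_cst 0) s0); apply: nearW => j.
  by rewrite normr_ge0 /= -pB -normcE ple.
have cRe : complex.Re (w j) @[j --> \oo] --> complex.Re z.
  by apply: part; [case=> ? ? [? ?]|exact: Re_norm].
have cIm : complex.Im (w j) @[j --> \oo] --> complex.Im z.
  by apply: part; [case=> ? ? [? ?]|exact: Im_norm].
by rewrite /nsq !expr2; under eq_fun do rewrite !expr2; apply: cvgD; exact: cvgM.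
Qed.

Section strichartz_limit.
Context {R : realType} (n : nat).
Local Notation leb := (@lebesgue_measure R).
Local Notation mu := (lebesgue_Rn R n).
Local Notation c := ((2 * pi : R) ^+ n).
Local Notation E := (energy mu).
Variables (k : nat) (A : R).
Hypothesis A0 : 0 <= A.
Hypothesis frequency_bound : forall (g : Rn R n -> R[i]) (e : R), 0 <= e ->
  cintegrable mu g -> (E g <= (c * e)%:E)%E ->
  (\int[leb \x mu]_z (nsq ((c^-1)%:C * extension g z) ^+ k)%:E <= (A * e ^+ k)%:E)%E.

Lemma inverse_fourier_extension (g : Rn R n -> R[i]) t x :
  inverse_fourier (fun xi => expi (t * dot xi xi) * g xi) x = (c^-1)%:C * extension g (t, x).
Proof.
rewrite /inverse_fourier /extension; congr (_ * _); apply: eq_cintegral => xi.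
by rewrite /= expiD mulrA [g xi * _]mulrC.
Qed.

Lemma cmeasurable_extension (g : Rn R n -> R[i]) : cmeasurable g -> cmeasurable (extension g).
Proof.
move=> mg; suff mF : cmeasurable (fun w : spacetime R n * Rn R n =>
  g w.2 * expi (w.1.1 * dot w.2 w.2 + dot w.1.2 w.2)) by exact: (cmeasurable_cintegral2 mu mF).
have m2 : measurable_fun [set: spacetime R n * Rn R n] (fun w => w.2).
  exact: measurable_snd.
have m11 : measurable_fun [set: spacetime R n * Rn R n] (fun w => w.1.1).
  exact: (measurableT_comp measurable_fst measurable_fst).
have m12 : measurable_fun [set: spacetime R n * Rn R n] (fun w => w.1.2).
  exact: (measurableT_comp measurable_snd measurable_fst).
apply: cmeasurableM; first exact: (cmeasurable_comp m2 mg).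
apply: cmeasurable_expi; apply: measurable_funD; last exact: measurable_dot.
by apply: measurable_funM => //; exact: measurable_dot.
Qed.

Section truncation.
Variable fh : Rn R n -> R[i].
Hypothesis mfh : cmeasurable fh.
Hypothesis fhoo : (E fh < +oo)%E.

Definition damping m (xi : Rn R n) : R := expR (- (m.+1%:R^-1 * dot xi xi)).
Definition damped m (xi : Rn R n) : R[i] := fh xi * (damping m xi)%:C.

Let dotx0 (xi : Rn R n) : 0 <= dot xi xi.
Proof. by apply: sumr_ge0 => i _; rewrite -expr2 sqr_ge0. Qed.

Let damping_le1 m xi : 0 <= damping m xi <= 1.
Proof. by rewrite expR_ge0 /= expR_le1 oppr_le0 mulr_ge0. Qed.

Let mdot : measurable_fun setT (fun xi : Rn R n => dot xi xi).
Proof. exact: measurable_dot. Qed.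

Let mdamping m : measurable_fun setT (damping m).
Proof.
apply: measurableT_comp => //; apply: measurableT_comp => //.
exact: measurable_funM.
Qed.

Lemma cmeasurable_damped m : cmeasurable (damped m).
Proof. by apply: cmeasurableM => //; exact: cmeasurable_real. Qed.

Lemma energy_damped m : (E (damped m) <= E fh)%E.
Proof.
apply: ge0_le_integral => //.
- by move=> x _; rewrite lee_fin nsq_ge0.
- by apply/emeasurable_nsq/cmeasurable_damped.
- exact: emeasurable_nsq.
- move=> x _; rewrite lee_fin nsqM nsq_real ler_piMr ?nsq_ge0//.
  have /andP[d0 d1] := damping_le1 m x; exact: exprn_ile1.
Qed.

Lemma cintegrable_damped m : cintegrable mu (damped m).
Proof.
have i1 : mu.-integrable setT (fun x => (nsq (fh x))%:E).
  by apply: ge0_integrable => //; [exact: measurable_nsq|move=> x; exact: nsq_ge0].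
have a0 : 0 < 2 * m.+1%:R^-1 :> R by rewrite mulr_gt0.
have i2 : mu.-integrable setT (fun x => (expR (- (2 * m.+1%:R^-1 * dot x x)))%:E).
  by have [] := cintegrable_gaussian_Rn n a0.
apply: (cintegrable_dom (h := fun x => nsq (fh x) + expR (- (2 * m.+1%:R^-1 * dot x x)))).
- exact: cmeasurable_damped.
- by have := integrableD measurableT i1 i2; congr (_.-integrable _ _); apply/funext.
- move=> x; rewrite normcM (normcE (_%:C)) nsq_real sqrtr_sqr ger0_norm ?expR_ge0//.
  rewrite -normc_sqr (_ : expR (- (2 * m.+1%:R^-1 * dot x x)) = damping m x ^+ 2); last first.
    by rewrite /damping expr2 -expRD; congr expR; ring.
  have := normc_ge0 (fh x); have := expR_ge0 (- (m.+1%:R^-1 * dot x x)).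
  rewrite -/(damping m x); nra.
Qed.

Lemma cvg_damped : E (fun xi => damped m xi - fh xi) @[m --> \oo] --> 0%E.
Proof.
pose g_ m (x : Rn R n) := (nsq (damped m x - fh x))%:E.
have mg_ m : measurable_fun setT (g_ m).
  by apply/emeasurable_nsq/cmeasurableB => //; exact: cmeasurable_damped.
have gE m x : nsq (damped m x - fh x) = nsq (fh x) * (damping m x - 1) ^+ 2.
  rewrite /damped (_ : _ - _ = fh x * (damping m x - 1)%:C) ?nsqM ?nsq_real//.
  by rewrite rmorphB /= mulrBr mulr1.
have g_0 : {ae mu, forall x, [set: Rn R n] x -> g_ ^~ x @ \oo --> cst 0%E x}.
  apply: aeW => x _; apply: cvg_EFin; first exact: nearW.
  have dc : (damping m x - 1) @[m --> \oo] --> (0 : R).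
    rewrite -(subrr 1); apply: cvgB; last exact: cvg_cst.
    rewrite -[X in _ --> X]expR0.
    apply: (@cvg_comp _ _ _ (fun m : nat => - (m.+1%:R^-1 * dot x x)) (@expR R)); last exact: continuous_expR.
    rewrite -oppr0 -(mul0r (dot x x)); apply: cvgN; apply: cvgMr_tmp.
    exact: cvg_harmonic.
  under eq_fun do rewrite /g_ /= gE expr2.
  rewrite -(mulr0 (nsq (fh x))); apply: cvgMl_tmp; rewrite -(mulr0 0); exact: cvgM.
have ifh : mu.-integrable setT (fun x => (nsq (fh x))%:E).
  by apply: ge0_integrable => //; [exact: measurable_nsq|move=> x; exact: nsq_ge0].
have g_fh : {ae mu, forall x m, [set: Rn R n] x -> (`|g_ m x| <= (nsq (fh x))%:E)%E}.
  apply: aeW => x m _; rewrite /g_ gee0_abs ?lee_fin ?nsq_ge0// gE ler_piMr ?nsq_ge0//.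
  have /andP[d0 d1] := damping_le1 m x; nra.
have [_ _] := dominated_convergence measurableT mg_ (measurable_cst _) g_0 ifh g_fh.
by rewrite integral0.
Qed.

End truncation.
Lemma energy_le_of_cLnorm2 (f g : Rn R n -> R[i]) (a : R) : 0 <= a ->
  (cLnorm mu 2 f <= (Num.sqrt a)%:E * cLnorm mu 2 g)%E -> (E f <= a%:E * E g)%E.
Proof.
move=> a0 fg; rewrite -(sqr_cLnorm2 mu f).
apply: (le_trans (lee_pmul (cLnorm2_ge0 _ _) (cLnorm2_ge0 _ _) fg fg)).
by rewrite muleACA -EFinM -expr2 sqr_sqrtr// sqr_cLnorm2.
Qed.

Section estimate.
Variables (f : Rn R n -> R[i]) (u : spacetime R n -> R[i]) (e : R).
Hypothesis e0 : 0 <= e.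
Hypothesis fe : (E f <= e%:E)%E.
Hypothesis solution : is_schrodinger f u.

(* The transforms of the damped data converge to [u] in L^2 for each [t], uniformly
   in [t]; the weight [expR (- t ^+ 2)] makes a summable subsequence of the errors
   integrable in space-time, whence almost everywhere convergence. *)
Lemma strichartz_le : (\int[leb \x mu]_z (nsq (u z) ^+ k)%:E <= (A * e ^+ k)%:E)%E.
Proof.
have [mu_ [fh ffh ufh]] := solution; have c0 : 0 < c := two_pi_gt0 n.
have fhe : (E fh <= (c * e)%:E)%E.
  apply: le_trans (energy_le_of_cLnorm2 (ltW c0) (is_fourier_le ffh)) _.
  by rewrite EFinM lee_wpmul2l// lee_fin ltW.
have [_ /cLp2P[mfh fhoo] _] := ffh.
have /choice[m_ hm_] : forall j, exists m,
    (E (fun xi => (damped fh m xi - fh xi)%R) <= (((2 ^ j.+1)%:R : R)^-1)%:E)%E.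
  move=> j; have /fine_cvgP[fin cu] := cvg_damped mfh fhoo.
  have j0 : (0 : R) < (2 ^ j.+1)%:R^-1 by rewrite invr_gt0 ltr0n expn_gt0.
  have /cvgrPdist_lt /(_ _ j0) near_j := cu.
  near \oo => m; exists m.
  have fm : E (fun xi => (damped fh m xi - fh xi)%R) \is a fin_num by near: m.
  rewrite -(fineK fm) lee_fin ltW//.
  have : `|0 - fine (E (fun xi => (damped fh m xi - fh xi)%R))| < (2 ^ j.+1)%:R^-1 by near: m.
  by rewrite sub0r normrN; apply: le_lt_trans; exact: ler_norm.
pose W j z : R[i] := (c^-1)%:C * extension (damped fh (m_ j)) z.
have mW j : cmeasurable (W j).
  by apply: cmeasurableM; [exact: cmeasurable_cst|apply: cmeasurable_extension; exact: cmeasurable_damped].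
have slice j t : (\int[mu]_x (nsq (W j (t, x) - u (t, x)))%:E <= (c^-1 * (2 ^ j.+1)%:R^-1)%:E)%E.
  pose G xi : R[i] := expi (t * dot xi xi) * damped fh (m_ j) xi.
  have mexp : measurable_fun setT (fun xi : Rn R n => t * dot xi xi).
    by apply: measurable_funM => //; exact: measurable_dot.
  have iG : cintegrable mu G.
    have := cintegrable_Rn_twist mexp (cintegrable_damped mfh fhoo (m_ j)).
    by congr cintegrable; apply/funext => xi; rewrite mulrC.
  have Goo : (E G < +oo)%E.
    rewrite (_ : E G = E (damped fh (m_ j))).
      exact: le_lt_trans (energy_damped mfh (m_ j)) fhoo.
    by apply: eq_integral => xi _; rewrite nsqM nsq_expi mul1r.
  have ci0 : 0 <= c^-1 by rewrite invr_ge0 ltW.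
  have := energy_le_of_cLnorm2 ci0 (is_fourier_inverse_le (ufh t) iG Goo).
  rewrite (_ : E (fun xi => (G xi - expi (t * dot xi xi) * fh xi)%R) =
    E (fun xi => (damped fh (m_ j) xi - fh xi)%R)); last first.
    by apply: eq_integral => xi _; rewrite -mulrBr nsqM nsq_expi mul1r.
  move=> H; rewrite /W; under eq_integral do rewrite -inverse_fourier_extension.
  by apply: (le_trans H); rewrite EFinM lee_wpmul2l.
pose w j (z : spacetime R n) := (expR (- (1 * z.1 ^+ 2)) * nsq (W j z - u z))%:E.
have w0 j z : (0 <= w j z)%E by rewrite lee_fin mulr_ge0 ?expR_ge0 ?nsq_ge0.
have mw j : measurable_fun setT (w j).
  apply/measurable_EFinP; apply: measurable_funM; last exact/measurable_nsq/cmeasurableB.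
  apply: measurableT_comp => //; apply: measurableT_comp => //; apply: measurable_funM => //.
  by apply: measurable_funX; exact: measurable_fst.
have ae0 : {ae (leb \x mu)%E, forall z, w j z @[j --> \oo] --> 0%E}.
  apply: (@ae_cvg_of_summable _ _ _ _ _ (Num.sqrt (pi / 1) * c^-1)) => // [|j].
    by rewrite mulr_ge0 ?sqrtr_ge0// invr_ge0 ltW.
  rewrite (fubini_tonelli1 (w j))//.
  apply: (@le_trans _ _ (\int[leb]_t ((expR (- (1 * t ^+ 2)))%:E * (c^-1 * (2 ^ j.+1)%:R^-1)%:E))%E).
    apply: ge0_le_integral => //.
    - by move=> t _; exact: integral_ge0.
    - exact: measurable_fun_fubini_tonelli_F.
    - apply: emeasurable_funM => //; apply/measurable_EFinP; exact: measurable_gauss_weight.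
    - move=> t _; rewrite /fubini_F /w /=; under eq_integral do rewrite EFinM.
      rewrite ge0_integralZl//.
      + by rewrite lee_wpmul2l ?lee_fin ?expR_ge0.
      + apply/measurable_EFinP/measurable_nsq.
        by apply: cmeasurableB; apply: (cmeasurable_comp (measurable_pair1 t)).
      + by move=> x _; rewrite lee_fin nsq_ge0.
  rewrite ge0_integralZr//; last 2 first.
  - by apply/measurable_EFinP; exact: measurable_gauss_weight.
  - by rewrite lee_fin mulr_ge0// invr_ge0 ltW.
  by rewrite integral_expRNsqr// -EFinM lee_fin mulrA.
apply: (@fatou_le _ _ _ _ (fun j z => (nsq (W j z) ^+ k)%:E)).
- by move=> j; apply/measurable_EFinP/measurable_funX/measurable_nsq.
- by move=> j z; rewrite lee_fin exprn_ge0// nsq_ge0.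
- by apply/measurable_EFinP/measurable_funX/measurable_nsq.
- by move=> z; rewrite lee_fin exprn_ge0// nsq_ge0.
- apply: filterS ae0 => z wz; apply: cvg_EFin; first exact: nearW.
  apply: (@cvg_comp _ _ _ (fun j => nsq (W j z)) (fun r : R => r ^+ k)); last exact: exprn_continuous.
  apply: cvg_nsq; have /fine_cvgP[_ fz] := wz.
  have -> : (fun j => nsq (W j z - u z)) = (fun j => expR (1 * z.1 ^+ 2) * fine (w j z)).
    by apply/funext => j; rewrite /w /= mulrA -expRD subrr expR0 mul1r.
  rewrite -(mulr0 (expR (1 * z.1 ^+ 2))); exact: cvgMl_tmp.
- move=> j; apply: frequency_bound => //; first exact: cintegrable_damped.
  exact: le_trans (energy_damped mfh _) fhe.
Unshelve. all: end_near. Qed.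

End estimate.
End strichartz_limit.

Lemma ae_eq0_of_energy0 d (T : measurableType d) (R : realType)
  (mu : {measure set T -> \bar R}) (f : T -> R[i]) : cmeasurable f ->
  energy mu f = 0%E -> {ae mu, forall x, f x = 0}.
Proof.
move=> mf f0; have mn : measurable_fun setT (fun x => (nsq (f x))%:E).
  exact: emeasurable_nsq.
have : (\int[mu]_x `|(nsq (f x))%:E| = 0)%E.
  rewrite -f0; apply: eq_integral => x _.
  by rewrite gee0_abs// lee_fin nsq_ge0.
move=> /(ae_eq_integral_abs _ measurableT mn); apply: filterS => x /(_ Logic.I) [].
case: (f x) => a b; rewrite /nsq /= => /eqP.
by rewrite paddr_eq0 ?sqr_ge0// !sqrf_eq0 => /andP[/eqP -> /eqP ->].
Qed.

(** * The Gaussian evolution *)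

Section chirp.
Context {R : realType}.
Local Notation leb := (@lebesgue_measure R).
Local Notation mu n := (lebesgue_Rn R n).

Lemma cintegrable_shift (f : measurableTypeR R -> R[i]) (b : R) : cintegrable leb f ->
  cintegrable leb (fun x : measurableTypeR R => f (x + b)).
Proof.
move=> [f1 f2]; split.
- have := integrable_affine b ltr01 f1.
  by congr (_.-integrable _ _); apply/funext => x; rewrite mul1r.
- have := integrable_affine b ltr01 f2.
  by congr (_.-integrable _ _); apply/funext => x; rewrite mul1r.
Qed.

Lemma cintegral_shift (f : measurableTypeR R -> R[i]) (b : R) : cintegrable leb f ->
  cintegral leb (fun x : measurableTypeR R => f (x + b)) = cintegral leb f.
Proof.
move=> [f1 f2]; rewrite /cintegral.
have := Rintegral_affine b ltr01 f1; have := Rintegral_affine b ltr01 f2.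
rewrite invr1 !mul1r => <- <-; congr (_ +i* _).
- by apply: eq_Rintegral => x _; rewrite mul1r.
- by apply: eq_Rintegral => x _; rewrite mul1r.
Qed.

Definition chirp (a t x : R) (xi : measurableTypeR R) : R[i] :=
  (expR (- (a * xi ^+ 2)))%:C * expi (t * xi ^+ 2 + x * xi).

Lemma cintegrable_chirp a t x : 0 < a -> cintegrable leb (chirp a t x).
Proof.
move=> a0; have mexp : cmeasurable (fun xi : measurableTypeR R => expi (t * xi ^+ 2)).
  by apply: cmeasurable_expi; apply: measurable_funM => //; exact: measurable_funX.
have := cintegrableM_unit (cintegrable_gauss x a0) mexp (fun xi => nsq_expi _).
congr cintegrable; apply/funext => xi.
by rewrite /chirp -mulrA -expiD [_ + _ * _]addrC.
Qed.

(* Writing [|I|^2] as a double integral in [(p, eta)] with [xi = eta + p] removes the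
   quadratic phase, so that only Fourier transforms of real Gaussians remain. *)
Lemma nsq_integral_chirp (a t x : R) : 0 < a ->
  nsq (cintegral leb (chirp a t x)) =
  Num.sqrt (pi / (2 * a)) * (Num.sqrt (pi / ((a ^+ 2 + t ^+ 2) / (2 * a))) *
    expR (- (x ^+ 2 / (4 * ((a ^+ 2 + t ^+ 2) / (2 * a)))))).
Proof.
move=> a0; pose F := chirp a t x; have iF : cintegrable leb F by exact: cintegrable_chirp.
set b := (a ^+ 2 + t ^+ 2) / (2 * a).
have a20 : 0 < 2 * a by rewrite mulr_gt0.
have b0 : 0 < b by rewrite divr_gt0// ltr_pwDl// ?exprn_gt0// sqr_ge0.
pose H (z : plane R) : R[i] := F (z.2 + z.1) * conjc (F z.1).
have normF y : normc (F y) = expR (- (a * y ^+ 2)).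
  rewrite /F /chirp normcM (normcE (_%:C)) nsq_real sqrtr_sqr ger0_norm ?expR_ge0//.
  by rewrite normcE nsq_expi sqrtr1 mulr1.
have mF := cintegrable_cmeasurable iF.
have m1 : measurable_fun [set: plane R] (fun z => z.1) by exact: measurable_fst.
have m2 : measurable_fun [set: plane R] (fun z => z.2) by exact: measurable_snd.
have mH : cmeasurable H.
  apply: cmeasurableM; last by apply: cmeasurable_conj; exact: (cmeasurable_comp m1 mF).
  by apply: (cmeasurable_comp _ mF); exact: measurable_funD.
have a40 : 0 < a / 4 by rewrite divr_gt0.
have iH : cintegrable (leb \x leb)%E H.
  apply: (cintegrable_dom mH (integrable_prod (integrable_expRNsqr a40) (integrable_expRNsqr a40))).
  move=> [y p]; rewrite normcM normF (normcE (conjc _)) nsq_conj -normcE normF -!expRD ler_expR /=.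
  have := sqr_ge0 (7 * y + 4 * p); nra.
have E1 : (nsq (cintegral leb F))%:C = cintegral leb (fun y => cintegral leb (fun p => H (y, p))).
  rewrite -mul_conjc -cintegral_conj// -cintegralZ; last exact: cintegrable_conj.
  apply: eq_cintegral => y; have iFy := cintegrable_shift y iF.
  by rewrite -[in LHS](cintegral_shift y iF) -(cintegralZr _ iFy).
have E2 p : cintegral leb (fun y => H (y, p)) =
    ((Num.sqrt (pi / (2 * a)))%:C * ((expR (- (b * p ^+ 2)))%:C * expi (x * p))).
  pose K (z : measurableTypeR R) : R[i] := (expR (- (2 * a * z ^+ 2)))%:C * expi ((2 * t * p) * z).
  have iK : cintegrable leb K by exact: cintegrable_gauss.
  rewrite (@eq_cintegral _ _ _ _ (fun y : measurableTypeR R =>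
     ((expR (- (a * p ^+ 2 / 2)))%:C * expi (x * p)) * K (y + p / 2))); last first.
    move=> y; have -> : H (y, p) = F (p + y) * conjc (F y) by [].
    rewrite /F /K /chirp conjcM -expiN (_ : conjc (_%:C) = (expR (- (a * y ^+ 2)))%:C); last first.
      by rewrite /= oppr0.
    rewrite mulrACA -rmorphM -expiD -expRD mulrACA -rmorphM -expiD -expRD.
    by congr ((expR _)%:C * expi _); field.
  rewrite cintegralZ; last exact: cintegrable_shift.
  rewrite cintegral_shift// /K gauss_fourier//.
  rewrite mulrAC -rmorphM mulrCA [LHS]mulrC -expRD.
  rewrite [in RHS]mulrA -rmorphM mulrC; congr ((_ * expR _)%:C * _).
  by rewrite /b; field; rewrite gt_eqF.
have E3 : (nsq (cintegral leb F))%:C = cintegral leb (fun p : measurableTypeR R =>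
    (Num.sqrt (pi / (2 * a)))%:C * ((expR (- (b * p ^+ 2)))%:C * expi (x * p))).
  rewrite E1; apply: (etrans (cfubini2 iH)); rewrite -[LHS](cfubini1 iH).
  exact: eq_cintegral.
rewrite cintegralZ in E3; last exact: cintegrable_gauss.
rewrite gauss_fourier// -rmorphM in E3.
exact: (congr1 (@complex.Re R) E3).
Qed.

Definition chirp_width (a t : R) : R := (a ^+ 2 + t ^+ 2) / (2 * a).

Lemma nsq_integral_chirp_Rn n (a t : R) (x : Rn R n) : 0 < a ->
  cintegrable (mu n) (fun xi => (expR (- (a * dot xi xi)))%:C * expi (t * dot xi xi + dot x xi)) /\
  nsq (cintegral (mu n) (fun xi => (expR (- (a * dot xi xi)))%:C * expi (t * dot xi xi + dot x xi))) =
  (Num.sqrt (pi / (2 * a)) * Num.sqrt (pi / chirp_width a t)) ^+ n *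
    expR (- (dot x x / (4 * chirp_width a t))).
Proof.
move=> a0; elim: n x => [|n IH] x.
  under eq_fun do rewrite !dot_Rn0 !mulr0 addr0 oppr0 expR0 expi0 mulr1.
  split; last first.
    rewrite cintegral_Rn0; last exact: cmeasurable_cst.
    by rewrite dot_Rn0 mul0r oppr0 expR0 mulr1 nsq_real expr1n expr0.
  split => /=; last exact: integrable0.
  apply: ge0_integrable => //.
  by rewrite integral_dirac// diracT mul1e ltry.
have E (z : spacetime R n) :
  (expR (- (a * dot (cons_Rn z) (cons_Rn z))))%:C *
    expi (t * dot (cons_Rn z) (cons_Rn z) + dot x (cons_Rn z)) =
  chirp a t (split_Rn x).1 z.1 * ((expR (- (a * dot z.2 z.2)))%:C *
    expi (t * dot z.2 z.2 + dot (split_Rn x).2 z.2)).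
  rewrite -[in LHS](split_RnK x) !dot_cons /chirp mulrACA -rmorphM -expRD -expiD.
  by congr ((expR _)%:C * expi _); ring.
have [iIH IHE] := IH (split_Rn x).2; have i1 := cintegrable_chirp t (split_Rn x).1 a0.
have i2 := cintegrable_prod i1 iIH.
have i3 : cintegrable (mu n.+1)
    (fun xi => (expR (- (a * dot xi xi)))%:C * expi (t * dot xi xi + dot x xi)).
  by apply/cintegrable_cons; rewrite (_ : (fun z => _) = fun z : spacetime R n =>
    chirp a t (split_Rn x).1 z.1 * ((expR (- (a * dot z.2 z.2)))%:C *
    expi (t * dot z.2 z.2 + dot (split_Rn x).2 z.2)))//; apply/funext => z; exact: E.
split=> //; rewrite (cintegral_cons (cintegrable_cmeasurable i3)) (eq_cintegral _ E).
rewrite (cintegral_prod i1 iIH) nsqM IHE nsq_integral_chirp// -/(chirp_width a t).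
have -> : dot x x / (4 * chirp_width a t) =
    (split_Rn x).1 ^+ 2 / (4 * chirp_width a t) + dot (split_Rn x).2 (split_Rn x).2 / (4 * chirp_width a t).
  by rewrite -[in LHS](split_RnK x) dot_cons mulrDl expr2.
set A := _ / (4 * chirp_width a t); set B := _ / (4 * chirp_width a t).
by rewrite (opprD A B) expRD exprS; ring.
Qed.

End chirp.

Section gaussian_solution.
Context {R : realType} (n : nat).
Local Notation leb := (@lebesgue_measure R).
Local Notation mu := (lebesgue_Rn R n).
Local Notation c := ((2 * pi : R) ^+ n).

Definition gaussian_hat (xi : Rn R n) : R[i] :=
  (Num.sqrt pi ^+ n)%:C * (expR (- (4^-1 * dot xi xi)))%:C.

Definition gaussian_flow (z : spacetime R n) : R[i] :=
  (c^-1)%:C * extension gaussian_hat z.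

Lemma integral_gaussian_Rn (a : R) : 0 < a ->
  (\int[mu]_x (expR (- (a * dot x x)))%:E)%E = (Num.sqrt (pi / a) ^+ n)%:E.
Proof.
move=> a0; have z0 (x : Rn R n) : dot [tuple of nseq n 0] x = 0.
  by rewrite /dot big1// => i _; rewrite tnth_nseq mul0r.
have := gauss_fourier_Rn [tuple of nseq n 0] a0.
under eq_fun do rewrite z0 expi0 mulr1.
rewrite z0 mul0r oppr0 expR0 mulr1 cintegral_real => /(congr1 (@complex.Re R)) /=.
rewrite /Rintegral => H; rewrite -[LHS]fineK ?H//.
by apply: integrable_fin_num => //; have [] := cintegrable_gaussian_Rn n a0.
Qed.

Lemma cintegrable_gaussian : cintegrable mu (gaussian R n).
Proof.
have := cintegrable_gaussian_Rn n (ltr01 (R := R)).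
by congr cintegrable; apply/funext => x; rewrite mul1r.
Qed.

Lemma energy_gaussian_Rn (a : R) : 0 < a ->
  energy mu (fun x => (expR (- (a * dot x x)))%:C) = (Num.sqrt (pi / (2 * a)) ^+ n)%:E.
Proof.
move=> a0; rewrite -integral_gaussian_Rn ?mulr_gt0//; apply: eq_integral => x _.
by rewrite nsq_real expr2 -expRD; congr (expR _)%:E; ring.
Qed.

Lemma energy_gaussian : energy mu (gaussian R n) = (Num.sqrt (pi / 2) ^+ n)%:E.
Proof.
have := energy_gaussian_Rn ltr01; rewrite mulr1 => <-.
by apply: eq_integral => x _; rewrite mul1r.
Qed.

Lemma fourier_gaussian : fourier_integral (gaussian R n) = gaussian_hat.
Proof.
apply/funext => xi; rewrite /fourier_integral /gaussian_hat.
have := gauss_fourier_Rn [tuple (- tnth xi i) | i < n] ltr01.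
have E (x : Rn R n) : dot [tuple (- tnth xi i) | i < n] x = - dot x xi.
  by rewrite /dot -sumrN; apply: eq_bigr => i _; rewrite tnth_mktuple mulNr mulrC.
have -> : dot [tuple (- tnth xi i) | i < n] [tuple (- tnth xi i) | i < n] = dot xi xi.
  by apply: eq_bigr => i _; rewrite tnth_mktuple mulrNN.
rewrite divr1 mulr1 => H; rewrite -rmorphM [4^-1 * _]mulrC -[RHS]H.
by apply: eq_cintegral => x; rewrite E mul1r.
Qed.

Lemma cintegrable_gaussian_hat : cintegrable mu gaussian_hat.
Proof. by apply: cintegrableZ; apply: cintegrable_gaussian_Rn; rewrite invr_gt0. Qed.

Lemma energy_gaussian_hat_lty : (energy mu gaussian_hat < +oo)%E.
Proof.
have i4 : (0 : R) < 4^-1 by rewrite invr_gt0.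
apply: energyZ_lty; first exact: cintegrable_cmeasurable (cintegrable_gaussian_Rn n i4).
by rewrite energy_gaussian_Rn// ltry.
Qed.

Lemma nsq_gaussian_flow t x :
  nsq (gaussian_flow (t, x)) =
  Num.sqrt ((1 + (4 * t) ^+ 2)^-1) ^+ n * expR (- (2 * (1 + (4 * t) ^+ 2)^-1 * dot x x)).
Proof.
have i4 : (0 : R) < 4^-1 by rewrite invr_gt0.
have [i1 E] := nsq_integral_chirp_Rn t x i4.
rewrite /gaussian_flow nsqM nsq_real /extension /gaussian_hat.
under eq_fun do rewrite -mulrA.
rewrite cintegralZ// nsqM nsq_real E /chirp_width.
have p0 := pi_gt0 R.
set d := 1 + (4 * t) ^+ 2; have d0 : 0 < d by rewrite ltr_pwDl// sqr_ge0.
have -> : (4^-1 ^+ 2 + t ^+ 2) / (2 * 4^-1) = d / 8 by rewrite /d; field.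
have -> : dot x x / (4 * (d / 8)) = 2 * d^-1 * dot x x by field; rewrite gt_eqF.
rewrite mulrA [LHS]mulrA; congr (_ * _).
rewrite -sqrtrM; last by rewrite divr_ge0 ?mulr_ge0 ?ltW.
have -> : pi / (2 * 4^-1) * (pi / (d / 8)) = (4 * pi) ^+ 2 * d^-1 :> R by field; rewrite gt_eqF.
rewrite sqrtrM ?sqr_ge0// sqrtr_sqr ger0_norm ?mulr_ge0 ?ltW//.
rewrite -exprVn -!exprM [X in _ ^+ X]mulnC [(n * 2)%N]mulnC !exprM -!exprMn.
have key (p r : R) : p != 0 -> (2 * p)^-1 ^+ 2 * p * (4 * p * r) = r by move=> ?; field.
by congr (_ ^+ n); rewrite exprMn sqr_sqrtr ?ltW// key// gt_eqF.
Qed.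

Lemma cmeasurable_gaussian_flow : cmeasurable gaussian_flow.
Proof.
apply: cmeasurableM; first exact: cmeasurable_cst.
exact: cmeasurable_extension (cintegrable_cmeasurable cintegrable_gaussian_hat).
Qed.

Let twisted t xi : R[i] := expi (t * dot xi xi) * gaussian_hat xi.

Let int_twisted t : cintegrable mu (twisted t).
Proof.
have mexp : measurable_fun setT (fun xi : Rn R n => t * dot xi xi).
  by apply: measurable_funM => //; exact: measurable_dot.
have := cintegrable_Rn_twist mexp cintegrable_gaussian_hat.
by congr cintegrable; apply/funext => xi; rewrite mulrC.
Qed.

Let twisted_lty t : (energy mu (twisted t) < +oo)%E.
Proof.
rewrite (_ : energy mu _ = energy mu gaussian_hat) ?energy_gaussian_hat_lty//.
by apply: eq_integral => xi _; rewrite nsqM nsq_expi mul1r.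
Qed.

Let flowE t : (fun x => gaussian_flow (t, x)) = inverse_fourier (twisted t).
Proof. by apply/funext => x; rewrite inverse_fourier_extension. Qed.

Lemma is_schrodinger_gaussian_flow : is_schrodinger (gaussian R n) gaussian_flow.
Proof.
split; first exact: cmeasurable_gaussian_flow.
exists gaussian_hat.
  rewrite -fourier_gaussian; apply: is_fourier_integral; first exact: cintegrable_gaussian.
  by rewrite energy_gaussian ltry.
move=> t; rewrite flowE; apply: is_fourier_inverse => //; rewrite -flowE.
pose d : R := (1 + (4 * t) ^+ 2)^-1.
have d0 : 0 < d by rewrite invr_gt0 ltr_pwDl// sqr_ge0.
have [i1 _] := cintegrable_gaussian_Rn n d0.
apply: (cintegrable_dom _ (integrable_scale (Num.sqrt (Num.sqrt d ^+ n)) i1)).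
  exact: (cmeasurable_comp (measurable_pair1 t) cmeasurable_gaussian_flow).
move=> x; rewrite normcE nsq_gaussian_flow -/d sqrtrM ?exprn_ge0 ?sqrtr_ge0// ler_wpM2l ?sqrtr_ge0//.
rewrite (_ : expR _ = expR (- (d * dot x x)) ^+ 2); last first.
  by rewrite expr2 -expRD; congr expR; ring.
by rewrite sqrtr_sqr ger0_norm ?expR_ge0.
Qed.

Lemma is_schrodinger_gaussian_unique u : is_schrodinger (gaussian R n) u ->
  {ae (leb \x mu)%E, forall z, gaussian_flow z = u z}.
Proof.
move=> [mu_ [fh ffh ufh]].
have mflow := cmeasurable_gaussian_flow.
have E0 : energy mu (fun xi => (fh xi - gaussian_hat xi)%R) = 0%E.
  by rewrite -fourier_gaussian; exact: is_fourier_unique cintegrable_gaussian ffh.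
have slice t : (\int[mu]_x (nsq (gaussian_flow (t, x) - u (t, x)))%:E = 0)%E.
  have ci0 : 0 <= c^-1 by rewrite invr_ge0 ltW// two_pi_gt0.
  have := energy_le_of_cLnorm2 ci0 (is_fourier_inverse_le (ufh t) (int_twisted t) (twisted_lty t)).
  rewrite (_ : energy mu (fun xi => (twisted t xi - expi (t * dot xi xi) * fh xi)%R) = 0%E); last first.
    rewrite -E0; apply: eq_integral => xi _.
    by rewrite -mulrBr nsqM nsq_expi mul1r -nsqN opprB.
  rewrite mule0 => H; apply/eqP; rewrite eq_le; apply/andP; split; last first.
    by apply: integral_ge0 => x _; rewrite lee_fin nsq_ge0.
  by move: H; rewrite -flowE.
have mw : measurable_fun setT (fun z => (nsq (gaussian_flow z - u z))%:E).
  by apply/emeasurable_nsq/cmeasurableB.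
have : energy (leb \x mu)%E (fun z => gaussian_flow z - u z) = 0%E.
  rewrite /energy (fubini_tonelli1 (fun z => (nsq (gaussian_flow z - u z))%:E))//; last first.
    by move=> z; rewrite lee_fin nsq_ge0.
  by apply: integral0_eq => t _; exact: slice.
move=> /(ae_eq0_of_energy0 (cmeasurableB mflow mu_)); apply: filterS => z /eqP.
by rewrite subr_eq0 => /eqP.
Qed.

End gaussian_solution.

(** * Sharp constants *)

Lemma cLnorm_even d (T : measurableType d) (R : realType)
  (mu : {measure set T -> \bar R}) (k : nat) (u : T -> R[i]) :
  cLnorm mu (2 * k%:R) u = ((\int[mu]_x (nsq (u x) ^+ k)%:E) `^ (2 * k%:R)^-1)%E.
Proof.
rewrite /cLnorm unlock; congr (_ `^ _)%E; apply: eq_integral => x _.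
rewrite abse_EFin ger0_norm ?normc_ge0// poweR_EFin -natrM powR_mulrn ?normc_ge0//.
by rewrite exprM normc_sqr.
Qed.

Section sharp_constant.
Context {R : realType} (n k : nat) (A : R).
Local Notation leb := (@lebesgue_measure R).
Local Notation mu := (lebesgue_Rn R n).
Local Notation c := ((2 * pi : R) ^+ n).
Local Notation q := ((2 * k%:R : R)^-1).
Hypothesis k0 : (0 < k)%N.
Hypothesis exponentE : strichartz_exponent R n = 2 * k%:R.
Hypothesis A0 : 0 <= A.
Hypothesis frequency_bound : forall (g : Rn R n -> R[i]) (e : R), 0 <= e ->
  cintegrable mu g -> (energy mu g <= (c * e)%:E)%E ->
  (\int[leb \x mu]_z (nsq ((c^-1)%:C * extension g z) ^+ k)%:E <= (A * e ^+ k)%:E)%E.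
Hypothesis gaussianE :
  (\int[leb \x mu]_z (nsq (gaussian_flow (n := n) z) ^+ k)%:E)%E =
  (A * (Num.sqrt (pi / 2) ^+ n) ^+ k)%:E.

Let power (e : R) : 0 <= e -> (A * e ^+ k) `^ q = A `^ q * e `^ 2^-1.
Proof.
move=> e0; rewrite powRM ?exprn_ge0//; congr (_ * _).
rewrite -powR_mulrn// -powRrM; congr (_ `^ _); field.
by rewrite pnatr_eq0 -lt0n.
Qed.

Let norm_energy f (e : R) : energy mu f = e%:E -> cLnorm mu 2 f = (e `^ 2^-1)%:E.
Proof. by move=> fe; rewrite cLnorm2E fe poweR_EFin. Qed.

Lemma strichartz_norm_le f : cLp mu 2 f ->
  (strichartz_norm f <= (A `^ q)%:E * cLnorm mu 2 f)%E.
Proof.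
move=> /cLp2P[mf foo]; have [e e0 fe] := ge0_lty_EFin (energy_ge0 mu f) foo.
rewrite (norm_energy fe) -EFinM -power// /strichartz_norm exponentE cLnorm_even -poweR_EFin.
apply: gt0_ler_poweR.
- by rewrite invr_ge0 mulr_ge0.
- rewrite in_itv /= leey andbT; apply: integral_ge0 => z _.
  by rewrite lee_fin exprn_ge0// nsq_ge0.
- by rewrite in_itv /= leey andbT lee_fin mulr_ge0// exprn_ge0.
have [[u su]|none] := pselect (exists u, is_schrodinger f u).
  have su' : is_schrodinger f (schrodinger f) := xgetPex _ (ex_intro _ u su).
  by apply: (strichartz_le frequency_bound e0 _ su') => //; rewrite fe.
have -> : schrodinger f = fun=> 0.
  by apply: xgetPN => u su; apply: none; exists u.
rewrite integral0_eq ?lee_fin ?mulr_ge0 ?exprn_ge0// => z _.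
by rewrite /nsq /= expr0n /= addr0 expr0n eqn0Ngt k0.
Qed.

Lemma strichartz_norm_gaussian :
  strichartz_norm (gaussian R n) = ((A `^ q)%:E * cLnorm mu 2 (gaussian R n))%E.
Proof.
have e0 : 0 <= Num.sqrt (pi / 2) ^+ n :> R by rewrite exprn_ge0 ?sqrtr_ge0.
rewrite (norm_energy (energy_gaussian n)) -EFinM -power// /strichartz_norm exponentE.
rewrite cLnorm_even -poweR_EFin -gaussianE; congr (_ `^ _)%E.
have su : is_schrodinger (gaussian R n) (schrodinger (gaussian R n)) :=
  xgetPex _ (ex_intro _ _ (is_schrodinger_gaussian_flow n)).
apply: ae_eq_integral => //.
- by apply/measurable_EFinP/measurable_funX/measurable_nsq; case: su.
- by apply/measurable_EFinP/measurable_funX/measurable_nsq/cmeasurable_gaussian_flow.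
- by apply: filterS (is_schrodinger_gaussian_unique su) => z -> _.
Qed.

Lemma L2_nonzero_norm f : L2_nonzero f -> exists2 r : R, 0 < r & cLnorm mu 2 f = r%:E.
Proof.
move=> [/cLp2P[mf foo] fN0]; have [e e0 fe] := ge0_lty_EFin (energy_ge0 mu f) foo.
exists (e `^ 2^-1); last exact: norm_energy.
rewrite powR_gt0// lt_neqAle e0 andbT eq_sym; apply/eqP => ez; apply: fN0.
rewrite ez in fe; apply: filterS (ae_eq0_of_energy0 mf fe) => x fx _.
exact: fx.
Qed.

Lemma L2_nonzero_gaussian : L2_nonzero (gaussian R n).
Proof.
have p0 : 0 < Num.sqrt (pi / 2) ^+ n :> R by rewrite exprn_gt0// sqrtr_gt0 divr_gt0// pi_gt0.
have mg := cintegrable_cmeasurable (cintegrable_gaussian n (R := R)).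
split; first by apply/cLp2P; split => //; rewrite energy_gaussian ltry.
move=> g0; have := energy_gaussian n (R := R).
rewrite (ae_eq_energy mg (cmeasurable_cst _ 0)); last by apply: filterS g0 => x /(_ Logic.I).
by rewrite energy0 => -[] /eqP; rewrite lt_eqF.
Qed.

Lemma strichartz_constantE : strichartz_constant R n = (A `^ q)%:E.
Proof.
apply/eqP; rewrite eq_le; apply/andP; split.
  apply: ge_ereal_sup => _ [f Lf <-]; have [r r0 fr] := L2_nonzero_norm Lf.
  rewrite fr inver gt_eqF// lee_pdivrMr// -fr; apply: strichartz_norm_le.
  by case: Lf.
apply: ereal_sup_ubound; exists (gaussian R n); first exact: L2_nonzero_gaussian.
have [r r0 fr] := L2_nonzero_norm L2_nonzero_gaussian.
by rewrite strichartz_norm_gaussian fr inver gt_eqF// -!EFinM mulfK// gt_eqF.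
Qed.

Lemma strichartz_maximizer_gaussian : strichartz_maximizer (gaussian R n).
Proof.
split; first exact: L2_nonzero_gaussian.
by rewrite strichartz_constantE strichartz_norm_gaussian.
Qed.

End sharp_constant.

Section constants.
Context {R : realType}.
Local Notation leb := (@lebesgue_measure R).
Local Notation mu n := (lebesgue_Rn R n).

Lemma integral_gaussian_flow n k : (n * k = n + 2)%N -> (0 < k)%N ->
  (\int[leb \x mu n]_z (nsq (gaussian_flow (R := R) z) ^+ k)%:E)%E =
  (pi / 4 * Num.sqrt (pi / (2 * k%:R)) ^+ n)%:E.
Proof.
move=> nk k0; have k0R : (0 : R) < k%:R by rewrite ltr0n.
rewrite (fubini_tonelli1 (fun z => (nsq (gaussian_flow (R := R) (n := n) z) ^+ k)%:E)); last 2 first.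
- exact/measurable_EFinP/measurable_funX/measurable_nsq/cmeasurable_gaussian_flow.
- by move=> z; rewrite lee_fin exprn_ge0// nsq_ge0.
pose d (t : R) : R := (1 + (4 * t) ^+ 2)^-1.
have d0 t : 0 < d t by rewrite invr_gt0 ltr_pwDl// sqr_ge0.
have md : measurable_fun setT (fun t : R => ((1 + t ^+ 2)^-1)%:E).
  apply/measurable_EFinP; apply: continuous_measurable_fun => t.
  apply: cvgV; first by rewrite gt_eqF// ltr_pwDl// sqr_ge0.
  by apply: cvgD; [exact: cvg_cst|exact: exprn_continuous].
transitivity (\int[leb]_t ((d t)%:E * (Num.sqrt (pi / (2 * k%:R)) ^+ n)%:E))%E.
  apply: eq_integral => t _; rewrite /fubini_F.
  have a0 : 0 < 2 * k%:R * d t by rewrite !mulr_gt0.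
  transitivity (\int[mu n]_x ((Num.sqrt (d t) ^+ (n * k))%:E * (expR (- (2 * k%:R * d t * dot x x)))%:E))%E.
    apply: eq_integral => x _; rewrite nsq_gaussian_flow -/(d t) -EFinM exprMn -exprM.
    by congr (_ * _)%:E; rewrite -expRM_natl; congr expR; rewrite -/(d t); ring.
  have [i1 _] := cintegrable_gaussian_Rn n a0.
  rewrite ge0_integralZl//; last first.
    exact: measurable_int i1.
  rewrite integral_gaussian_Rn// -!EFinM; congr EFin.
  have -> : Num.sqrt (d t) ^+ (n * k) = d t * Num.sqrt (d t) ^+ n.
    by rewrite nk exprD sqr_sqrtr ?ltW// mulrC.
  rewrite -(mulrA (d t)) -exprMn -sqrtrM ?ltW//.
  congr (_ * Num.sqrt _ ^+ _); field; by rewrite !gt_eqF.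
rewrite ge0_integralZr//; last 2 first.
- exact: (measurableT_comp md (mulrl_measurable 4 (D := setT))).
- by move=> t _; rewrite lee_fin ltW.
have := @ge0_integral_affine R 4 0 _ (fun t => ((1 + t ^+ 2)^-1)%:E) md _.
rewrite integral_inv1D => H.
rewrite (_ : (\int[_]_t _)%E = (pi / 4)%:E) ?EFinM//.
rewrite muleC -H//; last by move=> t; rewrite lee_fin invr_ge0 ltW// ltr_pwDl// sqr_ge0.
by apply: eq_integral => t _; rewrite addr0.
Qed.

Lemma integral_scale_nsq d (T : measurableType d) (m : {measure set T -> \bar R})
  (a : R) (k : nat) (f : T -> R[i]) : cmeasurable f ->
  (\int[m]_x (nsq (a%:C * f x) ^+ k)%:E =
   ((a ^+ 2) ^+ k)%:E * \int[m]_x (nsq (f x) ^+ k)%:E)%E.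
Proof.
move=> mf; rewrite -ge0_integralZl//.
- by apply: eq_integral => x _; rewrite nsqM nsq_real exprMn EFinM.
- exact/measurable_EFinP/measurable_funX/measurable_nsq.
- by move=> x _; rewrite lee_fin exprn_ge0// nsq_ge0.
- by rewrite lee_fin exprn_ge0// sqr_ge0.
Qed.

Lemma powR12N : 12 `^ (- (1 / 2)) = (2 * Num.sqrt 3)^-1 :> R.
Proof.
rewrite powRN mul1r powR12_sqrt//; congr (_^-1).
have -> : 12 = 2 ^+ 2 * 3 :> R by ring.
by rewrite sqrtrM ?sqr_ge0// sqrtr_sqr ger0_norm.
Qed.

Lemma frequency_bound_line (g : Rn R 1 -> R[i]) (e : R) : 0 <= e ->
  cintegrable (mu 1) g -> (energy (mu 1) g <= ((2 * pi) ^+ 1 * e)%:E)%E ->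
  (\int[leb \x mu 1]_z (nsq ((((2 * pi) ^+ 1)^-1)%:C * extension g z) ^+ 3)%:E <=
   (12 `^ (- (1 / 2)) * e ^+ 3)%:E)%E.
Proof.
move=> e0 ig ge; have mg := cintegrable_cmeasurable ig.
have goo : (energy (mu 1) g < +oo)%E by exact: le_lt_trans ge (ltry _).
have p0 : 0 < 2 * pi :> R by rewrite mulr_gt0 ?pi_gt0.
have E0 := energy_ge0 (mu 1) g.
have c0 : 0 <= ((2 * pi) ^-1 ^+ 2) ^+ 3 :> R by rewrite !exprn_ge0// invr_ge0 ltW.
rewrite integral_scale_nsq ?expr1//; last exact: cmeasurable_extension.
apply: (le_trans (lee_wpmul2l _ (extension_line_le ig goo))); first by rewrite lee_fin.
have K0 : 0 <= (2 * pi) ^+ 2 * (pi / Num.sqrt 3) :> R.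
  by rewrite mulr_ge0 ?exprn_ge0 ?divr_ge0 ?sqrtr_ge0 ?pi_ge0// ltW.
have ee := lee_pmul E0 (mule_ge0 E0 E0) ge (lee_pmul E0 E0 ge ge).
apply: (le_trans (lee_wpmul2l _ (lee_wpmul2l _ ee))); rewrite ?lee_fin//.
apply: le_of_eq.
rewrite powR12N.
have s0 : Num.sqrt 3 != 0 :> R by rewrite gt_eqF// sqrtr_gt0.
have key (p s : R) : p != 0 -> s != 0 -> ((2 * p)^-1 ^+ 2) ^+ 3 * ((2 * p) ^+ 2 * (p / s) *
  ((2 * p) ^+ 1 * e * ((2 * p) ^+ 1 * e * ((2 * p) ^+ 1 * e)))) = (2 * s)^-1 * e ^+ 3.
  by move=> p1 s1; field; rewrite p1 s1.
by apply: key => //; rewrite gt_eqF// pi_gt0.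
Qed.

Lemma frequency_bound_plane (g : Rn R 2 -> R[i]) (e : R) : 0 <= e ->
  cintegrable (mu 2) g -> (energy (mu 2) g <= ((2 * pi) ^+ 2 * e)%:E)%E ->
  (\int[leb \x mu 2]_z (nsq ((((2 * pi) ^+ 2)^-1)%:C * extension g z) ^+ 2)%:E <=
   (4^-1 * e ^+ 2)%:E)%E.
Proof.
move=> e0 ig ge; have mg := cintegrable_cmeasurable ig.
have goo : (energy (mu 2) g < +oo)%E by exact: le_lt_trans ge (ltry _).
have p0 : 0 < 2 * pi :> R by rewrite mulr_gt0 ?pi_gt0.
have E0 := energy_ge0 (mu 2) g.
have c0 : 0 <= (((2 * pi) ^+ 2) ^-1 ^+ 2) ^+ 2 :> R by rewrite !exprn_ge0// invr_ge0 exprn_ge0// ltW.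
rewrite integral_scale_nsq//; last exact: cmeasurable_extension.
apply: (le_trans (lee_wpmul2l _ (extension_plane_le ig goo))); first by rewrite lee_fin.
have K0 : 0 <= (2 * pi) ^+ 3 * (pi / 2) :> R.
  by rewrite mulr_ge0 ?exprn_ge0 ?divr_ge0 ?pi_ge0// ltW.
have ee := lee_pmul E0 E0 ge ge.
apply: (le_trans (lee_wpmul2l _ (lee_wpmul2l _ ee))); rewrite ?lee_fin//.
apply: le_of_eq.
have key (p : R) : p != 0 -> (((2 * p) ^+ 2)^-1 ^+ 2) ^+ 2 * ((2 * p) ^+ 3 * (p / 2) *
  ((2 * p) ^+ 2 * e * ((2 * p) ^+ 2 * e))) = 4^-1 * e ^+ 2.
  by move=> p1; field.
by apply: key => //; rewrite gt_eqF// pi_gt0.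
Qed.

End constants.

Theorem theorem1p1 (R : realType) :
  [/\ strichartz_exponent R 1 = 6,
      strichartz_constant R 1 = (12 `^ (- (1 / 12)))%:E &
      strichartz_maximizer (gaussian R 1)] /\
  [/\ strichartz_exponent R 2 = 4,
      strichartz_constant R 2 = (2 `^ (- (1 / 2)))%:E &
      strichartz_maximizer (gaussian R 2)].
Proof.
have p0 : 0 < pi :> R by exact: pi_gt0.
have x1 : strichartz_exponent R 1 = 2 * 3%:R by rewrite /strichartz_exponent; field.
have x2 : strichartz_exponent R 2 = 2 * 2%:R by rewrite /strichartz_exponent; field.
have A1 : 0 <= 12 `^ (- (1 / 2)) :> R by exact: powR_ge0.
have A2 : 0 <= 4^-1 :> R by rewrite invr_ge0.
have g1 : (\int[@lebesgue_measure R \x lebesgue_Rn R 1]_z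
    (nsq (gaussian_flow (R := R) z) ^+ 3)%:E)%E =
    (12 `^ (- (1 / 2)) * (Num.sqrt (pi / 2) ^+ 1) ^+ 3)%:E.
  rewrite integral_gaussian_flow//; congr EFin.
  rewrite !expr1 exprS sqr_sqrtr ?divr_ge0 ?ltW//.
  rewrite powR12N.
  rewrite (_ : pi / (2 * 3%:R) = pi / 2 * 3^-1); last by field.
  rewrite sqrtrM ?divr_ge0 ?ltW// sqrtrV//; field.
  by rewrite gt_eqF// sqrtr_gt0.
have g2 : (\int[@lebesgue_measure R \x lebesgue_Rn R 2]_z
    (nsq (gaussian_flow (R := R) z) ^+ 2)%:E)%E =
    (4^-1 * (Num.sqrt (pi / 2) ^+ 2) ^+ 2)%:E.
  rewrite integral_gaussian_flow//; congr EFin.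
  rewrite !sqr_sqrtr ?divr_ge0 ?mulr_ge0 ?ltW//.
  by field.
split; split.
- by rewrite x1; ring.
- rewrite (strichartz_constantE _ x1 A1 frequency_bound_line g1)// -powRrM.
  by congr (_ `^ _)%:E; field.
- exact: (strichartz_maximizer_gaussian _ x1 A1 frequency_bound_line g1).
- by rewrite x2; ring.
- rewrite (strichartz_constantE _ x2 A2 frequency_bound_plane g2)//; congr EFin.
  have -> : 4^-1 = 2 `^ (- 2) :> R.
    by rewrite powRN (powR_mulrn 2)//; congr (_^-1); ring.
  by rewrite -powRrM; congr (_ `^ _); field.
- exact: (strichartz_maximizer_gaussian _ x2 A2 frequency_bound_plane g2).
Qed.
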